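(* Assume scalar target signals ($d_s=1$). Let $P(z)=\sum_{k=-m}^mp_kz^{-k}$ and $Q(z)=\sum_{k=-m}^mq_kz^{-k}$ be Laurent polynomials of degree $m$ with real symmetric coefficients ($p_{-k}=p_k$, $q_{-k}=q_k$) satisfying $P(z)>0$, $Q(z)>0$ for all $z$ on the unit circle. Then the spectral factorization $U(z)^\ast U(z)=P(z)/Q(z)$ admits a rational factor $U(z)$. Furthermore, the filter $$K(z)=K_{H_2}(z)+U(z)^{-1}\big\{U(z)\{K_\circ(z)\Delta(z)\}_-\big\}_+\Delta(z)^{-1}$$ is rational and can be realized as a state-space filter $$\zeta_{t+1}=\widetilde{F}\zeta_t+\widetilde{G}y_t,\qquad \widehat{s}_t=\widetilde{H}\zeta_t+\widetilde{L}y_t,$$ with filter state $\zeta_t\in\mathbb{R}^{m+d_x}$, where $(\widetilde{F},\widetilde{G},\widetilde{H},\widetilde{L})$ are determined from $(A,B,C_y,C_s)$ and $U(z)$.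
   Context: State-space model: $x_{t+1}=Ax_t+Bw_t$, $y_t=C_yx_t+v_t$, $s_t=C_sx_t$ with $x_t\in\mathbb{R}^{d_x}$, $(A,C_y)$, $(A,C_s)$ detectable and $(A,B)$ controllable. Transfer functions $H(z)=C_y(zI-A)^{-1}B$, $L(z)=C_s(zI-A)^{-1}B$. $K_\circ(z)=L(z)H(z)^\ast(I+H(z)H(z)^\ast)^{-1}$ is the non-causal Wiener estimator. $\Delta(z)\Delta(z)^\ast=I+H(z)H(z)^\ast$ is the canonical spectral factorization ($\Delta,\Delta^{-1}$ causal). $\{\cdot\}_+$ and $\{\cdot\}_-$ denote the causal and strictly anti-causal parts of a transfer function (terms with nonpositive, resp. positive, powers of $z$ in its Laurent expansion on the unit circle). $K_{H_2}(z)=\{K_\circ(z)\Delta(z)\}_+\Delta(z)^{-1}$ is the Kalman filter. The spectral factor $U(z)$ is the canonical one ($U$ and $U^{-1}$ causal). *)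

(* Defs.v *)
From HB Require Import structures.
From mathcomp Require Import all_boot all_order all_algebra.
From mathcomp Require Import all_classical all_reals all_analysis.
From mathcomp Require Import complex.
Set Implicit Arguments. Unset Strict Implicit. Unset Printing Implicit Defensive.
Import Order.TTheory GRing.Theory Num.Theory.
Import numFieldNormedType.Exports.
Local Open Scope ring_scope.

Section Defs.
Variable R : realType.

Definition toC (x : R) : R[i] := (x +i* 0)%C.
Definition mxC m n (M : 'M[R]_(m, n)) : 'M[R[i]]_(m, n) := map_mx toC M.

Definition expi (t : R) : R[i] := (cos t +i* sin t)%C.

Definition zinv (t : R) (k : int) : R[i] := expi (- (k%:~R * t)).

(* a (p x q matrix-valued) transfer function, given by its values on the
   unit circle: F t = F(e^{it}) *)
Definition tf p q := R -> 'M[R[i]]_(p, q).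

(* conjugate transpose: on the unit circle F(z)^* is the conjugate transpose *)
Definition ctr m n (M : 'M[R[i]]_(m, n)) : 'M[R[i]]_(n, m) :=
  (map_mx Num.conj M)^T.

Definition cabs (x : R[i]) : R :=
  Num.sqrt (complex.Re x ^+ 2 + complex.Im x ^+ 2).

Definition circle_int (f : R -> R[i]) : R[i] :=
  (Rintegral (@lebesgue_measure R) `[0, 2 * pi]%classic (fun t => complex.Re (f t))
   +i* Rintegral (@lebesgue_measure R) `[0, 2 * pi]%classic (fun t => complex.Im (f t)))%C.

(* k-th coefficient of the Laurent expansion on the unit circle,
   F(z) = \sum_k f_k z^{-k}, i.e. f_k = (1/2pi) \int_0^{2pi} F(e^{it}) e^{ikt} dt *)
Definition fcoef p q (F : tf p q) (k : int) : 'M[R[i]]_(p, q) :=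
  \matrix_(i, j) (toC (2 * pi)^-1 * circle_int (fun t => F t i j * expi (k%:~R * t))).

Definition clim (u : nat -> R[i]) : R[i] :=
  (limn (fun n => complex.Re (u n)) +i* limn (fun n => complex.Im (u n)))%C.

Definition causal_part p q (F : tf p q) : tf p q := fun t =>
  \matrix_(i, j) clim (fun n => \sum_(k < n) fcoef F k%:Z i j * zinv t k%:Z).

Definition anticausal_part p q (F : tf p q) : tf p q := fun t =>
  \matrix_(i, j) clim (fun n =>
     \sum_(k < n) fcoef F (- (k.+1)%:Z) i j * zinv t (- (k.+1)%:Z)).

Definition causal_tf p q (F : tf p q) : Prop :=
  exists d : nat -> 'M[R[i]]_(p, q),
    (exists M : R, forall n, \sum_(k < n) \sum_i \sum_j cabs (d k i j) <= M) /\
    forall t, F t = \matrix_(i, j) clim (fun n => \sum_(k < n) d k i j * zinv t k%:Z).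

Definition inv_tf n (F : tf n n) : tf n n := fun t => invmx (F t).

(* canonical spectral factor D of S:  D D^* = S on the unit circle (wherever
   S is defined, i.e. where [good t] holds), D and D^{-1} causal *)
Definition lcanonical_factor n (good : R -> Prop) (S : tf n n) (D : tf n n) :=
  [/\ causal_tf D, (forall t, D t \in unitmx), causal_tf (inv_tf D)
    & forall t, good t -> D t *m ctr (D t) = S t].

Definition rcanonical_factor n (good : R -> Prop) (S : tf n n) (U : tf n n) :=
  [/\ causal_tf U, (forall t, U t \in unitmx), causal_tf (inv_tf U)
    & forall t, good t -> ctr (U t) *m U t = S t].

Definition rational_tf p q (F : tf p q) : Prop :=
  exists (N : 'M[{poly R[i]}]_(p, q)) (d : {poly R[i]}),
    forall t, d.[expi t] != 0 /\
      F t = d.[expi t]^-1 *: map_mx (fun r => r.[expi t]) N.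

Definition lpoly (p : int -> R) (m : nat) (t : R) : R[i] :=
  \sum_(i < (m + m).+1) toC (p (i%:Z - m%:Z)) * zinv t (i%:Z - m%:Z).

Definition ss_tf dx dw k (A : 'M[R]_dx) (B : 'M[R]_(dx, dw)) (Cm : 'M[R]_(k, dx))
  : tf k dw := fun t => mxC Cm *m invmx ((expi t)%:M - mxC A) *m mxC B.

(* e^{it} is not an eigenvalue of A (the transfer functions are defined there) *)
Definition regular_pt dx (A : 'M[R]_dx) (t : R) : Prop :=
  ((expi t)%:M - mxC A) \in unitmx.

(* detectability (PBH): every mode with |lambda| >= 1 is observable *)
Definition detectable dx k (A : 'M[R]_dx) (Cm : 'M[R]_(k, dx)) : Prop :=
  forall lam : R[i], 1 <= `|lam| ->
    \rank (col_mx (lam%:M - mxC A) (mxC Cm)) = dx.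

(* controllability (Kalman rank condition): rank [B, AB, ..., A^{dx-1}B] = dx,
   expressed as: the column spaces of A^i B (i < dx) span R^dx *)
Definition controllable dx dw (A : 'M[R]_dx) (B : 'M[R]_(dx, dw)) : Prop :=
  (1%:M <= \sum_(i < dx) <<(A ^+ i *m B)^T>>)%MS.

Definition wiener_nc dy dw (H : tf dy dw) (L : tf 1 dw) : tf 1 dy := fun t =>
  L t *m ctr (H t) *m invmx (1%:M + H t *m ctr (H t)).

Definition kalman_tf dy (Ko : tf 1 dy) (D : tf dy dy) : tf 1 dy := fun t =>
  causal_part (fun s => Ko s *m D s) t *m invmx (D t).

Definition filter_tf dy (Ko : tf 1 dy) (D : tf dy dy) (U : tf 1 1) : tf 1 dy :=
  fun t => kalman_tf Ko D t
    + invmx (U t) *m causal_part (fun s => U s *m anticausal_part (fun r => Ko r *m D r) s) t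
      *m invmx (D t).

(* F is realized by the (stable, causal) state-space filter
   zeta_{t+1} = Ft zeta_t + Gt y_t, shat_t = Ht zeta_t + Lt y_t, zeta_t in R^n:
   F(z) = Lt + Ht (zI - Ft)^{-1} Gt on the unit circle *)
Definition realizes p q (F : tf p q) n (Ft : 'M[R]_n) (Gt : 'M[R]_(n, q))
  (Ht : 'M[R]_(p, n)) (Lt : 'M[R]_(p, q)) : Prop :=
  (forall lam : R[i], root (char_poly (mxC Ft)) lam -> `|lam| < 1) /\
  forall t, F t = mxC Lt + mxC Ht *m invmx ((expi t)%:M - mxC Ft) *m mxC Gt.

End Defs.

(* Main.v *)
(** All functions live in the Wiener algebra of absolutely convergent Laurent series
    on the circle, where a causal function whose adjoint is causal is constant; hence
    canonical factors are unique up to a constant unitary. By Fejer-Riesz,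
    P = k |P1|^2 and Q = l |Q1|^2 with monic P1, Q1 of degree m having all their roots
    in the open disc, so that U is a constant multiple of P1 / Q1.

    Since D is bounded on the circle, the PBH tests exclude eigenvalues of A of modulus
    one. Put T = K_o D, G = (zI - A)^{-1}, Y = D^{-*}, lam = G^* C_y^* Y and
    Z = G B B^* lam. Then T = C_s Z, D = Y + C_y Z with Y anticausal, and the strictly
    causal Laurent coefficients of (Z, lam) form a bounded solution of a block triangular
    linear recursion whose bounded solutions span at most d_x dimensions. Writing the
    filter as K = V D^{-1}, the product P1 V agrees with P1 T up to a strictly
    anticausal term, so a dimension count gives a scalar polynomial c of degree at most
    d_x and a row polynomial N, not both zero, with c P1 V = N D, that is c P1 K = N.

    K is causal with real coefficients, as conjugation preserves the canonical factors
    up to constants. The monic polynomial a of least degree such that a K is a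
    polynomial is then real with all its roots in the open disc, and its companion
    matrix (after multiplication by a power of z) realizes K in dimension m + d_x. *)

Require Import Defs.
From HB Require Import structures.
From mathcomp Require Import all_boot all_order all_algebra.
From mathcomp Require Import all_classical all_reals all_analysis.
From mathcomp Require Import complex.
From mathcomp Require Import ring lra zify measurable_realfun.
Set Implicit Arguments. Unset Strict Implicit. Unset Printing Implicit Defensive.
Import Order.TTheory GRing.Theory Num.Theory.
Import numFieldNormedType.Exports.
Local Open Scope classical_set_scope.
Local Open Scope ring_scope.

(** * Complex limits *)

(** The factors are arbitrary canonical factors known only through their values on the circle, and
    no Riccati equation is solved. [A] may have eigenvalues on both sides of the circle, so (zI -
    A)^{-1} has a two-sided Laurent series and Z need not be causal or anticausal. The delicate
    quantity is the d_x in the state dimension, since the pair (Z, lam) has 2 d_x components. [A]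
    drives Z forward while its transpose drives lam backward, so decaying and growing modes come in
    pairs, and boundedness keeps at most half of them. This selection does the work of the
    stabilizing Riccati solution. A second obstacle is reality: the factors are complex and fixed
    only up to constants, whereas the realization must be real. Reality is therefore proved for K,
    in which the constants cancel. Finally, the annihilator c P1 found by counting may have roots
    outside the disc. They can be divided out because the coefficients of a Wiener function are
    summable and cannot satisfy a recursion that does not decay. *)

Section Cabs.
Variable R : realType.
Local Notation C := R[i].
Implicit Types x y : C.

Lemma cabsE x : (cabs x)%:C%C = `|x|.
Proof. by rewrite normc_def. Qed.

Lemma cabsM x y : cabs (x * y) = cabs x * cabs y.
Proof. by apply: complexI; rewrite rmorphM /= !cabsE normrM. Qed.

Lemma cabsD x y : cabs (x + y) <= cabs x + cabs y.
Proof. by rewrite -lecR rmorphD /= !cabsE ler_normD. Qed.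

Lemma cabsN x : cabs (- x) = cabs x.
Proof. by apply: complexI; rewrite !cabsE normrN. Qed.

Lemma cabs_ge0 x : 0 <= cabs x.
Proof. exact: sqrtr_ge0. Qed.

Lemma cabs0 : cabs (0 : C) = 0.
Proof. by apply: complexI; rewrite cabsE normr0. Qed.

Lemma cabs1 : cabs (1 : C) = 1.
Proof. by apply: complexI; rewrite cabsE normr1. Qed.

Lemma cabsX x n : cabs (x ^+ n) = cabs x ^+ n.
Proof. by elim: n => [|n IH]; rewrite ?expr0 ?cabs1// !exprS cabsM IH. Qed.

Lemma cabs_eq0 x : (cabs x == 0) = (x == 0).
Proof. by rewrite -(inj_eq (@complexI R)) cabsE normr_eq0. Qed.

Lemma cabs_conj x : cabs (Num.conj x) = cabs x.
Proof. by case: x => a b; rewrite /cabs /= sqrrN. Qed.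

Lemma cabsV x : cabs (x^-1) = (cabs x)^-1.
Proof. by apply: complexI; rewrite fmorphV /= !cabsE normfV. Qed.

Lemma toCE (r : R) : toC r = r%:C%C.
Proof. by []. Qed.

Lemma cabs_toC (r : R) : cabs (toC r) = `|r|.
Proof. by rewrite /cabs /= expr0n /= addr0 sqrtr_sqr. Qed.

Lemma cabs_sum (I : Type) (s : seq I) (P : pred I) (F : I -> C) :
  cabs (\sum_(i <- s | P i) F i) <= \sum_(i <- s | P i) cabs (F i).
Proof.
elim/big_ind2: _ => //; first by rewrite cabs0.
by move=> ? ? ? ? h1 h2; apply: le_trans (cabsD _ _) (lerD h1 h2).
Qed.

Lemma Re_cabs x : `|complex.Re x| <= cabs x.
Proof. by rewrite -sqrtr_sqr ler_wsqrtr // lerDl sqr_ge0. Qed.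

Lemma Im_cabs x : `|complex.Im x| <= cabs x.
Proof. by rewrite -sqrtr_sqr ler_wsqrtr // lerDr sqr_ge0. Qed.

Lemma cabs_lt1 x : (cabs x < 1) = (`|x| < 1).
Proof. by rewrite -ltcR cabsE. Qed.

Lemma cabs_le1 x : (1 <= cabs x) = (1 <= `|x|).
Proof. by rewrite -lecR cabsE. Qed.

Lemma cReD x y : complex.Re (x + y) = complex.Re x + complex.Re y.
Proof. by case: x y => [a b] [c d]. Qed.

Lemma cImD x y : complex.Im (x + y) = complex.Im x + complex.Im y.
Proof. by case: x y => [a b] [c d]. Qed.

Lemma cReM x y : complex.Re (x * y) =
  complex.Re x * complex.Re y - complex.Im x * complex.Im y.
Proof. by case: x y => [a b] [c d]. Qed.

Lemma cImM x y : complex.Im (x * y) =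
  complex.Re x * complex.Im y + complex.Im x * complex.Re y.
Proof. by case: x y => [a b] [c d]. Qed.

Lemma cRe_sum (I : Type) (s : seq I) (P : pred I) (F : I -> C) :
  complex.Re (\sum_(i <- s | P i) F i) = \sum_(i <- s | P i) complex.Re (F i).
Proof. by elim/big_ind2: _ => // a b c d <- <-; rewrite cReD. Qed.

Lemma cIm_sum (I : Type) (s : seq I) (P : pred I) (F : I -> C) :
  complex.Im (\sum_(i <- s | P i) F i) = \sum_(i <- s | P i) complex.Im (F i).
Proof. by elim/big_ind2: _ => // a b c d <- <-; rewrite cImD. Qed.

End Cabs.

Section Ccvg.
Variable R : realType.
Local Notation C := R[i].

(** Componentwise, to match [clim], whose two real limits are default values on divergent sequences.
    Every evaluation of [clim] therefore goes through a convergence proof of this shape. *)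
Definition ccvg (u : nat -> C) (l : C) : Prop :=
  (complex.Re (u n) @[n --> \oo] --> complex.Re l) /\
  (complex.Im (u n) @[n --> \oo] --> complex.Im l).

Lemma ccvg_clim u l : ccvg u l -> clim u = l.
Proof.
by case: l => a b [h1 h2]; rewrite /clim; congr (_ +i* _)%C; apply: cvg_lim.
Qed.

Lemma ccvg_cst l : ccvg (fun=> l) l.
Proof. by split; apply: cvg_cst. Qed.

Lemma ccvgD u v l k : ccvg u l -> ccvg v k -> ccvg (fun n => u n + v n) (l + k).
Proof.
by move=> [a b] [c d]; split; rewrite ?cReD ?cImD;
  under eq_fun do rewrite ?cReD ?cImD; apply: cvgD.
Qed.

Lemma ccvgM u v l k : ccvg u l -> ccvg v k -> ccvg (fun n => u n * v n) (l * k).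
Proof.
move=> [a b] [c d]; split.
  rewrite cReM; under eq_fun do rewrite cReM.
  by apply: cvgB; apply: cvgM.
rewrite cImM; under eq_fun do rewrite cImM.
by apply: cvgD; apply: cvgM.
Qed.

Lemma ccvgZ a u l : ccvg u l -> ccvg (fun n => a * u n) (a * l).
Proof. by move=> h; apply: ccvgM h; apply: ccvg_cst. Qed.

Lemma ccvg_conj u l : ccvg u l -> ccvg (fun n => Num.conj (u n)) (Num.conj l).
Proof.
move=> [a b]; split.
  have -> : complex.Re (Num.conj l) = complex.Re l by case: (l).
  by apply: cvg_trans a; apply: near_eq_cvg; apply: nearW => n; case: (u n).
have -> : complex.Im (Num.conj l) = - complex.Im l by case: (l).
have -> : (fun n => complex.Im (Num.conj (u n))) = (fun n => - complex.Im (u n)).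
  by apply/funext => n; case: (u n).
exact: cvgN.
Qed.

Lemma ccvgS u l : ccvg (fun n => u n.+1) l <-> ccvg u l.
Proof.
split=> -[a b]; split.
- by rewrite -cvg_shiftS.
- by rewrite -cvg_shiftS.
- by rewrite (cvg_shiftS (fun n => complex.Re (u n))).
- by rewrite (cvg_shiftS (fun n => complex.Im (u n))).
Qed.

Lemma ccvg_squeeze u l (e : nat -> R) :
  (forall n, cabs (u n - l) <= e n) -> e n @[n --> \oo] --> (0 : R) -> ccvg u l.
Proof.
move=> h e0; split.
- apply/subr_cvg0; apply/norm_cvg0P; apply: squeeze_cvgr (cvg_cst 0) e0.
  apply: nearW => n; rewrite normr_ge0 /=; apply: le_trans (h n).
  by apply: le_trans (Re_cabs _); rewrite cReD; case: (l).
- apply/subr_cvg0; apply/norm_cvg0P; apply: squeeze_cvgr (cvg_cst 0) e0.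
  apply: nearW => n; rewrite normr_ge0 /=; apply: le_trans (h n).
  by apply: le_trans (Im_cabs _); rewrite cImD; case: (l).
Qed.

Lemma ccvg_cabs u l : ccvg u l -> cabs (u n) @[n --> \oo] --> cabs l.
Proof.
move=> [a b]; apply: (@continuous_cvg _ _ _ _ _ _ Num.sqrt); first exact: sqrt_continuous.
by apply: cvgD; rewrite expr2; under eq_fun do rewrite expr2; apply: cvgM.
Qed.

Lemma ccvg_cabs_le u l M : ccvg u l -> (forall n, cabs (u n) <= M) -> cabs l <= M.
Proof.
move=> /ccvg_cabs h b; rewrite -(cvg_lim _ h) //; apply: limr_le.
  by apply/cvg_ex; exists (cabs l).
exact: nearW.
Qed.

End Ccvg.

(** * Absolutely convergent power series *)

Section L1.
Variable R : realType.
Local Notation C := R[i].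
Implicit Types (a b : nat -> C) (x : C).

Definition l1 a := exists M, forall n, \sum_(k < n) cabs (a k) <= M.

Definition psum a x n := \sum_(k < n) a k * x ^+ k.

Definition pser a x : C := clim (psum a x).

Lemma nondecreasing_sum (f : nat -> R) : (forall k, 0 <= f k) ->
  {homo (fun n => \sum_(k < n) f k) : m n / (m <= n)%N >-> m <= n}.
Proof.
move=> f0 m n mn /=; rewrite -!(@big_mkord _ _ _ _ xpredT f) (big_cat_nat (leq0n m) mn) /=.
by rewrite lerDl sumr_ge0.
Qed.

Lemma bounded_sum_cvgn (f : nat -> R) M : (forall k, 0 <= f k) ->
  (forall n, \sum_(k < n) f k <= M) -> cvgn (fun n => \sum_(k < n) f k).
Proof.
move=> f0 fM; apply: nondecreasing_is_cvgn; first exact: nondecreasing_sum.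
by exists M => _ [n _ <-].
Qed.

Lemma abs_bounded_sum_cvgn (f : nat -> R) M :
  (forall n, \sum_(k < n) `|f k| <= M) -> cvgn (fun n => \sum_(k < n) f k).
Proof.
move=> fM.
have -> : (fun n => \sum_(k < n) f k) = series f.
  by rewrite seriesEord.
apply: (@normed_cvg R R).
have -> : [normed series f] = (fun n => \sum_(k < n) `|f k|).
  by rewrite /normed_series_of seriesEord.
by apply: (@bounded_sum_cvgn (fun k => `|f k|) M).
Qed.

Lemma psum_cabs_le a x n : cabs x <= 1 ->
  \sum_(k < n) cabs (a k * x ^+ k) <= \sum_(k < n) cabs (a k).
Proof.
move=> x1; apply: ler_sum => k _; rewrite cabsM ler_piMr ?cabs_ge0 // cabsX.
by rewrite exprn_ile1 ?cabs_ge0.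
Qed.

Lemma pser_cvg a x : l1 a -> cabs x <= 1 -> ccvg (psum a x) (pser a x).
Proof.
move=> [M aM] x1.
have aM' n : \sum_(k < n) cabs (a k * x ^+ k) <= M.
  exact: le_trans (psum_cabs_le _ _ x1) (aM n).
have eRe : (fun n => complex.Re (psum a x n))
    = fun n => \sum_(k < n) complex.Re (a k * x ^+ k).
  by apply/funext => n; rewrite cRe_sum.
have eIm : (fun n => complex.Im (psum a x n))
    = fun n => \sum_(k < n) complex.Im (a k * x ^+ k).
  by apply/funext => n; rewrite cIm_sum.
rewrite /ccvg /pser /clim /= eRe eIm; split.
  apply: (@abs_bounded_sum_cvgn (fun k => complex.Re (a k * x ^+ k)) M) => n.
  apply: le_trans (aM' n).
  by apply: ler_sum => k _; apply: Re_cabs.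
apply: (@abs_bounded_sum_cvgn (fun k => complex.Im (a k * x ^+ k)) M) => n; apply: le_trans (aM' n).
by apply: ler_sum => k _; apply: Im_cabs.
Qed.

Lemma pser_cabs_le a x M : (forall n, \sum_(k < n) cabs (a k) <= M) ->
  cabs x <= 1 -> cabs (pser a x) <= M.
Proof.
move=> aM x1; apply: (ccvg_cabs_le (pser_cvg (ex_intro _ M aM) x1)) => n.
by apply: le_trans (cabs_sum _ _ _) (le_trans (psum_cabs_le _ _ x1) (aM n)).
Qed.

Lemma l1_bounded a : l1 a -> exists M, forall n, cabs (a n) <= M.
Proof.
move=> [M aM]; exists M => n; apply: le_trans (aM n.+1).
by rewrite big_ord_recr /= lerDr sumr_ge0 // => k _; apply: cabs_ge0.
Qed.

Lemma l1_0 : l1 (fun=> 0).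
Proof. by exists 0 => n; rewrite big1 // => k _; rewrite cabs0. Qed.

Lemma l1D a b : l1 a -> l1 b -> l1 (fun k => a k + b k).
Proof.
move=> [M aM] [N bN]; exists (M + N) => n; apply: le_trans (lerD (aM n) (bN n)).
by rewrite -big_split /=; apply: ler_sum => k _; apply: cabsD.
Qed.

Lemma l1Z y a : l1 a -> l1 (fun k => y * a k).
Proof.
move=> [M aM]; exists (cabs y * M) => n.
by under eq_bigr do rewrite cabsM; rewrite -mulr_sumr ler_wpM2l ?cabs_ge0.
Qed.

Lemma l1_conj a : l1 a -> l1 (fun k => Num.conj (a k)).
Proof.
by move=> [M aM]; exists M => n; under eq_bigr do rewrite cabs_conj.
Qed.

Lemma l1_shift a : l1 (fun k => a k.+1) <-> l1 a.
Proof.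
split=> -[M aM]; last first.
  exists M => n; apply: le_trans (aM n.+1).
  by rewrite big_ord_recl lerDr cabs_ge0.
exists (cabs (a 0%N) + M) => -[|n].
  by rewrite big_ord0 addr_ge0 ?cabs_ge0 //; have := aM 0%N; rewrite big_ord0.
by rewrite big_ord_recl lerD2l.
Qed.

Lemma pser_eq a b x : a =1 b -> pser a x = pser b x.
Proof. by move=> /funext ->. Qed.

Lemma pser0 x : pser (fun=> 0) x = 0.
Proof.
apply: ccvg_clim.
have -> : psum (fun=> 0) x = fun=> 0.
  by apply/funext => n; apply: big1 => k _; rewrite mul0r.
exact: ccvg_cst.
Qed.

Lemma pserD a b x : l1 a -> l1 b -> cabs x <= 1 ->
  pser (fun k => a k + b k) x = pser a x + pser b x.
Proof.
move=> la lb x1; apply: ccvg_clim.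
have -> : psum (fun k => a k + b k) x = fun n => psum a x n + psum b x n.
  by apply/funext => n; rewrite -big_split /=; apply: eq_bigr => k _; rewrite mulrDl.
by apply: ccvgD; apply: pser_cvg.
Qed.

Lemma pserZ y a x : l1 a -> cabs x <= 1 ->
  pser (fun k => y * a k) x = y * pser a x.
Proof.
move=> la x1; apply: ccvg_clim.
have -> : psum (fun k => y * a k) x = fun n => y * psum a x n.
  by apply/funext => n; rewrite mulr_sumr; apply: eq_bigr => k _; rewrite mulrA.
by apply: ccvgZ; apply: pser_cvg.
Qed.

Lemma pser_shift a x : l1 a -> cabs x <= 1 ->
  pser a x = a 0%N + x * pser (fun k => a k.+1) x.
Proof.
move=> la x1; apply: ccvg_clim; apply/ccvgS.
have -> : (fun n => psum a x n.+1)
    = fun n => a 0%N + x * psum (fun k => a k.+1) x n.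
  apply/funext => n; rewrite /psum big_ord_recl expr0 mulr1; congr (_ + _).
  by rewrite mulr_sumr; apply: eq_bigr => k _; rewrite exprS mulrCA.
apply: ccvgD; first exact: ccvg_cst.
by apply: ccvgZ; apply: pser_cvg => //; apply/l1_shift.
Qed.

Lemma pser_conj a x : l1 a -> cabs x <= 1 ->
  Num.conj (pser a x) = pser (fun k => Num.conj (a k)) (Num.conj x).
Proof.
move=> la x1; apply/esym/ccvg_clim.
have -> : psum (fun k => Num.conj (a k)) (Num.conj x)
    = fun n => Num.conj (psum a x n).
  apply/funext => n; rewrite /psum rmorph_sum /=; apply: eq_bigr => k _.
  by rewrite rmorphM rmorphXn.
by apply: ccvg_conj; apply: pser_cvg.
Qed.

Definition cauchy_prod a b k := \sum_(i < k.+1) a i * b (k - i)%N.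

Lemma sum_triangle (V : nmodType) (F : nat -> nat -> V) n :
  \sum_(k < n) \sum_(i < k.+1) F i (k - i)%N = \sum_(i < n) \sum_(j < n - i) F i j.
Proof.
elim: n => [|n IH]; first by rewrite !big_ord0.
rewrite big_ord_recr IH /= [RHS]big_ord_recr /= subSnn big_ord1.
rewrite [X in _ + X]big_ord_recr /= subnn addrA; congr (_ + _).
rewrite -big_split /=; apply: eq_bigr => i _.
by rewrite subSn ?big_ord_recr //= ltnW.
Qed.

Lemma l1_cauchy_prod a b : l1 a -> l1 b -> l1 (cauchy_prod a b).
Proof.
move=> [M aM] [N bN]; exists (M * N) => n.
apply: (@le_trans _ _ (\sum_(k < n) \sum_(i < k.+1) cabs (a i) * cabs (b (k - i)%N))).
  apply: ler_sum => k _; apply: le_trans (cabs_sum _ _ _) _.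
  by apply: ler_sum => i _; rewrite cabsM.
rewrite (sum_triangle (fun i j => cabs (a i) * cabs (b j))).
have N0 : 0 <= N by have := bN 0%N; rewrite big_ord0.
apply: (@le_trans _ _ (\sum_(i < n) cabs (a i) * N)).
  by apply: ler_sum => i _; rewrite -mulr_sumr ler_wpM2l ?cabs_ge0.
by rewrite -mulr_suml ler_wpM2r.
Qed.

(** The product of partial sums minus the partial sum of the Cauchy product runs over the pairs in a
    square ([H]) outside a triangle ([G]). For the moduli, [G n] <= [H n] <= [G (n + n)], and [G] is
    monotone and bounded. Hence [H n - G n], which dominates the difference, tends to 0. *)
Lemma pser_cauchy_prod a b x : l1 a -> l1 b -> cabs x <= 1 ->
  pser (cauchy_prod a b) x = pser a x * pser b x.
Proof.
move=> la lb x1.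
pose f i j := cabs (a i) * cabs (b j).
have f0 i j : 0 <= f i j by rewrite mulr_ge0 ?cabs_ge0.
pose G n := \sum_(i < n) \sum_(j < n - i) f i j.
pose H n := \sum_(i < n) \sum_(j < n) f i j.
have [Lf GL] : exists L : R, G n @[n --> \oo] --> L.
  pose g k := \sum_(i < k.+1) f i (k - i)%N.
  have gG : (fun n => \sum_(k < n) g k) = G.
    by apply/funext => n; rewrite /g sum_triangle.
  have [M aM] := la; have [N bN] := lb.
  have N0 : 0 <= N by have := bN 0%N; rewrite big_ord0.
  suff : cvgn G by move=> /cvg_ex.
  rewrite -gG; apply: (@bounded_sum_cvgn g (M * N)) => [k|n].
    by apply: sumr_ge0 => i _.
  rewrite /g sum_triangle.
  apply: (@le_trans _ _ (\sum_(i < n) cabs (a i) * N)).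
    by apply: ler_sum => i _; rewrite -mulr_sumr ler_wpM2l ?cabs_ge0.
  by rewrite -mulr_suml ler_wpM2r.
have GH n : G n <= H n.
  apply: ler_sum => i _.
  by apply: (nondecreasing_sum (f := f i)) => //; apply: leq_subr.
have HG n : H n <= G (n + n)%N.
  rewrite /H /G.
  apply: (@le_trans _ _ (\sum_(i < n) \sum_(j < n + n - i) f i j)).
    apply: ler_sum => i _; apply: (nondecreasing_sum (f := f i)) => //.
    by rewrite -addnBA ?leq_addr // ltnW.
  rewrite -!(@big_mkord _ _ _ _ xpredT (fun i => \sum_(j < n + n - i) f i j)).
  rewrite (big_cat_nat (leq0n n) (leq_addr n n)) /= lerDl sumr_ge0 // => i _.
  by apply: sumr_ge0.
have G2L : G (n + n)%N @[n --> \oo] --> Lf.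
  apply: (@cvg_comp _ _ _ (fun n => (n + n)%N) G _ \oo _ _ GL).
  by apply/cvgnyPge => m; near=> n; rewrite (@leq_trans n) ?leq_addr //; near: n;
     exists m.
have HL : H n @[n --> \oo] --> Lf.
  by apply: squeeze_cvgr GL G2L; apply: nearW => n; rewrite GH HG.
have D0 : H n - G n @[n --> \oo] --> (0 : R).
  by rewrite -(subrr Lf); apply: cvgB.
have ab : ccvg (fun n => psum a x n * psum b x n) (pser a x * pser b x).
  by apply: ccvgM; apply: pser_cvg.
apply: ccvg_clim.
suff h : ccvg (fun n => psum (cauchy_prod a b) x n - psum a x n * psum b x n) 0.
  have := ccvgD h ab; rewrite add0r; congr ccvg; apply/funext => n.
  by rewrite subrK.
apply: ccvg_squeeze D0 => n; rewrite subr0 -cabsN opprB.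
pose F i j := a i * x ^+ i * (b j * x ^+ j).
have -> : psum (cauchy_prod a b) x n = \sum_(i < n) \sum_(j < n - i) F i j.
  rewrite -sum_triangle; apply: eq_bigr => k _.
  rewrite /cauchy_prod mulr_suml; apply: eq_bigr => i _.
  rewrite /F mulrACA -exprD subnKC //; by rewrite -ltnS.
have -> : psum a x n * psum b x n = \sum_(i < n) \sum_(j < n) F i j.
  by rewrite mulr_suml; apply: eq_bigr => i _; rewrite mulr_sumr.
rewrite -!sumrB; apply: le_trans (cabs_sum _ _ _) _.
apply: ler_sum => i _.
have split (V : zmodType) (h : nat -> V) :
    \sum_(j < n) h j - \sum_(j < n - i) h j = \sum_(n - i <= j < n) h j.
  rewrite -!(@big_mkord _ _ _ _ xpredT h).
  by rewrite (big_cat_nat (leq0n (n - i)) (leq_subr i n)) /= addrAC subrr add0r.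
rewrite !split.
apply: le_trans (cabs_sum _ _ _) _; apply: ler_sum => j _.
rewrite /F /f !cabsM !cabsX; apply: ler_pM; rewrite ?mulr_ge0 ?exprn_ge0 ?cabs_ge0 //.
  by rewrite ler_piMr ?cabs_ge0 // exprn_ile1 ?cabs_ge0.
by rewrite ler_piMr ?cabs_ge0 // exprn_ile1 ?cabs_ge0.
Unshelve. all: by end_near. Qed.

Lemma pserE a x : pser a x = clim (fun n => \sum_(k < n) a k * x ^+ k).
Proof. by []. Qed.

Lemma clim_mull y a x : l1 a -> cabs x <= 1 ->
  clim (fun n => \sum_(k < n) a k * (y * x ^+ k)) = y * pser a x.
Proof.
move=> la x1; apply: ccvg_clim.
have -> : (fun n => \sum_(k < n) a k * (y * x ^+ k)) = fun n => y * psum a x n.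
  by apply/funext => n; rewrite mulr_sumr; apply: eq_bigr => k _; rewrite mulrCA.
by apply: ccvgZ; apply: pser_cvg.
Qed.

End L1.
#[local] Opaque pser.

(** * Fourier integrals *)

Section Expi.
Variable R : realType.
Implicit Types s t : R.

Lemma expiD s t : expi (s + t) = expi s * expi t.
Proof. by apply/eqP; rewrite eq_complex /= cosD sinD addrC eqxx /= addrC [X in _ + X]mulrC. Qed.

Lemma expi0 : expi (0 : R) = 1.
Proof. by rewrite /expi cos0 sin0. Qed.

Lemma expi_conj t : Num.conj (expi t) = expi (- t).
Proof. by rewrite /expi cosN sinN. Qed.

Lemma expiNr t : expi t * expi (- t) = 1.
Proof. by rewrite -expiD subrr expi0. Qed.

Lemma expi_neq0 t : expi t != 0.
Proof. by apply/eqP => e; have := expiNr t; rewrite e mul0r => /esym/eqP; rewrite oner_eq0. Qed.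

Lemma expiN t : expi (- t) = (expi t)^-1.
Proof. by apply: (mulfI (expi_neq0 t)); rewrite expiNr divff ?expi_neq0. Qed.

Lemma cabs_expi t : cabs (expi t) = 1.
Proof. by rewrite /cabs /= cos2Dsin2 sqrtr1. Qed.

Lemma expiMn n t : expi (n%:R * t) = expi t ^+ n.
Proof.
elim: n => [|n IH]; first by rewrite mul0r expi0 expr0.
by rewrite -addn1 natrD mulrDl mul1r expiD IH exprD expr1.
Qed.

Lemma zinv_nat t (n : nat) : zinv t n%:Z = expi (- t) ^+ n.
Proof. by rewrite /zinv -expiMn mulrN -pmulrn. Qed.

Lemma zinv_neg t (n : nat) : zinv t (- n%:Z) = expi t ^+ n.
Proof. by rewrite /zinv -expiMn rmorphN /= mulNr opprK -pmulrn. Qed.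

Lemma expi_surj (x : R[i]) : cabs x = 1 -> exists t, x = expi t.
Proof.
case: x => a b; rewrite /cabs /= => h.
have h2 : a ^+ 2 + b ^+ 2 = 1.
  by rewrite -[LHS]sqr_sqrtr ?addr_ge0 ?sqr_ge0 // h expr1n.
have a1 : -1 <= a <= 1 by have := sqr_ge0 b; rewrite -ler_norml => b0; rewrite -(@ler_pXn2r _ 2) ?nnegrE // real_normK ?num_real // expr1n; lra.
have ca := acosK a1.
have sb : sin (acos a) = `|b|.
  by rewrite sin_acos // -h2 addrAC subrr add0r sqrtr_sqr.
have [b0|b0] := leP 0 b.
  by exists (acos a); rewrite /expi ca sb ger0_norm.
by exists (- acos a); rewrite /expi cosN sinN ca sb ltr0_norm // opprK.
Qed.

End Expi.

Section Fourier.
Variable R : realType.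
Local Notation C := R[i].
Local Notation mu := (@lebesgue_measure R).
Local Notation I := (`[0, 2 * pi]%classic : set R).

(** Continuity travels with the value, so integrability over the compact interval is automatic when
    integrals are added or scaled. *)
Definition cint (f : R -> R) v := continuous f /\ Rintegral mu I f = v.

Lemma cint_integrable f v : cint f v -> mu.-integrable I (EFin \o f).
Proof.
move=> [cf _]; apply: continuous_compact_integrable; first exact: (@segment_compact R).
exact: continuous_subspaceT.
Qed.

Lemma cintD f g v w : cint f v -> cint g w -> cint (fun t => f t + g t) (v + w).
Proof.
move=> hf hg; split; first by move=> x; apply: cvgD; [exact: hf.1|exact: hg.1].
rewrite RintegralD //; first by case: hf => _ ->; case: hg => _ ->.
- exact: cint_integrable hf.
- exact: cint_integrable hg.
Qed.

Lemma cintZ a f v : cint f v -> cint (fun t => a * f t) (a * v).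
Proof.
move=> hf; split; first by move=> x; apply: cvgM; [exact: cvg_cst|exact: hf.1].
by rewrite RintegralZl //; [case: hf => _ ->|exact: cint_integrable hf].
Qed.

Lemma cint_cst a : cint (fun=> a) (a * (2 * pi)).
Proof.
split; first by move=> x; apply: cvg_cst.
have p0 : 0 < 2 * pi :> R by rewrite mulr_gt0 ?pi_gt0.
have hm := @lebesgue_measure_itv R `[0, 2 * pi]%R.
rewrite Rintegral_cst //= hm /= lte_fin p0 /= subr0 //.
Qed.

Lemma cint_deriv (f F : R -> R) : continuous f ->
  (forall x : R, is_derive x (1 : R) F (f x)) -> cint f (F (2 * pi) - F 0).
Proof.
move=> cf dF; split => //; rewrite /Rintegral (@continuous_FTC2 _ f F) //.
- by rewrite mulr_gt0 ?pi_gt0.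
- exact: continuous_subspaceT.
- have cF : continuous F.
    by move=> x; apply/differentiable_continuous/derivable1_diffP; case: (dF x).
  split; first by move=> x _; case: (dF x).
  + by apply: cvg_at_right_filter; apply: cF.
  + by apply: cvg_at_left_filter; apply: cF.
- by move=> x _; rewrite derive1E; apply: derive_val.
Qed.

Lemma cos_2piMn n : cos (n%:R * (2 * pi)) = 1 :> R.
Proof.
elim: n => [|n IH]; first by rewrite mul0r cos0.
rewrite -addn1 natrD mulrDl mul1r.
by have := cosD2pi (n%:R * (2 * pi) : R); rewrite -[pi *+ 2]mulr_natl => ->.
Qed.

Lemma sin_2piMn n : sin (n%:R * (2 * pi)) = 0 :> R.
Proof.
elim: n => [|n IH]; first by rewrite mul0r sin0.
rewrite -addn1 natrD mulrDl mul1r.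
by have := sinD2pi (n%:R * (2 * pi) : R); rewrite -[pi *+ 2]mulr_natl => ->.
Qed.

Lemma continuous_scale n : continuous (fun x : R => n%:R * x).
Proof. by move=> x; apply: cvgM; [apply: cvg_cst|apply: cvg_id]. Qed.

Lemma cint_cos n : cint (fun t => cos (n.+1%:R * t)) 0.
Proof.
have n0 : n.+1%:R != 0 :> R by rewrite pnatr_eq0.
have := @cint_deriv (fun t => cos (n.+1%:R * t)) (fun t => n.+1%:R^-1 * sin (n.+1%:R * t)).
rewrite mulr0 sin0 sin_2piMn mulr0 subr0; apply.
  move=> x; apply: continuous_comp; [exact: continuous_scale|exact: continuous_cos].
move=> x; apply: is_derive_eq.
by rewrite /GRing.scale /= ; field.
Qed.

Lemma cint_sin n : cint (fun t => sin (n.+1%:R * t)) 0.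
Proof.
have n0 : n.+1%:R != 0 :> R by rewrite pnatr_eq0.
have := @cint_deriv (fun t => sin (n.+1%:R * t)) (fun t => - n.+1%:R^-1 * cos (n.+1%:R * t)).
rewrite mulr0 cos0 cos_2piMn mulr1 subrr; apply.
  move=> x; apply: continuous_comp; [exact: continuous_scale|exact: continuous_sin].
move=> x; apply: is_derive_eq.
by rewrite /GRing.scale /= ; field.
Qed.

Definition ccint (f : R -> C) (v : C) :=
  cint (fun t => complex.Re (f t)) (complex.Re v) /\
  cint (fun t => complex.Im (f t)) (complex.Im v).

Lemma ccintD f g v w : ccint f v -> ccint g w -> ccint (fun t => f t + g t) (v + w).
Proof.
move=> [a b] [c d]; split.
  have -> : (fun t => complex.Re (f t + g t))
      = fun t => complex.Re (f t) + complex.Re (g t) by apply/funext => t; rewrite cReD.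
  by rewrite cReD; apply: cintD.
have -> : (fun t => complex.Im (f t + g t))
    = fun t => complex.Im (f t) + complex.Im (g t) by apply/funext => t; rewrite cImD.
by rewrite cImD; apply: cintD.
Qed.

Lemma ccint_cst (a : C) : ccint (fun=> a) (a * toC (2 * pi)).
Proof.
case: a => a b; have := cint_cst a; have := cint_cst b; split => /=.
  by rewrite mulr0 subr0.
by rewrite mulr0 add0r.
Qed.

Lemma ccint_sum n (f : 'I_n -> R -> C) : (forall i, ccint (f i) 0) ->
  ccint (fun t => \sum_i f i t) 0.
Proof.
elim: n f => [|n IH] f h.
  have -> : (fun t => \sum_(i < 0) f i t) = fun=> 0.
    by apply/funext => t; rewrite big_ord0.
  by have := ccint_cst 0; rewrite mul0r.
have -> : (fun t => \sum_i f i t)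
    = fun t => f ord0 t + \sum_i f (lift ord0 i) t.
  by apply/funext => t; rewrite big_ord_recl.
by rewrite -[X in ccint _ X]addr0; apply: ccintD => //; apply: IH.
Qed.

Lemma ccint_expi (a : C) n : ccint (fun t => a * expi t ^+ n.+1) 0.
Proof.
split.
  have -> : (fun t => complex.Re (a * expi t ^+ n.+1)) =
      fun t => complex.Re a * cos (n.+1%:R * t) + - complex.Im a * sin (n.+1%:R * t).
    by apply/funext => t; rewrite -expiMn cReM /= mulNr.
  rewrite -[complex.Re 0](_ : complex.Re a * 0 + - complex.Im a * 0 = 0); last by rewrite !mulr0 addr0.
  by apply: cintD; apply: cintZ; [exact: cint_cos|exact: cint_sin].
have -> : (fun t => complex.Im (a * expi t ^+ n.+1)) =
    fun t => complex.Re a * sin (n.+1%:R * t) + complex.Im a * cos (n.+1%:R * t).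
  by apply/funext => t; rewrite -expiMn cImM /=.
rewrite -[complex.Im 0](_ : complex.Re a * 0 + complex.Im a * 0 = 0); last by rewrite !mulr0 addr0.
by apply: cintD; apply: cintZ; [exact: cint_sin|exact: cint_cos].
Qed.

Lemma ccint_expiN (a : C) n : ccint (fun t => a * expi (- t) ^+ n.+1) 0.
Proof.
split.
  have -> : (fun t => complex.Re (a * expi (- t) ^+ n.+1)) =
      fun t => complex.Re a * cos (n.+1%:R * t) + complex.Im a * sin (n.+1%:R * t).
    by apply/funext => t; rewrite -expiMn cReM /= mulrN cosN sinN mulrN opprK.
  rewrite -[complex.Re 0](_ : complex.Re a * 0 + complex.Im a * 0 = 0); last by rewrite !mulr0 addr0.
  by apply: cintD; apply: cintZ; [exact: cint_cos|exact: cint_sin].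
have -> : (fun t => complex.Im (a * expi (- t) ^+ n.+1)) =
    fun t => - complex.Re a * sin (n.+1%:R * t) + complex.Im a * cos (n.+1%:R * t).
  by apply/funext => t; rewrite -expiMn cImM /= mulrN cosN sinN mulrN mulNr.
rewrite -[complex.Im 0](_ : - complex.Re a * 0 + complex.Im a * 0 = 0); last by rewrite !mulr0 addr0.
by apply: cintD; apply: cintZ; [exact: cint_sin|exact: cint_cos].
Qed.

(** Dominated convergence with a constant bound. All approximants have the same integral, so no
    limit of values has to be computed, and continuity of the limit function is not claimed. *)
Lemma cint_lim (f_ : nat -> R -> R) (f : R -> R) (M v : R) :
  (forall n, cint (f_ n) v) -> (forall n t, `|f_ n t| <= M) ->
  (forall t, f_ n t @[n --> \oo] --> f t) -> Rintegral mu I f = v.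
Proof.
move=> hf fM fl; rewrite /Rintegral.
have mI : measurable (I : set (measurableTypeR R)) by [].
have mf n : measurable_fun (I : set (measurableTypeR R)) (fun x => (f_ n x)%:E).
  by apply/measurable_EFinP; apply: measurable_funTS; apply: continuous_measurable_fun; case: (hf n).
have h := @dominated_cvg _ _ _ mu I mI (fun n x => (f_ n x)%:E) (fun x => (f x)%:E) (fun=> M%:E) mf.
have {h} : (\int[mu]_(x in I) (f_ n x)%:E)%E @[n --> \oo] --> (\int[mu]_(x in I) (f x)%:E)%E.
  apply: h => //.
  - by move=> x _; apply: cvg_EFin; [exact: nearW|exact: fl].
  - exact: cint_integrable (cint_cst M).
  - by move=> n x _; rewrite lee_fin.
have e n : (\int[mu]_(x in I) (f_ n x)%:E)%E = v%:E.
  rewrite -[in RHS](hf n).2 /Rintegral fineK //.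
  by apply: integrable_fin_num => //; apply: cint_integrable (hf n).
by under eq_fun do rewrite e; move=> /cvg_lim <- //; rewrite lim_cst.
Qed.

End Fourier.
#[local] Opaque expi.

(** * The Wiener algebra *)

Section Wiener.
Variable R : realType.
Local Notation C := R[i].
Implicit Types (f g : R -> C) (c d : int -> C).

(* Membership in the Wiener algebra: [c k] is the coefficient of z^{-k}, so that
   [c (Negz k)] is the coefficient of z^{k+1}. *)
Definition wf f c := [/\ l1 (fun k => c (Posz k)), l1 (fun k => c (Negz k))
  & forall t, f t = pser (fun k => c (Posz k)) (expi (- t))
                    + expi t * pser (fun k => c (Negz k)) (expi t)].

Lemma cabs_expi_le1 (t : R) : cabs (expi t) <= 1.
Proof. by rewrite cabs_expi. Qed.
Hint Resolve cabs_expi_le1 : core.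

(** Every nonconstant power of z integrates to 0, so all truncations have the same integral. They
    are bounded by the two l1 norms, and dominated convergence passes to [f]. *)
Lemma circle_int_wf f c : wf f c -> circle_int f = c 0 * toC (2 * pi).
Proof.
move=> [[M aM] [N bN] fE]; set v := _ * _.
(* Truncating at [n.+1] keeps the constant term in every approximant, including the first. *)
pose g n t := psum (fun k => c (Posz k)) (expi (- t)) n.+1
  + expi t * psum (fun k => c (Negz k)) (expi t) n.+1.
have gi n : ccint (g n) v.
  have -> : g n = fun t => c 0 + (\sum_(k < n) c k.+1%:Z * expi (- t) ^+ k.+1
      + \sum_(k < n.+1) c (Negz k) * expi t ^+ k.+1).
    apply/funext => t; rewrite /g /psum big_ord_recl expr0 mulr1 -addrA.
    congr (_ + (_ + _)); rewrite mulr_sumr; apply: eq_bigr => k _.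
    by rewrite exprS mulrCA.
  rewrite -[v]addr0; apply: ccintD; first exact: ccint_cst.
  rewrite -[X in ccint _ X]addr0; apply: ccintD; apply: ccint_sum => k.
    exact: ccint_expiN.
  exact: ccint_expi.
have gf t : ccvg (g^~ t) (f t).
  rewrite fE; apply: ccvgD; first by apply/ccvgS; apply: pser_cvg => //; exists M.
  by apply: ccvgZ; apply/ccvgS; apply: pser_cvg => //; exists N.
have gb n t : cabs (g n t) <= M + N.
  apply: le_trans (cabsD _ _) _; rewrite cabsM cabs_expi mul1r; apply: lerD.
    apply: le_trans (cabs_sum _ _ _) _.
    by apply: le_trans (@psum_cabs_le _ (fun k => c (Posz k)) (expi (- t)) n.+1 _) (aM _).
  apply: le_trans (cabs_sum _ _ _) _.
  by apply: le_trans (@psum_cabs_le _ (fun k => c (Negz k)) (expi t) n.+1 _) (bN _).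
have hRe : Rintegral (@lebesgue_measure R) `[0, 2 * pi]%classic
    (fun t => complex.Re (f t)) = complex.Re v.
  apply: (@cint_lim _ (fun n t => complex.Re (g n t))
    (fun t => complex.Re (f t)) (M + N)) => [n|n t|t].
  - exact: (gi n).1.
  - exact: le_trans (Re_cabs _) (gb n t).
  - exact: (gf t).1.
have hIm : Rintegral (@lebesgue_measure R) `[0, 2 * pi]%classic
    (fun t => complex.Im (f t)) = complex.Im v.
  apply: (@cint_lim _ (fun n t => complex.Im (g n t))
    (fun t => complex.Im (f t)) (M + N)) => [n|n t|t].
  - exact: (gi n).2.
  - exact: le_trans (Im_cabs _) (gb n t).
  - exact: (gf t).2.
by rewrite /circle_int hRe hIm; case: (v).
Qed.

Let shift_aux (E E' x P Q : C) : E * E' = 1 ->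
  E * (x + E' * P + E * Q) = P + E * (x + E * Q).
Proof.
move=> h; rewrite -{2}[P]mul1r -h; ring.
Qed.

Lemma wf_shift f c : wf f c -> wf (fun t => expi t * f t) (fun k => c (k + 1)).
Proof.
move=> [la lb fE].
have eP k : c (Posz k + 1) = c (Posz k.+1) by congr c; rewrite -addn1 PoszD.
have eN k : c (Negz k + 1) = if k is j.+1 then c (Negz j) else c 0.
  by case: k => [|k]; congr c; rewrite !NegzE; lia.
have la' : l1 (fun k => c (Posz k + 1)).
  by under [X in l1 X]eq_fun do rewrite eP; apply/(@l1_shift _ (fun k => c (Posz k))).
have lb' : l1 (fun k => c (Negz k + 1)).
  by under [X in l1 X]eq_fun do rewrite eN; apply/l1_shift.
split; [exact: la'|exact: lb'|move=> t]; rewrite fE (pser_shift la (cabs_expi_le1 _)).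
rewrite (pser_shift lb' (cabs_expi_le1 _)).
rewrite (pser_eq (expi (- t)) eP) (eN 0%N).
rewrite (pser_eq (b := fun k => c (Negz k)) (expi t) (fun k => eN k.+1)).
exact: shift_aux (expiNr t).
Qed.

Let unshift_aux (E E' x P Q : C) : E * E' = 1 ->
  E' * (P + E * (x + E * Q)) = x + E' * P + E * Q.
Proof.
move=> h; rewrite -{2}[x]mul1r -{2}[E * Q]mul1r -h; ring.
Qed.

Lemma wf_unshift f c : wf f c -> wf (fun t => expi (- t) * f t) (fun k => c (k - 1)).
Proof.
move=> [la lb fE].
have eP k : c (Posz k - 1) = if k is j.+1 then c (Posz j) else c (Negz 0).
  by case: k => [//|k]; congr c; rewrite -addn1 PoszD addrK.
have eN k : c (Negz k - 1) = c (Negz k.+1).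
  by congr c; rewrite !NegzE; lia.
have la' : l1 (fun k => c (Posz k - 1)).
  by under [X in l1 X]eq_fun do rewrite eP; apply/l1_shift.
have lb' : l1 (fun k => c (Negz k - 1)).
  by under [X in l1 X]eq_fun do rewrite eN; apply/(@l1_shift _ (fun k => c (Negz k))).
split; [exact: la'|exact: lb'|move=> t]; rewrite fE (pser_shift lb (cabs_expi_le1 _)).
rewrite (pser_shift la' (cabs_expi_le1 _)) (eP 0%N).
rewrite (pser_eq (expi t) eN).
rewrite (pser_eq (b := fun k => c (Posz k)) (expi (- t)) (fun k => eP k.+1)).
exact: unshift_aux (expiNr t).
Qed.

Lemma wfD f g c d : wf f c -> wf g d -> wf (fun t => f t + g t) (fun k => c k + d k).
Proof.
move=> [la lb fE] [la' lb' gE]; split; [exact: l1D|exact: l1D|] => t.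
by rewrite !pserD // fE gE mulrDr addrACA.
Qed.

Lemma wfZ a f c : wf f c -> wf (fun t => a * f t) (fun k => a * c k).
Proof.
move=> [la lb fE]; split; [exact: l1Z|exact: l1Z|] => t.
by rewrite !pserZ // fE mulrDr [_ * (a * _)]mulrCA.
Qed.

Lemma wf0 : wf (fun=> 0) (fun=> 0).
Proof. by split=> [||t]; [exact: l1_0|exact: l1_0|rewrite !pser0 mulr0 addr0]. Qed.

Lemma wf1 : wf (fun=> 1) (fun k => (k == 0)%:R).
Proof.
have l : l1 (fun k => (Posz k == 0)%:R : C).
  by apply/l1_shift; exact: l1_0.
split=> [//||t]; first exact: l1_0.
by rewrite pser_shift // !pser0 !mulr0 !addr0.
Qed.

Lemma wf_sum (I : Type) (s : seq I) (f : I -> R -> C) (c : I -> int -> C) :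
  (forall i, wf (f i) (c i)) ->
  wf (fun t => \sum_(i <- s) f i t) (fun k => \sum_(i <- s) c i k).
Proof.
move=> h; elim: s => [|i s IH].
  by under [X in wf X]eq_fun do rewrite big_nil;
    under [X in wf _ X]eq_fun do rewrite big_nil; exact: wf0.
by under [X in wf X]eq_fun do rewrite big_cons;
  under [X in wf _ X]eq_fun do rewrite big_cons; apply: wfD.
Qed.

(** On the circle, t -> -t conjugates z. Conjugating the value as well conjugates the coefficients
    and leaves their indices in place, so causality is preserved. The proof that K has real
    coefficients rests on this symmetry. *)
Lemma wf_conj_opp f c : wf f c -> wf (fun t => Num.conj (f (- t))) (fun k => Num.conj (c k)).
Proof.
move=> [la lb fE]; split; [exact: l1_conj|exact: l1_conj|] => t.
rewrite fE opprK rmorphD /= (pser_conj la (cabs_expi_le1 _)).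
rewrite rmorphM /= (pser_conj lb (cabs_expi_le1 _)).
by rewrite !expi_conj opprK.
Qed.

Lemma wf_opp f c : wf f c -> wf (fun t => f (- t)) (fun k => c (- k)).
Proof.
move=> [la lb fE].
have eP k : c (- Posz k.+1) = c (Negz k) by rewrite NegzE.
have eN k : c (- Negz k) = c (Posz k.+1) by rewrite NegzE opprK.
have la' : l1 (fun k => c (- Posz k)).
  by apply/l1_shift; under [X in l1 X]eq_fun do rewrite eP.
have lb' : l1 (fun k => c (- Negz k)).
  by under [X in l1 X]eq_fun do rewrite eN; apply/(@l1_shift _ (fun k => c (Posz k))).
split; [exact: la'|exact: lb'|move=> t]; rewrite fE opprK (pser_shift la (cabs_expi_le1 _)).
rewrite (pser_shift la' (cabs_expi_le1 _)) oppr0.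
rewrite (pser_eq (b := fun k => c (Negz k)) (expi (- t)) eP).
by rewrite (pser_eq (expi t) eN); exact: addrAC.
Qed.

(** Conjugating the value alone reverses the index, which is why adjoints exchange causal and
    anticausal functions. *)
Lemma wf_conj f c : wf f c -> wf (fun t => Num.conj (f t)) (fun k => Num.conj (c (- k))).
Proof.
move=> /wf_opp /wf_conj_opp.
by under [X in wf X]eq_fun do rewrite opprK.
Qed.

Lemma wf_shiftn n f c : wf f c -> wf (fun t => expi t ^+ n * f t) (fun k => c (k + n%:Z)).
Proof.
move=> h; elim: n => [|n IH].
  by under [X in wf X]eq_fun do rewrite expr0 mul1r; under [X in wf _ X]eq_fun do rewrite addr0.
have := wf_shift IH; congr wf; apply/funext => x; first by rewrite exprS mulrA.
by rewrite -addrA -PoszD.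
Qed.

Lemma wf_unshiftn n f c :
  wf f c -> wf (fun t => expi (- t) ^+ n * f t) (fun k => c (k - n%:Z)).
Proof.
move=> h; elim: n => [|n IH].
  by under [X in wf X]eq_fun do rewrite expr0 mul1r; under [X in wf _ X]eq_fun do rewrite subr0.
have := wf_unshift IH; congr wf; apply/funext => x; first by rewrite exprS mulrA.
by congr c; rewrite -addn1 PoszD opprD addrAC addrA.
Qed.

Lemma toC_2pi_neq0 : toC (2 * pi) != 0 :> C.
Proof.
by rewrite -cabs_eq0 cabs_toC normr_eq0 mulf_neq0 // gt_eqF ?pi_gt0.
Qed.

(** Multiplication by z^k moves the k-th coefficient to index 0, where [circle_int_wf] reads it off.
    This links [fcoef], and so the causal parts, to coefficient sequences. *)
Lemma wf_fcoef f c k : wf f c ->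
  toC (2 * pi)^-1 * circle_int (fun t => f t * expi (k%:~R * t)) = c k.
Proof.
move=> h; suff : wf (fun t => f t * expi (k%:~R * t)) (fun j => c (j + k)).
  move=> /circle_int_wf ->; rewrite add0r mulrCA.
  have -> : toC (2 * pi)^-1 = (toC (2 * pi) : C)^-1 by rewrite !toCE fmorphV.
  by rewrite mulVf ?mulr1 // toC_2pi_neq0.
case: k => n.
  have := wf_shiftn n h; congr wf; apply/funext => t.
  by rewrite -expiMn mulrC -pmulrn.
have := wf_unshiftn n.+1 h; congr wf; apply/funext => t.
  by rewrite -expiMn mulrC NegzE rmorphN /= mulNr mulrN -pmulrn.
Qed.

Lemma wf_uniq f c d : wf f c -> wf f d -> c = d.
Proof. by move=> h h'; apply/funext => k; rewrite -(wf_fcoef k h) (wf_fcoef k h'). Qed.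

Lemma wf_uniq_fun f g c : wf f c -> wf g c -> f = g.
Proof. by move=> [_ _ h] [_ _ h']; apply/funext => t; rewrite h h'. Qed.

Lemma wf_coef_bounded f c : wf f c -> exists M, forall k, cabs (c k) <= M.
Proof.
move=> [/l1_bounded [M hM] /l1_bounded [N hN] _].
have M0 : 0 <= M by apply: le_trans (hM 0%N); apply: cabs_ge0.
have N0 : 0 <= N by apply: le_trans (hN 0%N); apply: cabs_ge0.
exists (M + N) => -[k|k]; first by apply: le_trans (hM k) _; rewrite lerDl.
by apply: le_trans (hN k) _; rewrite lerDr.
Qed.

Lemma wf_bounded f c : wf f c -> exists M, forall t, cabs (f t) <= M.
Proof.
move=> [[M hM] [N hN] fE]; exists (M + N) => t; rewrite fE.
apply: le_trans (cabsD _ _) _; rewrite cabsM cabs_expi mul1r.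
by apply: lerD; apply: pser_cabs_le.
Qed.

End Wiener.

Section WienerDivision.
Variable R : realType.
Local Notation C := R[i].
Implicit Types (f g : R -> C) (c d : int -> C).

Definition causal_coef c := forall k, c (Negz k) = 0.

(* Coefficients of the quotient of \sum_k a_k z^{-k} by z - r. *)
Fixpoint div_rec (a : nat -> C) (r : C) (k : nat) : C :=
  if k is j.+1 then r * div_rec a r j + a j else 0.

Lemma l1_div_rec a r : l1 a -> cabs r < 1 -> l1 (div_rec a r).
Proof.
move=> [M aM] r1; have r0 := cabs_ge0 r.
have M0 : 0 <= M by have := aM 0%N; rewrite big_ord0.
(* The bound is the fixed point of x -> |r| x + M, which is how the recursion acts on partial l1
   sums. *)
exists (M / (1 - cabs r)) => n.
have d0 : 0 < 1 - cabs r by rewrite subr_gt0.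
elim: n => [|n IH]; first by rewrite big_ord0 divr_ge0 // ltW.
rewrite big_ord_recl /= cabs0 add0r.
apply: (@le_trans _ _ (cabs r * (M / (1 - cabs r)) + M)); last first.
  rewrite le_eqVlt; apply/orP; left; apply/eqP; field; lra.
apply: (@le_trans _ _ (cabs r * (\sum_(k < n) cabs (div_rec a r k)) + \sum_(k < n) cabs (a k))).
  rewrite mulr_sumr -big_split /=; apply: ler_sum => k _.
  by apply: le_trans (cabsD _ _) _; rewrite cabsM.
by apply: lerD; [rewrite ler_wpM2l|].
Qed.

Lemma pser_div_rec a r x y : l1 a -> cabs r < 1 -> cabs x <= 1 -> x * y = 1 ->
  (y - r) * pser (div_rec a r) x = pser a x.
Proof.
move=> la r1 x1 xy; have lh := l1_div_rec la r1.
have e : pser (div_rec a r) x = x * (r * pser (div_rec a r) x + pser a x).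
  rewrite {1}(pser_shift lh x1) /= add0r; congr (_ * _).
  rewrite -(pserZ r lh x1) -pserD //; exact: l1Z.
have -> : (y - r) * pser (div_rec a r) x
   = y * pser (div_rec a r) x - r * pser (div_rec a r) x by exact: mulrBl.
rewrite {1}e mulrA [y * x]mulrC xy mul1r addrAC subrr; exact: add0r.
Qed.

(* \sum_j b_j z^{j+1} = (z - r) \sum_j h_j z^j + r h_0 with h_j = \sum_k r^k b_{j+k}. *)
Definition div_tail (b : nat -> C) (r : C) (j : nat) : C :=
  pser (fun k => b (j + k)%N) r.

Lemma l1_addn j (b : nat -> C) : l1 b -> l1 (fun k => b (j + k)%N).
Proof.
move=> lb; elim: j => [//|j IH].
have -> : (fun k => b (j.+1 + k)%N) = (fun k => b (j + k.+1)%N).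
  by apply/funext => k; rewrite addSnnS.
exact/(@l1_shift _ (fun k => b (j + k)%N)).
Qed.

Lemma div_tailE b r j : l1 b -> cabs r < 1 ->
  div_tail b r j = b j + r * div_tail b r j.+1.
Proof.
move=> lb r1; rewrite /div_tail (pser_shift (l1_addn j lb) (ltW r1)) addn0.
congr (_ + _ * _); apply: pser_eq => k; by rewrite addSnnS.
Qed.

Lemma l1_div_tail b r : l1 b -> cabs r < 1 -> l1 (div_tail b r).
Proof.
move=> lb r1; have r0 := cabs_ge0 r; have [M bM] := lb.
have M0 : 0 <= M by have := bM 0%N; rewrite big_ord0.
have d0 : 0 < 1 - cabs r by rewrite subr_gt0.
have hM j : cabs (div_tail b r j) <= M.
  apply: pser_cabs_le (ltW r1) => n; apply: le_trans (bM (j + n)%N).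
  rewrite big_split_ord /= lerDr sumr_ge0 // => i _; exact: cabs_ge0.
(* From h_j = b_j + r h_{j+1}, a partial sum S satisfies S <= M + |r| (S + M). The last M bounds the
   extra term created by the shift of index. *)
exists ((M + cabs r * M) / (1 - cabs r)) => n.
rewrite ler_pdivlMr // mulrBr mulr1 lerBlDr.
set S := \sum_(k < n) _.
have : S <= \sum_(k < n) cabs (b k) + cabs r * \sum_(k < n) cabs (div_tail b r k.+1).
  rewrite mulr_sumr -big_split /=; apply: ler_sum => k _.
  by rewrite div_tailE //; apply: le_trans (cabsD _ _) _; rewrite cabsM.
move/le_trans; apply.
have h : \sum_(k < n) cabs (div_tail b r k.+1) <= S + M.
  have : \sum_(k < n.+1) cabs (div_tail b r k) <= S + M by rewrite big_ord_recr lerD2l.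
  apply: le_trans; rewrite big_ord_recl lerDr; exact: cabs_ge0.
have h2 := ler_wpM2l r0 h; have h3 := bM n; rewrite mulrDr mulrC in h2; lra.
Qed.

Lemma pser_div_tail b r x : l1 b -> cabs r < 1 -> cabs x <= 1 ->
  (x - r) * pser (div_tail b r) x = x * pser b x - r * div_tail b r 0.
Proof.
move=> lb r1 x1; have lh := l1_div_tail lb r1.
have lh' : l1 (fun k => div_tail b r k.+1) by apply/(@l1_shift _ (div_tail b r)).
have e1 := pser_shift lh x1.
have e2 : pser (div_tail b r) x = pser b x + r * pser (fun k => div_tail b r k.+1) x.
  rewrite -(pserZ r lh' x1) -pserD //; last exact: l1Z.
  by apply: pser_eq => k; apply: div_tailE.
move: e1 e2; set H := pser _ x; set G := pser b x; set H' := pser _ x; set h := div_tail b r 0.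
move=> e1 e2; rewrite mulrBl {1}e2 {1}e1; ring.
Qed.

Let div_aux (z s A1 A2 A3 A4 A5 A6 : C) :
  (z - s) * A1 = A2 -> A2 = A3 + s * A6 ->
  (z - s) * (A6 + z * A4) = z * A5 - s * A6 ->
  A3 + z * A5 = (A1 + A6 + z * A4) * (z - s).
Proof.
move=> h1 h2 h3.
have -> : A3 + z * A5 = (A3 + s * A6) + (z * A5 - s * A6) by ring.
rewrite -h2 -h1 -h3; ring.
Qed.

(** Dividing the strictly anticausal part by z - r leaves the constant remainder r h_0. It is added
    to the causal part ([a]), which [div_rec] then divides. The constant term h_0 of the anticausal
    quotient is returned at index 0 by [e]. Without an anticausal part all h_j vanish, and the
    quotient is causal with zero constant term. *)
Lemma wf_div_in f c r : wf f c -> cabs r < 1 ->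
  exists d, wf (fun t => f t / (expi t - r)) d /\
    (causal_coef c -> causal_coef d /\ d 0 = 0).
Proof.
move=> [la lb fE] r1.
pose h := div_tail (fun k => c (Negz k)) r.
have lh : l1 h by apply: l1_div_tail.
pose a k := c (Posz k) + (if k is 0%N then r * h 0%N else 0).
pose e k : C := if k is 0%N then h 0%N else 0.
have le' : l1 e by apply/l1_shift; exact: l1_0.
have la0 : l1 (fun k => if k is 0%N then r * h 0%N else 0) by apply/l1_shift; exact: l1_0.
have la' : l1 a by apply: l1D.
have ldr := l1_div_rec la' r1.
exists (fun k => match k with Posz n => div_rec a r n + e n | Negz n => h n.+1 end).
split; last first.
  move=> c0; have hz k : h k = 0.
    rewrite /h /div_tail -(pser0 r); apply: pser_eq => j; exact: c0.
  by split=> [k|]; rewrite ?hz //= hz addr0.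
split; [exact: l1D|by apply/(@l1_shift _ h)|move=> t].
have x1 : cabs (expi (- t)) <= 1 by rewrite cabs_expi.
have z1 : cabs (expi t) <= 1 by rewrite cabs_expi.
have zr : expi t - r != 0.
  by apply/eqP => /subr0_eq zr; move: r1; rewrite -zr cabs_expi ltxx.
rewrite fE; apply: (mulIf zr); rewrite divfK //.
rewrite (pserD ldr le' x1).
have -> : pser e (expi (- t)) = h 0%N.
  by rewrite (pser_shift le' x1) /= pser0 mulr0; apply: addr0.
have E : expi (- t) * expi t = 1 by rewrite mulrC expiNr.
have h1 := pser_div_rec la' r1 x1 E.
have h2 : pser a (expi (- t)) = pser (fun k => c (Posz k)) (expi (- t)) + r * h 0%N.
  rewrite (pserD la la0 x1) (pser_shift la0 x1) /= pser0 mulr0; congr (_ + _); exact: addr0.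
have h3 := pser_div_tail lb r1 z1.
rewrite -/h in h3; rewrite (pser_shift lh z1) in h3.
exact: div_aux h1 h2 h3.
Qed.

(** For |r| > 1 the substitution z -> z^{-1} moves the root inside, through 1/(z - r) = - r^{-1}
    z^{-1} / (z^{-1} - r^{-1}). *)
Lemma wf_div_root f c r : wf f c -> cabs r != 1 ->
  exists d, wf (fun t => f t / (expi t - r)) d.
Proof.
move=> h; rewrite neq_lt => /orP[r1|r1].
  by have [d [hd _]] := wf_div_in h r1; exists d.
have r0 : r != 0 by rewrite -cabs_eq0 gt_eqF // (lt_trans _ r1).
have [|d [hd _]] := wf_div_in (wf_opp h) (r := r^-1).
  by rewrite cabsV invf_lt1 // (lt_trans _ r1).
have := wfZ (- r^-1) (wf_unshift (wf_opp hd)).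
set g := (X in wf X); set d' := (X in wf _ X) => hg; exists d'.
suff <- : g = (fun t => f t / (expi t - r)) by [].
apply/funext => t; rewrite /g opprK expiN.
have z0 := expi_neq0 t.
have zr : expi t - r != 0.
  by apply/eqP => /subr0_eq zr; move: r1; rewrite -zr cabs_expi ltxx.
have zr' : (expi t)^-1 - r^-1 = - (expi t - r) / (expi t * r) by field; apply/andP.
rewrite zr' invfM invrN invrK.
move: (f t) (expi t) z0 zr {zr'} => F z z0 zr; field; apply/and3P; split => //.
Qed.

Definition pact (p : {poly C}) c (k : int) := \sum_(i < size p) p`_i * c (k + i%:Z).

Lemma wf_mulpoly p f c : wf f c -> wf (fun t => p.[expi t] * f t) (pact p c).
Proof.
move=> h.
have := wf_sum (index_enum _) (fun i : 'I_(size p) => wfZ p`_i (wf_shiftn i h)).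
congr wf; apply/funext => t; rewrite horner_coef mulr_suml.
by apply: eq_bigr => i _; rewrite mulrA.
Qed.

Lemma wf_divpoly p f c : wf f c -> (forall z, root p z -> cabs z != 1) -> p != 0 ->
  exists d, wf (fun t => f t / p.[expi t]) d.
Proof.
move=> h hp p0; have [s ps] := closed_field_poly_normal p.
have {hp} : all (fun z => cabs z != 1) s.
  apply/allP => z zs; apply: hp; rewrite ps rootZ ?lead_coef_eq0 //.
  by rewrite root_prod_XsubC.
have -> : (fun t => f t / p.[expi t]) =
    (fun t => (lead_coef p)^-1 * (f t / (\prod_(z <- s) ('X - z%:P)).[expi t])).
  apply/funext => t; rewrite [in LHS]ps hornerZ invfM; exact: mulrCA.
move=> hs; suff [d hd] : exists d, wf (fun t => f t / (\prod_(z <- s) ('X - z%:P)).[expi t]) d.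
  by exists (fun k => (lead_coef p)^-1 * d k); apply: wfZ.
elim: s hs {ps} => [_|r s IH /= /andP[r1 /IH [d hd]]].
  by exists c; under eq_fun do rewrite big_nil hornerC divr1.
have [e he] := wf_div_root hd r1; exists e.
have := he; congr wf; apply/funext => t.
by rewrite big_cons hornerM hornerXsubC invfM mulrA mulrAC.
Qed.

(** A one-sided Cauchy product suffices: in every other product formed below, one factor is a
    constant, a polynomial, the inverse of a polynomial without roots on the circle, or a
    resolvent. *)
Lemma wf_causal_mul f g c d : wf f c -> wf g d -> causal_coef c -> causal_coef d ->
  exists2 e, wf (fun t => f t * g t) e & causal_coef e.
Proof.
move=> [la lb fE] [la' lb' gE] c0 d0.
pose h := cauchy_prod (fun k => c (Posz k)) (fun k => d (Posz k)).
exists (fun k => if k is Posz n then h n else 0) => //.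
split; [exact: l1_cauchy_prod|exact: l1_0|move=> t].
have x1 : cabs (expi (- t)) <= 1 by rewrite cabs_expi.
rewrite (@pser_cauchy_prod _ _ _ _ la la' x1) pser0 mulr0.
rewrite fE gE (pser_eq (b := fun=> 0) (expi t) c0) (pser_eq (b := fun=> 0) (expi t) d0).
by rewrite pser0 mulr0 !addr0.
Qed.

End WienerDivision.

(** * Matrices over the Wiener algebra *)

Section WienerMatrix.
Variable R : realType.
Local Notation C := R[i].

Definition wm p q (F : tf R p q) (c : int -> 'M[C]_(p, q)) :=
  forall i j, wf (fun t => F t i j) (fun k => c k i j).

Lemma wm_uniq p q (F : tf R p q) c d : wm F c -> wm F d -> c = d.
Proof.
move=> h h'; apply/funext => k; apply/matrixP => i j.
by have := wf_uniq (h i j) (h' i j); move/(congr1 (fun f => f k)).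
Qed.

Lemma wm_uniq_fun p q (F G : tf R p q) c : wm F c -> wm G c -> F = G.
Proof.
move=> h h'; apply/funext => t; apply/matrixP => i j.
by have := wf_uniq_fun (h i j) (h' i j); move/(congr1 (fun f => f t)).
Qed.

Lemma wm_exists p q (F : tf R p q) :
  (forall i j, exists c, wf (fun t => F t i j) c) -> exists c, wm F c.
Proof.
move=> h; exists (fun k => \matrix_(i, j) (sval (cid (h i j)) k)) => i j.
have := svalP (cid (h i j)); congr wf; apply/funext => k; by rewrite mxE.
Qed.

Lemma wmD p q (F G : tf R p q) c d :
  wm F c -> wm G d -> wm (fun t => F t + G t) (fun k => c k + d k).
Proof.
move=> h h' i j; have := wfD (h i j) (h' i j); congr wf; apply/funext => x; by rewrite mxE.
Qed.

Lemma wmZ p q (F : tf R p q) c a : wm F c -> wm (fun t => a *: F t) (fun k => a *: c k).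
Proof.
move=> h i j; have := wfZ a (h i j); congr wf; apply/funext => x; by rewrite mxE.
Qed.

Lemma wmN p q (F : tf R p q) c : wm F c -> wm (fun t => - F t) (fun k => - c k).
Proof. by move=> /(wmZ (-1)); congr wm; apply/funext => x; rewrite scaleN1r. Qed.

Lemma wmB p q (F G : tf R p q) c d :
  wm F c -> wm G d -> wm (fun t => F t - G t) (fun k => c k - d k).
Proof. by move=> h /wmN; apply: wmD. Qed.

Lemma wm_mulmxl p q r (M : 'M[C]_(r, p)) (F : tf R p q) c :
  wm F c -> wm (fun t => M *m F t) (fun k => M *m c k).
Proof.
move=> h i j; have := wf_sum (index_enum _) (fun k => wfZ (M i k) (h k j)).
by congr wf; apply/funext => x; rewrite mxE.
Qed.

Lemma wm_mulmxr p q r (M : 'M[C]_(q, r)) (F : tf R p q) c :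
  wm F c -> wm (fun t => F t *m M) (fun k => c k *m M).
Proof.
move=> h i j; have := wf_sum (index_enum _) (fun k => wfZ (M k j) (h i k)).
by congr wf; apply/funext => x; rewrite mxE; apply: eq_bigr => k _; rewrite mulrC.
Qed.

Lemma wm_shift p q (F : tf R p q) c :
  wm F c -> wm (fun t => expi t *: F t) (fun k => c (k + 1)).
Proof.
move=> h i j; have := wf_shift (h i j); congr wf; apply/funext => x; by rewrite mxE.
Qed.

Lemma wm_unshift p q (F : tf R p q) c :
  wm F c -> wm (fun t => expi (- t) *: F t) (fun k => c (k - 1)).
Proof.
move=> h i j; have := wf_unshift (h i j); congr wf; apply/funext => x; by rewrite mxE.
Qed.

Definition mpact p q (P : {poly C}) (c : int -> 'M[C]_(p, q)) (k : int) :=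
  \sum_(i < size P) P`_i *: c (k + i%:Z).

Lemma mpactE p q n (P : {poly C}) (c : int -> 'M[C]_(p, q)) k : (size P <= n)%N ->
  mpact P c k = \sum_(i < n) P`_i *: c (k + i%:Z).
Proof.
move=> pn; rewrite /mpact (big_ord_widen n (fun i => P`_i *: c (k + i%:Z))) // big_mkcond.
apply: eq_bigr => i _; case: ltnP => // /leq_sizeP -> //; by rewrite scale0r.
Qed.

Lemma wm_mulpoly p q P (F : tf R p q) c :
  wm F c -> wm (fun t => P.[expi t] *: F t) (mpact P c).
Proof.
move=> h i j; have := wf_mulpoly P (h i j); congr wf; apply/funext => x.
  by rewrite mxE.
by rewrite summxE; apply: eq_bigr => k _; rewrite mxE.
Qed.

Lemma wm_conj_opp p q (F : tf R p q) c : wm F c ->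
  wm (fun t => map_mx Num.conj (F (- t))) (fun k => map_mx Num.conj (c k)).
Proof.
move=> h i j; have := wf_conj_opp (h i j); congr wf; apply/funext => x; by rewrite mxE.
Qed.

Lemma wm_ctr p q (F : tf R p q) c : wm F c ->
  wm (fun t => ctr (F t)) (fun k => ctr (c (- k))).
Proof.
move=> h i j; have := wf_conj (h j i); congr wf; apply/funext => x; by rewrite !mxE.
Qed.

Lemma wm_bounded p q (F : tf R p q) c : wm F c -> exists M, forall t i j, cabs (F t i j) <= M.
Proof.
move=> h; have hb i j := wf_bounded (h i j).
exists (\sum_i \sum_j `|sval (cid (hb i j))|) => t i j.
apply: le_trans (svalP (cid (hb i j)) t) _; apply: le_trans (ler_norm _) _.
rewrite (bigD1 i) //= (bigD1 j) //= -addrA lerDl addr_ge0 // sumr_ge0 // => *.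
by apply: sumr_ge0.
Qed.

Lemma wm_coef_bounded p q (F : tf R p q) c :
  wm F c -> exists M, forall k i j, cabs (c k i j) <= M.
Proof.
move=> h; have hb i j := wf_coef_bounded (h i j).
exists (\sum_i \sum_j `|sval (cid (hb i j))|) => t i j.
apply: le_trans (svalP (cid (hb i j)) t) _; apply: le_trans (ler_norm _) _.
rewrite (bigD1 i) //= (bigD1 j) //= -addrA lerDl addr_ge0 // sumr_ge0 // => *.
by apply: sumr_ge0.
Qed.

Lemma wm_divpoly p q P (F : tf R p q) c : wm F c ->
  (forall z, root P z -> cabs z != 1) -> P != 0 ->
  exists d, wm (fun t => (P.[expi t])^-1 *: F t) d.
Proof.
move=> h hP P0; apply: wm_exists => i j.
have [d hd] := wf_divpoly (h i j) hP P0; exists d.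
by have := hd; congr wf; apply/funext => t; rewrite mxE mulrC.
Qed.

Lemma wm_mulpolymx p q r (P : 'M[{poly C}]_(p, q)) (F : tf R q r) c : wm F c ->
  exists d, wm (fun t => map_mx (horner_eval (expi t)) P *m F t) d.
Proof.
move=> h; apply: wm_exists => i j.
have := wf_sum (index_enum _) (fun k => wf_mulpoly (P i k) (h k j)).
set d := (X in wf _ X) => hd; exists d.
by have := hd; congr wf; apply/funext => t; rewrite mxE; apply: eq_bigr => k _; rewrite mxE.
Qed.

Lemma char_poly_mx_eval n (A : 'M[C]_n) z :
  map_mx (horner_eval z) (char_poly_mx A) = z%:M - A.
Proof.
apply/matrixP => i j; rewrite !mxE /horner_eval hornerD hornerN hornerC.
by rewrite hornerMn hornerX.
Qed.

Lemma char_poly_eval n (A : 'M[C]_n) z : (char_poly A).[z] = \det (z%:M - A).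
Proof. by rewrite -char_poly_mx_eval -[LHS]/(horner_eval z _) -det_map_mx. Qed.

(** By Cramer's rule the resolvent is the adjugate, polynomial in z, divided by the characteristic
    polynomial. The latter has no root on the circle, so both operations stay in the Wiener
    algebra. *)
Lemma wm_resolvent n q (A : 'M[C]_n) (F : tf R n q) c :
  (forall t, (expi t)%:M - A \in unitmx) -> wm F c ->
  exists d, wm (fun t => invmx ((expi t)%:M - A) *m F t) d.
Proof.
move=> hA h; have [d hd] := wm_mulpolymx (\adj (char_poly_mx A)) h.
have [||e he] := wm_divpoly hd (P := char_poly A).
- move=> z rz; apply/eqP => /expi_surj [t zt].
  have := hA t; rewrite unitmxE -char_poly_eval -zt (rootP rz).
  by rewrite unitr0.
- exact/monic_neq0/char_poly_monic.
exists e; have := he; congr wm; apply/funext => t.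
rewrite map_mx_adj char_poly_mx_eval char_poly_eval /invmx hA.
by rewrite -scalemxAl.
Qed.

Definition mcausal_coef p q (c : int -> 'M[C]_(p, q)) := forall k, c (Negz k) = 0.

Lemma causal_tfP p q (F : tf R p q) :
  causal_tf F <-> exists2 c, wm F c & mcausal_coef c.
Proof.
have e0 (a : nat -> C) t :
    clim (fun n => \sum_(k < n) a k * zinv t k%:Z) = pser a (expi (- t)).
  rewrite pserE; congr clim; apply/funext => n; apply: eq_bigr => k _.
  by rewrite zinv_nat.
split=> [[d [[M dM] dF]]|[c h c0]].
  exists (fun k => if k is Posz n then d n else 0) => // i j.
  have hz : (fun k : nat => (0 : 'M[C]_(p, q)) i j) = fun=> 0.
    by apply/funext => k; rewrite mxE.
  split=> [||t].
  - exists M => n; apply: le_trans (dM n); apply: ler_sum => k _.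
    rewrite (bigD1 i) //= (bigD1 j) //= -addrA lerDl.
    by rewrite addr_ge0 ?sumr_ge0 // => *; rewrite ?sumr_ge0 // => *; apply: cabs_ge0.
  - by rewrite hz; apply: l1_0.
  - rewrite hz pser0 mulr0 dF mxE (e0 (fun k => d k i j)); symmetry; exact: addr0.
exists (fun k => c (Posz k)); split.
  have hb i j : l1 (fun k => c (Posz k) i j) by case: (h i j).
  exists (\sum_i \sum_j sval (cid (hb i j))) => n.
  rewrite exchange_big /=; apply: ler_sum => i _.
  rewrite exchange_big /=; apply: ler_sum => j _.
  exact: (svalP (cid (hb i j))).
move=> t; apply/matrixP => i j; rewrite mxE (e0 (fun k => c (Posz k) i j)).
have [_ _ ->] := h i j.
rewrite (pser_eq (b := fun=> 0) (expi t)); last by move=> k; rewrite c0 mxE.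
rewrite pser0 mulr0; exact: addr0.
Qed.

Lemma wm_causal_part p q (F : tf R p q) c : wm F c ->
  wm (causal_part F) (fun k => if k is Posz n then c n else 0).
Proof.
move=> h i j; have [la lb fE] := h i j.
have hz : (fun k : nat => (0 : 'M[C]_(p, q)) i j) = fun=> 0.
  by apply/funext => k; rewrite mxE.
split=> [||t]; first exact: la.
  by rewrite hz; apply: l1_0.
rewrite hz pser0 mulr0 mxE pserE; apply/esym; apply: etrans (addr0 _) _.
congr clim; apply/funext => n; apply: eq_bigr => k _.
by rewrite zinv_nat mxE (wf_fcoef _ (h i j)).
Qed.

Lemma wm_anticausal_part p q (F : tf R p q) c : wm F c ->
  wm (anticausal_part F) (fun k => if k is Posz n then 0 else c k).
Proof.
move=> h i j; have [la lb fE] := h i j.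
have hz : (fun k : nat => (0 : 'M[C]_(p, q)) i j) = fun=> 0.
  by apply/funext => k; rewrite mxE.
split=> [||t]; [by rewrite hz; apply: l1_0|exact: lb|].
have z1 : cabs (expi t) <= 1 by rewrite cabs_expi.
rewrite hz pser0 mxE -(clim_mull (expi t) lb z1); apply: etrans _ (esym (add0r _)).
congr clim; apply/funext => n; apply: eq_bigr => k _.
by rewrite zinv_neg mxE (wf_fcoef _ (h i j)) NegzE exprS.
Qed.

Lemma wm_causal_mul p q r (F : tf R p q) (G : tf R q r) c d :
  wm F c -> wm G d -> mcausal_coef c -> mcausal_coef d ->
  exists2 e, wm (fun t => F t *m G t) e & mcausal_coef e.
Proof.
move=> hF hG c0 d0.
have c0' i k : causal_coef (fun l => c l i k) by move=> l; rewrite c0 mxE.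
have d0' k j : causal_coef (fun l => d l k j) by move=> l; rewrite d0 mxE.
have h i k j := wf_causal_mul (hF i k) (hG k j) (c0' i k) (d0' k j).
pose e i k j := s2val (cid2 (h i k j)).
have he i k j : wf (fun t => F t i k * G t k j) (e i k j) by exact: s2valP (cid2 (h i k j)).
have e0 i k j : causal_coef (e i k j) by exact: s2valP' (cid2 (h i k j)).
exists (fun l => \matrix_(i, j) \sum_k e i k j l) => [i j|l].
  by have := wf_sum (index_enum _) (fun k => he i k j); congr wf; apply/funext => x; rewrite mxE.
by apply/matrixP => i j; rewrite !mxE; apply: big1 => k _; rewrite e0.
Qed.

End WienerMatrix.

(** * Bounded solutions of linear recursions *)

Section Hyperbolic.
Variable R : realType.
Local Notation C := R[i].

Definition bnd p q (x : nat -> 'M[C]_(p, q)) := exists M, forall k i j, cabs (x k i j) <= M.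

Lemma bnd_mulmxl p q r (M : 'M[C]_(r, p)) (x : nat -> 'M[C]_(p, q)) :
  bnd x -> bnd (fun k => M *m x k).
Proof.
move=> [b hb]; exists (\sum_i \sum_j cabs (M i j) * `|b|) => k i j.
rewrite mxE; apply: le_trans (cabs_sum _ _ _) _.
rewrite (bigD1 i) //=; apply: ler_wpDr.
  by do 2![apply: sumr_ge0 => *]; rewrite mulr_ge0 ?cabs_ge0.
apply: ler_sum => l _; rewrite cabsM ler_wpM2l ?cabs_ge0 //.
exact: le_trans (hb k l j) (ler_norm _).
Qed.

Lemma bnd_mulmxr p q r (M : 'M[C]_(q, r)) (x : nat -> 'M[C]_(p, q)) :
  bnd x -> bnd (fun k => x k *m M).
Proof.
move=> [b hb].
have [|c hc] := @bnd_mulmxl _ _ _ M^T (fun k => (x k)^T); first by exists b => k i j; rewrite mxE.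
by exists c => k i j; have := hc k j i; rewrite -trmx_mul mxE.
Qed.

Lemma bndD p q (x y : nat -> 'M[C]_(p, q)) : bnd x -> bnd y -> bnd (fun k => x k + y k).
Proof.
move=> [b hb] [c hc]; exists (b + c) => k i j; rewrite mxE.
exact: le_trans (cabsD _ _) (lerD (hb k i j) (hc k i j)).
Qed.

Lemma bndZ p q a (x : nat -> 'M[C]_(p, q)) : bnd x -> bnd (fun k => a *: x k).
Proof.
move=> [b hb]; exists (cabs a * b) => k i j; rewrite mxE cabsM.
by rewrite ler_wpM2l ?cabs_ge0.
Qed.

(** Iteration gives x_k = r^n x_{k+n}, whose modulus is at most |r|^n times the bound. *)
Lemma bnd_shrink p q (r : C) (x : nat -> 'M[C]_(p, q)) : cabs r < 1 -> bnd x ->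
  (forall k, x k = r *: x k.+1) -> forall k, x k = 0.
Proof.
move=> r1 [b hb] xr k; apply/matrixP => i j; rewrite mxE; apply/eqP; rewrite -cabs_eq0.
have h n : x k i j = r ^+ n * x (k + n)%N i j.
  elim: n => [|n ->]; first by rewrite addn0 expr0 mul1r.
  by rewrite [in LHS]xr mxE mulrA addnS exprSr.
have b0 : 0 <= b := le_trans (cabs_ge0 _) (hb 0%N i j).
rewrite eq_le cabs_ge0 andbT.
have lim0 : (cabs r ^+ n * b) @[n --> \oo] --> (0 : R).
  rewrite -(mul0r b); apply: cvgM; last exact: cvg_cst.
  by apply: cvg_expr; rewrite ger0_norm ?cabs_ge0.
rewrite -(cvg_lim _ lim0) //; apply: limr_ge; first by apply/cvg_ex; exists 0.
by apply: nearW => n; rewrite (h n) cabsM cabsX ler_wpM2l ?exprn_ge0 ?cabs_ge0.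
Qed.

Definition fold_sub p q (F : 'M[C]_p) (s : seq C) (x : 'M[C]_(p, q)) : 'M[C]_(p, q) :=
  foldr (fun r y => (F - r%:M) *m y) x s.

Lemma fold_sub_comm p q (F : 'M[C]_p) s (x : 'M[C]_(p, q)) :
  fold_sub F s (F *m x) = F *m fold_sub F s x.
Proof.
elim: s => [//|r s IH] /=; rewrite IH !mulmxA; congr (_ *m _).
by rewrite mulmxBl mulmxBr scalar_mxC.
Qed.

Lemma bnd_fold_sub p q (F : 'M[C]_p) s (x : nat -> 'M[C]_(p, q)) :
  bnd x -> bnd (fun k => fold_sub F s (x k)).
Proof. by move=> h; elim: s => [//|r s IH] /=; apply: bnd_mulmxl. Qed.

(** The factors F - r are peeled off one at a time. If y_k denotes the product of the remaining
    factors applied to x_k, then (F - r) y_{k+1} = 0 turns y_k = F y_{k+1} into y_k = r y_{k+1}, and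
    [bnd_shrink] gives y = 0. The forward version uses r^{-1} instead. *)
Lemma bnd_backward_eq0 p q (F : 'M[C]_p) s (x : nat -> 'M[C]_(p, q)) :
  all (fun r => cabs r < 1) s -> bnd x -> (forall k, x k = F *m x k.+1) ->
  (forall k, fold_sub F s (x k) = 0) -> forall k, x k = 0.
Proof.
move=> hs bx xF; elim: s hs => [|r s IH] //= /andP[r1 /IH {IH} h] e.
apply: h; apply: (@bnd_shrink _ _ r) => // [|k]; first exact: bnd_fold_sub.
rewrite {1}xF fold_sub_comm; have := e k.+1; rewrite mulmxBl mul_scalar_mx.
by move/eqP; rewrite subr_eq0 => /eqP.
Qed.

Lemma bnd_forward_eq0 p q (F : 'M[C]_p) s (x : nat -> 'M[C]_(p, q)) :
  all (fun r => 1 < cabs r) s -> bnd x -> (forall k, x k.+1 = F *m x k) ->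
  (forall k, fold_sub F s (x k) = 0) -> forall k, x k = 0.
Proof.
move=> hs bx xF; elim: s hs => [|r s IH] //= /andP[r1 /IH {IH} h] e.
have r0 : r != 0 by rewrite -cabs_eq0 gt_eqF // (lt_trans _ r1).
apply: h; apply: (@bnd_shrink _ _ r^-1) => [||k].
- by rewrite cabsV invf_lt1 // (lt_trans _ r1).
- exact: bnd_fold_sub.
- rewrite xF fold_sub_comm; have := e k; rewrite mulmxBl mul_scalar_mx.
  by move/eqP; rewrite subr_eq0 => /eqP ->; rewrite scalerK.
Qed.

Lemma horner_mx_prod n q (A : 'M[C]_n.+1) s (x : 'M[C]_(n.+1, q)) :
  horner_mx A (\prod_(r <- s) ('X - r%:P)) *m x = fold_sub A s x.
Proof.
elim: s => [|r s IH] /=; first by rewrite big_nil rmorph1 mul1mx.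
rewrite big_cons rmorphM /= -mulmxE -mulmxA IH rmorphB /= horner_mx_X.
by rewrite horner_mx_C.
Qed.

Lemma horner_mx_prod_tr n q (A : 'M[C]_n.+1) s (x : 'M[C]_(n.+1, q)) :
  (horner_mx A (\prod_(r <- s) ('X - r%:P)))^T *m x = fold_sub A^T s x.
Proof.
elim: s => [|r s IH] /=; first by rewrite big_nil rmorph1 trmx1 mul1mx.
rewrite big_cons mulrC rmorphM /= -mulmxE trmx_mul -mulmxA IH rmorphB /= horner_mx_X.
by rewrite horner_mx_C linearB /= tr_scalar_mx.
Qed.

(** [P1] and [P2] are the spectral projections for the eigenvalues inside and outside the disc,
    obtained from a Bezout relation u p1 + v p2 = 1 between the two factors of the characteristic
    polynomial. A bounded backward solution has no component on decaying modes, and a bounded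
    forward solution none on growing modes. *)
Lemma hyperbolic_split n (A : 'M[C]_n) :
  (forall z, root (char_poly A) z -> cabs z != 1) ->
  exists P1 P2 J : 'M[C]_n,
   [/\ P1 + P2 = 1%:M, P1 *m P2 = 0, P2 *m A *m J = P2,
    (forall q (x : nat -> 'M[C]_(n, q)), bnd x -> (forall k, x k = A^T *m x k.+1) ->
       forall k, P1^T *m x k = 0)
    & (forall q (x : nat -> 'M[C]_(n, q)), bnd x -> (forall k, x k.+1 = A *m x k) ->
       forall k, P2 *m x k = 0)].
Proof.
(* Polynomials in a matrix exist only in positive dimension, so dimension 0 is treated apart. *)
case: n A => [|n] A hA.
  have z q (M N : 'M[C]_(0, q)) : M = N by apply/matrixP => -[].
  by exists 0, 0, 0; split => *; apply: z.
have [s hs] := closed_field_poly_normal (char_poly A).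
have chM := char_poly_monic A.
rewrite (monicP chM) scale1r in hs.
pose s1 := [seq z <- s | cabs z < 1]; pose s2 := [seq z <- s | ~~ (cabs z < 1)].
pose p1 := \prod_(z <- s1) ('X - z%:P); pose p2 := \prod_(z <- s2) ('X - z%:P).
have p12 : char_poly A = p1 * p2.
  by rewrite hs (bigID (fun z : C => cabs z < 1)) /= /p1 /p2 !big_filter.
have s1i : all (fun r => cabs r < 1) s1 by apply: filter_all.
have s2o : all (fun r => 1 < cabs r) s2.
  apply/allP => z; rewrite mem_filter -leNgt => /andP[z1 zs].
  by rewrite lt_neqAle z1 andbT eq_sym; apply: hA; rewrite hs root_prod_XsubC.
have cop12 : coprimep p1 p2.
  rewrite /p2; elim: s2 s2o {p2 p12} => [_|z t IH /= /andP[z1 ht]].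
    by rewrite big_nil coprimep1.
  rewrite big_cons coprimepMr IH // andbT coprimep_XsubC root_prod_XsubC.
  by rewrite mem_filter negb_and -leNgt (ltW z1).
have cop2X : coprimep p2 'X.
  rewrite coprimepX root_prod_XsubC; apply/negP => /(allP s2o).
  by rewrite cabs0 ltr10.
have [[u v] /= uv] := Bezout_eq1_coprimepP _ _ cop12.
have [[y w] /= yw] := Bezout_eq1_coprimepP _ _ cop2X.
have CH : horner_mx A (p1 * p2) = 0 by rewrite -p12 Cayley_Hamilton.
pose P1 := horner_mx A (v * p2); pose P2 := horner_mx A (u * p1).
(* Since y p2 + w X = 1 and p2(A) vanishes on the range of [P2], the matrix w(A) inverts [A]
   there. *)
exists P1, P2, (horner_mx A w).
have P1A : P1 *m A = A *m P1 by rewrite -[in LHS](horner_mx_X A) -[in RHS](horner_mx_X A) !mulmxE -!rmorphM mulrC.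
have P2A : P2 *m A = A *m P2 by rewrite -[in LHS](horner_mx_X A) -[in RHS](horner_mx_X A) !mulmxE -!rmorphM mulrC.
have P1p1 : P1 *m horner_mx A p1 = 0.
  by rewrite mulmxE -rmorphM -mulrA [p2 * _]mulrC rmorphM /= CH mulr0.
have P2p2 : horner_mx A p2 *m P2 = 0.
  by rewrite mulmxE -rmorphM mulrCA [p2 * _]mulrC rmorphM /= CH mulr0.
split.
- by rewrite -rmorphD /= addrC uv rmorph1.
- by rewrite mulmxE -rmorphM mulrACA [p2 * p1]mulrC rmorphM /= CH mulr0.
- rewrite -[X in _ *m X *m _](horner_mx_X A) !mulmxE -!rmorphM -mulrA [_ * w]mulrC.
  have -> : w * 'X = 1 - y * p2 by rewrite -yw addrC addKr.
  rewrite mulrBr mulr1 rmorphB /= [X in _ - X](_ : _ = 0) ?subr0 //.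
  have -> : u * p1 * (y * p2) = u * y * (p1 * p2) by rewrite mulrACA.
  by rewrite [LHS]rmorphM /= CH mulr0.
- move=> q x bx xA; apply: (@bnd_backward_eq0 _ _ A^T s1) => //.
  + exact: bnd_mulmxl.
  + by move=> k; rewrite {1}xA !mulmxA -!trmx_mul P1A.
  + by move=> k; rewrite -horner_mx_prod_tr mulmxA -trmx_mul -/p1 P1p1 trmx0 mul0mx.
- move=> q x bx xA; apply: (@bnd_forward_eq0 _ _ A s2) => //.
  + exact: bnd_mulmxl.
  + by move=> k; rewrite xA !mulmxA P2A.
  + by move=> k; rewrite -horner_mx_prod mulmxA -/p2 P2p2 mul0mx.
Qed.

(** Take a matrix of greatest rank among those whose row space satisfies [P]. Adjoining a vector of
    [P] outside its row space would raise the rank. *)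
Lemma max_subspace n (P : 'rV[C]_n -> Prop) : P 0 ->
  (forall a u v, P u -> P v -> P (a *: u + v)) ->
  exists V : 'M[C]_n, forall u, P u <-> (u <= V)%MS.
Proof.
move=> P0 Plin.
pose good (V : 'M[C]_n) := forall u, (u <= V)%MS -> P u.
pose D k := `[< exists2 V, good V & \rank V = k >].
have D0 : exists k, D k.
  exists 0%N; apply/asboolP; exists 0; last exact: mxrank0.
  by move=> u; rewrite submx0 => /eqP ->.
have Dn k : D k -> (k <= n)%N by move=> /asboolP [V _ <-]; apply: rank_leq_row.
case: (ex_maxnP D0 Dn) => k /asboolP [V gV rV] kmax.
exists V => u; split; last exact: gV.
move=> Pu; have gW : good (V + u)%MS.
  move=> w /sub_addsmxP [[x y] /= ->].
  rewrite (mx11_scalar y) mul_scalar_mx addrC.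
  by apply: Plin => //; apply: gV; apply: submxMl.
have : D (\rank (V + u)%MS) by apply/asboolP; exists (V + u)%MS.
move=> /kmax; rewrite -rV => h.
have := mxrank_leqif_sup (addsmxSl V u); move/leqifP.
by case: ifP => [/(submx_trans (addsmxSr V u))|_]; last by rewrite ltnNge h.
Qed.

(* On (Z, L) the recursion is block triangular with diagonal blocks A and, on the
   unstable part of A^T where alone L is bounded, the inverse of A^T. Hence as
   many solutions stay bounded as A has eigenvalues. *)
Lemma bounded_solution_dim n q (A Q : 'M[C]_n) (Z L : nat -> 'M[C]_(n, q)) :
  (forall z, root (char_poly A) z -> cabs z != 1) -> bnd Z -> bnd L ->
  (forall k, Z k.+1 = A *m Z k + Q *m L k) -> (forall k, L k = A^T *m L k.+1) ->
  exists d (W : nat -> 'M[C]_(n, d)), (d <= n)%N /\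
    forall N (r : nat -> 'rV[C]_n), \sum_(i < N) r i *m W i = 0 ->
      forall k, \sum_(i < N) r i *m Z (k + i)%N = 0.
Proof.
move=> hA bZ bL ZE LE.
have [P1 [P2 [J [P12 P1P2 PAJ backw forw]]]] := hyperbolic_split hA.
have P1L k : P1^T *m L k = 0 by apply: backw.
have P2L k : P2^T *m L k = L k.
  by rewrite -[RHS]mul1mx -trmx1 -P12 linearD /= mulmxDl P1L add0r.
(* [L] lives on the range of [P2^T], where [A^T] is inverted by [J^T]. The backward recursion can
   thus be run forward, so that both sequences follow the single matrix [AA]. *)
have LJ k : L k.+1 = J^T *m L k.
  by rewrite [in RHS]LE -[in LHS]P2L -PAJ !trmx_mul -!mulmxA P2L.
pose AA := block_mx A Q 0 J^T.
pose s k := col_mx (Z k) (L k).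
have sE k : s k.+1 = AA *m s k by rewrite /s mul_block_col ZE LJ mul0mx add0r.
have sX j k : s (k + j)%N = AA ^+ j *m s k.
  elim: j => [|j IH]; first by rewrite addn0 expr0 mul1mx.
  by rewrite addnS sE IH mulmxA exprS.
(* The space of initial pairs with bounded orbit whose second component has no decaying part.
   Vectors are transposed because subspaces are row spaces. *)
pose E (u : 'rV[C]_(n + n)) := P1^T *m dsubmx u^T = 0 /\ bnd (fun k => AA ^+ k *m u^T).
have [||V VE] := @max_subspace _ E.
- split; first by rewrite trmx0 linear0 mulmx0.
  by exists 0 => k i j; rewrite trmx0 mulmx0 mxE cabs0.
- move=> a u v [u1 u2] [v1 v2]; split.
    by rewrite !linearP /= u1 v1 scaler0 addr0.
  have -> : (fun k => AA ^+ k *m (a *: u + v)^T) =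
      fun k => a *: (AA ^+ k *m u^T) + AA ^+ k *m v^T.
    by apply/funext => k; rewrite !linearP.
  by apply: bndD => //; apply: bndZ.
have sV k : ((s k)^T <= V)%MS.
  apply/row_subP => j; apply/VE; rewrite -tr_col; split; rewrite trmxK.
    by rewrite colE -mul_dsub_mx /s col_mxKd mulmxA P1L mul0mx.
  have -> : (fun i => AA ^+ i *m col j (s k)) = fun i => s (k + i)%N *m delta_mx j 0.
    by apply/funext => i; rewrite colE mulmxA -sX.
  apply: bnd_mulmxr; move: bZ bL => [b1 h1] [b2 h2]; exists (`|b1| + `|b2|) => i a c.
  rewrite /s -[a]splitK; case: (fintype.split a) => l /=; rewrite ?col_mxEu ?col_mxEd.
    by apply: le_trans (h1 _ l c) _; apply: le_trans (ler_norm _) _; rewrite lerDl.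
  by apply: le_trans (h2 _ l c) _; apply: le_trans (ler_norm _) _; rewrite lerDr.
(* In [E] a pair (z, l) is determined by (P1 z, P2^T l). If both vanish then l = 0, since P1^T l = 0
   as well. Then A^k z is bounded, so P2 z = 0 and z = 0. As P1 P2 = 0, the ranks of [P1] and [P2]
   add up to at most n, which bounds the dimension of [V]. *)
pose PP := block_mx P1^T 0 0 P2.
have inj (u : 'rV_(n + n)) : (u <= V)%MS -> u *m PP = 0 -> u = 0.
  move=> /(proj2 (VE u)) [u1 u2] u0; apply: trmx_inj; rewrite trmx0.
  set z := usubmx u^T; set l := dsubmx u^T.
  have ul : u^T = col_mx z l by rewrite vsubmxK.
  have : PP^T *m u^T = 0 by rewrite -trmx_mul u0 trmx0.
  rewrite ul /PP tr_block_mx trmxK !trmx0 mul_block_col !mul0mx addr0 add0r.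
  rewrite -[0 in X in X -> _](@col_mx0 _ n n 1) => /eq_col_mx [P1z P2l].
  have l0 : l = 0.
    by rewrite -[LHS]mul1mx -trmx1 -P12 linearD /= mulmxDl u1 P2l addr0.
  rewrite l0.
  have AX k : AA ^+ k *m col_mx z 0 = col_mx (A ^+ k *m z) 0.
    elim: k => [|k IH]; first by rewrite !expr0 !mul1mx.
    by rewrite !exprS -!mulmxE -!mulmxA IH mul_block_col !mulmx0 !mul0mx !addr0.
  have z0 : z = 0.
    rewrite -[LHS]mul1mx -P12 mulmxDl P1z add0r.
    have := forw _ (fun k => A ^+ k *m z); move/(_ _ _ 0%N); rewrite expr0 mul1mx; apply.
    - move: u2 => [b hb]; exists b => k i j.
      by have := hb k (lshift n i) j; rewrite ul l0 AX col_mxEu.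
    - by move=> k; rewrite exprS -mulmxE mulmxA.
  by rewrite z0 col_mx0.
have rkV : (\rank V <= n)%N.
  have <- : \rank (V *m PP) = \rank V.
    apply/mxrank_injP/rowV0P => u; rewrite sub_capmx => /andP[uV /sub_kermxP uP].
    exact: inj.
  apply: leq_trans (mxrankM_maxr _ _) _.
  rewrite rank_diag_block_mx mxrank_tr; exact: mulmx0_rank_max.
(* [W i] is the upper half of [AA ^+ i] on a basis of [V]. Every Z (k + i) is [W i] times a matrix
   depending on k only, so a relation among the [W i] holds at every k. *)
exists (\rank V), (fun i => row_mx 1%:M 0 *m (AA ^+ i) *m (row_base V)^T); split => //.
move=> N r rW k.
have /submxP [X sXk] : ((s k)^T <= row_base V)%MS by rewrite eq_row_base.
have {}sXk : s k = (row_base V)^T *m X^T by rewrite -trmx_mul -sXk trmxK.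
transitivity ((\sum_(i < N) r i *m (row_mx 1%:M 0 *m (AA ^+ i) *m (row_base V)^T)) *m X^T); last first.
  by rewrite rW mul0mx.
rewrite mulmx_suml; apply: eq_bigr => i _; rewrite -!mulmxA -sXk -sX /s.
by rewrite mul_row_col mul1mx mul0mx addr0.
Qed.

End Hyperbolic.

(** * Fejer-Riesz factorization *)

Section FejerRiesz.
Variable R : realType.
Local Notation C := R[i].

Lemma poly_circle_eq0 (p : {poly C}) : (forall t, p.[expi t] = 0) -> p = 0.
Proof.
move=> hp; have h := wf_mulpoly p (@wf1 R).
have e : (fun t => p.[expi t] * 1) = fun=> 0 by apply/funext => t; rewrite hp mul0r.
rewrite e in h; have h0 := wf_uniq h (@wf0 R).
apply/polyP => j; rewrite coef0; have := congr1 (fun c => c (- j%:Z)) h0.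
have [jp|jp] := ltnP j (size p); last by rewrite (leq_sizeP _ _ jp).
rewrite /pact (bigD1 (Ordinal jp)) //= addNr eqxx mulr1 big1 ?addr0 // => i ij.
by rewrite addrC subr_eq0 eqz_nat (negPf (_ : nat_of_ord i != j)) ?mulr0.
Qed.

Lemma poly_circle_inj (p q : {poly C}) : (forall t, p.[expi t] = q.[expi t]) -> p = q.
Proof.
move=> h; apply/eqP; rewrite -subr_eq0; apply/eqP/poly_circle_eq0 => t.
by rewrite hornerD hornerN h subrr.
Qed.

(** As [P] is real, [f] equals its conjugate reciprocal [g](z) = z^{2n} conj (f (1 / conj z)): the
    two agree on the circle. Roots therefore come in pairs reflected in the circle, and positivity
    excludes roots on it. *)
Lemma fejer_riesz_root n (f : {poly C}) (P : R -> C) (r : C) :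
  size f = (n + n).+1 -> (forall t, 0 < P t) ->
  (forall t, f.[expi t] = expi t ^+ n * P t) -> root f r ->
  [/\ r != 0, cabs r != 1 & root f (Num.conj r)^-1].
Proof.
move=> sf P0 fP fr.
pose g := \poly_(i < (n + n).+1) Num.conj f`_(n + n - i).
have gE x : x != 0 -> g.[x] = x ^+ (n + n) * Num.conj f.[(Num.conj x)^-1].
  move=> x0; rewrite horner_poly horner_coef sf rmorph_sum mulr_sumr.
  rewrite (reindex_inj rev_ord_inj) /=; apply: eq_bigr => i _.
  have il : (i <= n + n)%N by rewrite -ltnS.
  rewrite subSS subKn // rmorphM rmorphXn fmorphV /= conjCK mulrCA; congr (_ * _).
  by rewrite exprVn -expfB_cond ?(negPf x0).
have gf : g = f.
  apply: poly_circle_inj => t; rewrite gE ?expi_neq0 // expi_conj -expiN opprK fP.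
  have Pc : Num.conj (P t) = P t by apply/CrealP/gtr0_real.
  rewrite rmorphM rmorphXn /= expi_conj Pc exprD mulrA.
  by rewrite -[_ * _ * expi (- t) ^+ n]mulrA -exprMn expiNr expr1n mulr1.
have r0 : r != 0.
  apply/eqP => re; move: fr; rewrite re rootE horner_coef0 -gf coef_poly ltn0Sn subn0.
  rewrite fmorph_eq0 -[(n + n)%N]/((n + n).+1.-1) -sf -lead_coefE lead_coef_eq0.
  by rewrite -size_poly_eq0 sf.
split => //.
  apply/eqP => /expi_surj [t rt]; move: fr; rewrite rt rootE fP mulf_eq0.
  by rewrite expf_eq0 (negPf (expi_neq0 t)) andbF /= gt_eqF.
rewrite rootE -gf gE ?invr_eq0 ?fmorph_eq0 // fmorphV /= conjCK invrK.
by rewrite (rootP fr) rmorph0 mulr0.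
Qed.

Let fejer_aux (z s t x p : C) n : z - s != 0 -> z != 0 -> t != 0 -> z^-1 - t != 0 ->
  x * (z - t^-1) * (z - s) = z * z ^+ n * p ->
  - t^-1 * x = z ^+ n * (p / ((z - s) * (z^-1 - t))).
Proof.
move=> h1 h2 h3 h4 h5.
have h4' : z - t^-1 = - t^-1 * z * (z^-1 - t) by field; apply/andP.
have /(mulfI h2) h6 : z * (z ^+ n * p) = z * (- t^-1 * x * ((z - s) * (z^-1 - t))).
  rewrite [LHS]mulrA -h5 h4'.
  move: (z^-1 - t) (t^-1) => y y'; ring.
by rewrite [RHS]mulrA h6 mulfK // mulf_neq0.
Qed.

(* With r' the conjugate of r, (z - r)(z - 1/r') = - z |z - r|^2 / r' on the circle,
   so dividing by it removes one factor z and keeps the cofactor positive. *)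
Lemma fejer_riesz n (f : {poly C}) (P : R -> C) :
  size f = (n + n).+1 -> (forall t, 0 < P t) ->
  (forall t, f.[expi t] = expi t ^+ n * P t) ->
  exists s (k : C), [/\ size s = n, all (fun r => cabs r < 1) s, 0 < k
    & forall t, P t = k * ((\prod_(r <- s) ('X - r%:P)).[expi t]
        * Num.conj (\prod_(r <- s) ('X - r%:P)).[expi t])].
Proof.
elim: n f P => [|n IH] f P sf P0 fP.
  have /size_poly1P [c c0 fc] : size f == 1%N by rewrite sf.
  exists [::], c; split => //.
    by have := P0 0; have := fP 0; rewrite fc hornerC expr0 mul1r => ->.
  by move=> t; have := fP t; rewrite big_nil fc !hornerC expr0 mul1r rmorph1 !mulr1.
have [x fx] : exists x, root f x by apply/closed_rootP; rewrite sf.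
have [r [fr r0 r1 fr']] : exists r, [/\ root f r, r != 0, cabs r < 1 & root f (Num.conj r)^-1].
  have [x0 x1 fx'] := fejer_riesz_root sf P0 fP fx.
  have [xl|xl] := ltP (cabs x) 1; first by exists x.
  exists (Num.conj x)^-1; split => //.
  - by rewrite invr_eq0 fmorph_eq0.
  - have x1' : 1 < cabs x by rewrite lt_neqAle eq_sym x1 xl.
    by rewrite cabsV cabs_conj invf_lt1 // (lt_trans ltr01 x1').
  - by rewrite fmorphV /= conjCK invrK.
have rc0 : Num.conj r != 0 by rewrite fmorph_eq0.
have [h fh] := factor_theorem _ _ fr.
(* The reflected root is a second root of [f]: it has modulus above 1, so it is not r. *)
have hr' : root h (Num.conj r)^-1.
  move: fr'; rewrite fh rootM => /orP[//|]; rewrite root_XsubC => /eqP e.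
  have := r1; rewrite -cabs_conj -[Num.conj r]invrK e cabsV => r1'.
  have : 0 < cabs r by rewrite lt_neqAle cabs_ge0 andbT eq_sym cabs_eq0.
  by move=> p0; move: r1'; rewrite invf_lt1 // => /lt_trans /(_ r1); rewrite ltxx.
have [g hg] := factor_theorem _ _ hr'.
have f0 : f != 0 by rewrite -size_poly_eq0 sf.
have g0 : g != 0 by apply: contraNneq f0 => g0; rewrite fh hg g0 !mul0r.
have sg : size g = (n + n).+1.
  have := sf; rewrite fh hg -mulrA size_mul ?mulf_neq0 ?polyXsubC_eq0 //.
  rewrite size_mul ?polyXsubC_eq0 // !size_XsubC; set k := size g => e; lia.
have zr t : expi t - r != 0.
  by apply/eqP => /subr0_eq e; move: r1; rewrite -e cabs_expi ltxx.
have [|||s [k [ss sr k0 kP]]] := IH (- (Num.conj r)^-1 *: g)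
   (fun t => P t / ((expi t - r) * Num.conj (expi t - r))).
- by rewrite size_scale // oppr_eq0 invr_eq0.
- by move=> t; rewrite divr_gt0 // lt_neqAle eq_sym mulf_neq0 ?fmorph_eq0 //= mul_conjC_ge0.
- move=> t; have := fP t; rewrite fh hg !hornerM !hornerXsubC hornerZ.
  have zc0 : Num.conj (expi t - r) != 0 by rewrite fmorph_eq0.
  have zE : Num.conj (expi t - r) = (expi t)^-1 - Num.conj r by rewrite rmorphB /= expi_conj expiN.
  rewrite exprS; move: zc0; rewrite zE.
  move: (Num.conj r) (expi t) (zr t) (expi_neq0 t) rc0 (P t) (g.[_]) => rc z z1 z0 rc0' Pt gt zc.
  exact: fejer_aux.
exists (r :: s), k; split => //=; [by rewrite ss|by rewrite r1|].
move=> t; have := kP t; move/(canRL (divfK _)) => ->; last by rewrite mulf_neq0 ?fmorph_eq0.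
rewrite big_cons hornerM hornerXsubC rmorphM /= -[LHS]mulrA; congr (_ * _).
by rewrite [LHS]mulrACA; congr (_ * _); exact: mulrC.
Qed.

End FejerRiesz.

(** * Eigenvalues on the circle *)

Section Spectrum.
Variable R : realType.
Local Notation C := R[i].

Lemma linear_kernel_neq0 (F : fieldType) p q (f : 'rV[F]_p -> 'rV[F]_q) :
  (forall a u v, f (a *: u + v) = a *: f u + f v) -> (q < p)%N ->
  exists2 u, u != 0 & f u = 0.
Proof.
move=> fl qp.
have f0 : f 0 = 0 by have := fl (-1) 0 0; rewrite scaler0 addr0 scaleN1r addNr.
have fsum n (c : 'I_n -> F) (w : 'I_n -> 'rV[F]_p) :
    f (\sum_i c i *: w i) = \sum_i c i *: f (w i).
  elim: n c w => [|n IH] c w; first by rewrite !big_ord0.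
  by rewrite !big_ord_recl fl IH.
pose M := \matrix_i f (delta_mx 0 i).
have fM u : f u = u *m M.
  by rewrite {1}(row_sum_delta u) fsum mulmx_sum_row; apply: eq_bigr => i _; rewrite rowK.
have : kermx M != 0.
  rewrite -mxrank_eq0 mxrank_ker -lt0n subn_gt0.
  exact: leq_ltn_trans (rank_leq_col M) qp.
move=> /rowV0Pn [u /sub_kermxP uM u0]; exists u => //; by rewrite fM.
Qed.

Definition mnorm p q (M : 'M[C]_(p, q)) : R := \sum_i \sum_j cabs (M i j).

Lemma mnorm_ge0 p q (M : 'M[C]_(p, q)) : 0 <= mnorm M.
Proof. by do 2![apply: sumr_ge0 => *]; apply: cabs_ge0. Qed.

Lemma mnormD p q (M N : 'M[C]_(p, q)) : mnorm (M + N) <= mnorm M + mnorm N.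
Proof.
rewrite /mnorm -big_split; apply: ler_sum => i _; rewrite -big_split.
by apply: ler_sum => j _; rewrite mxE cabsD.
Qed.

Lemma mnormZ p q a (M : 'M[C]_(p, q)) : mnorm (a *: M) = cabs a * mnorm M.
Proof.
rewrite /mnorm mulr_sumr; apply: eq_bigr => i _; rewrite mulr_sumr.
by apply: eq_bigr => j _; rewrite mxE cabsM.
Qed.

Lemma mnormN p q (M : 'M[C]_(p, q)) : mnorm (- M) = mnorm M.
Proof. by rewrite -scaleN1r mnormZ cabsN cabs1 mul1r. Qed.

Lemma mnormM p q r (M : 'M[C]_(p, q)) (N : 'M[C]_(q, r)) :
  mnorm (M *m N) <= mnorm M * mnorm N.
Proof.
rewrite /mnorm mulr_suml; apply: ler_sum => i _.
apply: (@le_trans _ _ (\sum_j \sum_k cabs (M i k) * cabs (N k j))).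
  apply: ler_sum => j _; rewrite mxE; apply: le_trans (cabs_sum _ _ _) _.
  by apply: ler_sum => k _; rewrite cabsM.
rewrite exchange_big /= mulr_suml; apply: ler_sum => k _.
rewrite -mulr_sumr ler_wpM2l ?cabs_ge0 // [leRHS](bigD1 k) //= lerDl.
by do 2![apply: sumr_ge0 => *]; apply: cabs_ge0.
Qed.

Lemma mnorm_eq0 p q (M : 'M[C]_(p, q)) : mnorm M = 0 -> M = 0.
Proof.
move=> h; apply/matrixP => i j; rewrite mxE; apply/eqP; rewrite -cabs_eq0 eq_le cabs_ge0 andbT -h.
rewrite /mnorm (bigD1 i) //= (bigD1 j) //= -addrA lerDl addr_ge0 //.
  by apply: sumr_ge0 => *; apply: cabs_ge0.
by do 2![apply: sumr_ge0 => *]; apply: cabs_ge0.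
Qed.

Lemma mnorm_le p q (M : 'M[C]_(p, q)) b :
  (forall i j, cabs (M i j) <= b) -> mnorm M <= (p * q)%:R * b.
Proof.
move=> h; apply: (@le_trans _ _ (\sum_(i < p) \sum_(j < q) b)).
  by apply: ler_sum => i _; apply: ler_sum => j _; apply: h.
by rewrite !sumr_const !card_ord -mulrnA -(mulr_natl b) [(q * p)%N]mulnC.
Qed.

Lemma circle_nonroot (f : {poly C}) t0 (e : R) : f != 0 -> 0 < e ->
  exists t, cabs (expi t - expi t0) < e /\ ~~ root f (expi t).
Proof.
move=> f0 e0; apply: contrapT => hn.
have hroot t : cabs (expi t - expi t0) < e -> root f (expi t).
  by move=> h; apply: contrapT => /negP h'; apply: hn; exists t.
(* The points z0 (1 - i s)/(1 + i s) lie on the circle and tend to z0 as s -> 0. *)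
pose s (k : nat) : R := (e / 4) / k.+1%:R.
have s0 k : 0 < s k by rewrite !divr_gt0.
have se k : s k <= e / 4 by rewrite ler_pdivrMr // ler_peMr ?ler1n // divr_ge0 // ltW.
pose den k : C := (1 +i* s k)%C.
pose num k : C := (1 +i* - s k)%C.
have den0 k : den k != 0.
  by rewrite eq_complex /= negb_and oner_eq0.
have den1 k : 1 <= cabs (den k).
  rewrite /cabs /= -[X in X <= _]sqrtr1 ler_sqrt ?addr_ge0 ?sqr_ge0 // expr1n lerDl; exact: sqr_ge0.
have cnum k : cabs (num k) = cabs (den k) by rewrite /cabs /= sqrrN.
pose w k := expi t0 * (num k / den k).
have cw k : cabs (w k) = 1.
  rewrite /w !cabsM cabs_expi mul1r cabsV cnum mulfV // cabs_eq0; exact: den0.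
(* |num - den| = 2 s_k and |den| >= 1, so the distance is at most 2 s_k <= e / 2. *)
have wclose k : cabs (w k - expi t0) < e.
  have -> : w k - expi t0 = expi t0 * ((num k - den k) / den k).
    by rewrite /w mulrBl divff // mulrBr mulr1.
  rewrite !cabsM cabs_expi mul1r cabsV.
  have -> : cabs (num k - den k) = 2 * s k.
    have -> : num k - den k = (0 +i* (- (2 * s k)))%C.
      by apply/eqP; rewrite eq_complex /= subrr eqxx /=; apply/eqP; ring.
    rewrite /cabs /= expr0n /= add0r sqrtr_sqr normrN ger0_norm //.
    by rewrite mulr_ge0 // ltW.
  have : (cabs (den k))^-1 <= 1 by rewrite invf_le1 // (lt_le_trans ltr01).
  have := se k; have := s0 k => h1 h2 h3.
  apply: (@le_lt_trans _ _ (2 * s k)); last by lra.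
  by rewrite ler_piMr // mulr_ge0 // ltW.
have winj : injective w.
  move=> k l; rewrite /w => /(mulfI (expi_neq0 t0)) h.
  have : num k * den l = num l * den k.
    apply: (mulIf (mulf_neq0 (invr_neq0 (den0 k)) (invr_neq0 (den0 l)))).
    have -> : num k * den l * ((den k)^-1 / den l) = num k / den k * (den l / den l) by rewrite mulrACA.
    have -> : num l * den k * ((den k)^-1 / den l) = num l / den l * (den k / den k).
      by rewrite [(den k)^-1 / _]mulrC mulrACA.
    by rewrite h !divff.
  move/(congr1 (@complex.Im R)); rewrite /= !mul1r !mulr1 => h'.
  have {h'} : s k = s l by lra.
  move/(mulfI _)/invr_inj/eqP; rewrite eqr_nat eqSS => /(_ _)/eqP; apply.
  by rewrite gt_eqF // divr_gt0.
have h1 : all (root f) (mkseq w (size f)).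
  apply/allP => x /mapP [k _ ->]; have [t wt] := expi_surj (cw k).
  by rewrite wt; apply: hroot; rewrite -wt.
have h2 : uniq (mkseq w (size f)) by apply: mkseq_uniq.
by have := max_poly_roots f0 h1 h2; rewrite size_mkseq ltnn.
Qed.

(** The rank conditions supply a left inverse ([M1], [M2]) and a right inverse ([N1], [N2]). Near z0
    the first turns the bound on Cy G B into one on G B, and the second turns that into one on G. If
    z0 were an eigenvalue with left eigenvector v, then v = (z - z0) v G, which a bounded G forbids
    for z close to z0. *)
Lemma circle_regular n dy dw (A : 'M[C]_n) (B : 'M[C]_(n, dw)) (Cy : 'M[C]_(dy, n))
  t0 (b : R) :
  \rank (col_mx ((expi t0)%:M - A) Cy) = n ->
  \rank (row_mx ((expi t0)%:M - A) B) = n ->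
  (forall t, (expi t)%:M - A \in unitmx ->
     mnorm (Cy *m invmx ((expi t)%:M - A) *m B) <= b) ->
  (expi t0)%:M - A \in unitmx.
Proof.
move=> hobs hctr hb; apply: contrapT => /negP sing.
set z0 := expi t0 in hobs hctr sing.
have /row_fullP [M hM] : row_full (col_mx (z0%:M - A) Cy) by rewrite /row_full hobs.
have /row_freeP [N hN] : row_free (row_mx (z0%:M - A) B) by rewrite /row_free hctr.
rewrite -[M]hsubmxK mul_row_col in hM; rewrite -[N]vsubmxK mul_row_col in hN.
move: (lsubmx M) (rsubmx M) (usubmx N) (dsubmx N) hM hN => M1 M2 N1 N2 hM hN.
have [v v0 vA] : exists2 v : 'rV[C]_n, v != 0 & v *m (z0%:M - A) = 0.
  have : kermx (z0%:M - A) != 0.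
    rewrite -mxrank_eq0 mxrank_ker subn_eq0 -ltnNge ltn_neqAle rank_leq_row andbT.
    by rewrite -row_free_unit in sing.
  by move=> /rowV0Pn [u /sub_kermxP uM u0]; exists u.
have b0 : 0 <= `|b| by [].
(* The factors 2 absorb the error terms containing E = z - z0, which are at most half of the norm
   being estimated. *)
pose K1 := 2 * (mnorm M1 * mnorm B + mnorm M2 * `|b|).
pose K2 := 2 * (mnorm N1 + K1 * mnorm N2).
have K10 : 0 <= K1 by rewrite mulr_ge0 // addr_ge0 // mulr_ge0 ?mnorm_ge0.
have K20 : 0 <= K2 by rewrite mulr_ge0 // addr_ge0 ?mnorm_ge0 // mulr_ge0 ?mnorm_ge0.
(* This radius makes |E| times the norms of [M1] and [N1] at most 1/2, and |E| K2 < 1. *)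
pose e := (2 * (1 + mnorm M1 + mnorm N1 + K2))^-1.
have e0 : 0 < e.
  rewrite invr_gt0; have := mnorm_ge0 M1; have := mnorm_ge0 N1; lra.
have chA0 : char_poly A != 0 by apply/monic_neq0/char_poly_monic.
have [t [te tr]] := circle_nonroot t0 chA0 e0.
have ut : (expi t)%:M - A \in unitmx.
  by rewrite unitmxE -char_poly_eval unitfE -rootE.
set z := expi t in te tr ut; set G := invmx (z%:M - A); set E := z - z0.
have EA : z0%:M - A = (z%:M - A) - E%:M.
  by rewrite /E raddfB /= opprB [RHS]addrC addrA subrK.
have hE : cabs E * (2 * (1 + mnorm M1 + mnorm N1 + K2)) < 1.
  rewrite -lter_pdivlMr; first by rewrite div1r.
  have := mnorm_ge0 M1; have := mnorm_ge0 N1; lra.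
have E0 := cabs_ge0 E; have m1 := mnorm_ge0 M1; have n1 := mnorm_ge0 N1.
have EM1 : cabs E * mnorm M1 <= 1 / 2 by nra.
have EN1 : cabs E * mnorm N1 <= 1 / 2 by nra.
have EK2 : cabs E * K2 < 1 by nra.
have gb : mnorm (G *m B) <= K1.
  have e1 : G *m B = M1 *m B - E *: (M1 *m (G *m B)) + M2 *m (Cy *m G *m B).
    rewrite -[LHS]mul1mx -hM EA mulmxDl -!mulmxA; congr (_ + _).
    by rewrite mulmxBl mulmxBr mulKVmx // mul_scalar_mx -scalemxAr.
  have h1 : mnorm (G *m B) <= mnorm M1 * mnorm B + cabs E * (mnorm M1 * mnorm (G *m B))
       + mnorm M2 * `|b|.
    rewrite {1}e1; apply: le_trans (mnormD _ _) _; apply: lerD.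
      apply: le_trans (mnormD _ _) _; apply: lerD; first exact: mnormM.
      by rewrite mnormN mnormZ ler_wpM2l // mnormM.
    apply: le_trans (mnormM _ _) _; rewrite ler_wpM2l ?mnorm_ge0 //.
    exact: le_trans (hb t ut) (ler_norm _).
  have g0 := mnorm_ge0 (G *m B); rewrite /K1; nra.
have gg : mnorm G <= K2.
  have e1 : G = N1 - E *: (G *m N1) + G *m B *m N2.
    rewrite -[LHS]mulmx1 -hN EA mulmxDr mulmxA; congr (_ + _); last by rewrite mulmxA.
    by rewrite mulmxBr mulmxBl mulVmx // mul1mx mul_mx_scalar -scalemxAl.
  have h1 : mnorm G <= mnorm N1 + cabs E * (mnorm G * mnorm N1) + K1 * mnorm N2.
    rewrite {1}e1; apply: le_trans (mnormD _ _) _; apply: lerD.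
      apply: le_trans (mnormD _ _) _; apply: lerD => //.
      by rewrite mnormN mnormZ ler_wpM2l // mnormM.
    apply: le_trans (mnormM _ _) _; by rewrite ler_wpM2r ?mnorm_ge0.
  have g0 := mnorm_ge0 G; rewrite /K2; nra.
have vE : v = E *: (v *m G).
  have : v *m (z%:M - A) = E *: v.
    have -> : z%:M - A = (z0%:M - A) + E%:M by rewrite EA subrK.
    by rewrite mulmxDr vA add0r mul_mx_scalar.
  by move/(congr1 (fun u => u *m G)); rewrite mulmxK // -scalemxAl.
have vn : 0 < mnorm v.
  rewrite lt_neqAle mnorm_ge0 andbT eq_sym; apply: contra v0 => /eqP/mnorm_eq0 ->.
  by [].
have : mnorm v <= cabs E * (mnorm v * mnorm G).
  by rewrite {1}vE mnormZ ler_wpM2l // mnormM.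
have : cabs E * (mnorm v * mnorm G) <= cabs E * (mnorm v * K2).
  by rewrite ler_wpM2l // ler_wpM2l // mnorm_ge0.
nra.
Qed.

End Spectrum.

(** * Companion realization *)

Section StateSpace.
Variable R : realType.
Local Notation C := R[i].

Lemma mxCE m n (M : 'M[R]_(m, n)) : mxC M = map_mx (real_complex R) M.
Proof. by []. Qed.

Lemma mxCM m n p (M : 'M[R]_(m, n)) (N : 'M[R]_(n, p)) : mxC (M *m N) = mxC M *m mxC N.
Proof. by rewrite !mxCE map_mxM. Qed.

(** A row w killed by both blocks satisfies w A = z w and w B = 0, hence w A^i B = 0 for all i. The
    spanning condition then forces w = 0. *)
Lemma controllable_pbh n dw (A : 'M[R]_n) (B : 'M[R]_(n, dw)) (z : C) :
  controllable A B -> \rank (row_mx (z%:M - mxC A) (mxC B)) = n.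
Proof.
move=> /sub_sumsmxP [u hu]; apply/eqP; rewrite -[_ == _]/(row_free _) -kermx_eq0.
apply/eqP/eqP/rowV0P => w /sub_kermxP.
rewrite mul_mx_row -[0 in X in X -> _]row_mx0 => /eq_row_mx [wA wB].
have {}wA : w *m mxC A = z *: w.
  by move: wA; rewrite mulmxBr mul_mx_scalar => /eqP; rewrite subr_eq0 eq_sym => /eqP.
have wAB i : w *m mxC (A ^+ i *m B) = 0.
  elim: i => [|i IH]; first by rewrite expr0 mul1mx.
  by rewrite exprS -mulmxE -mulmxA mxCM mulmxA wA -scalemxAl IH scaler0.
apply: trmx_inj; rewrite trmx0.
have : mxC (1%:M : 'M[R]_n) *m w^T = 0.
  rewrite hu mxCE map_mx_sum mulmx_suml big1 // => i _.
  have /submxP [X ->] : (<<(A ^+ i *m B)^T>> <= (A ^+ i *m B)^T)%MS by rewrite genmxE.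
  by rewrite -mxCE !mxCM -!mulmxA -[mxC _^T]map_trmx -trmx_mul wAB trmx0 !mulmx0.
by rewrite mxCE map_mx1 mul1mx.
Qed.

Section Companion.
Variables (n dy : nat) (a : {poly R}) (N : 'rV[{poly R}]_dy).
Hypothesis a_monic : a \is monic.
Hypothesis size_a : size a = n.+1.
Hypothesis size_N : forall j, (size (N 0%R j) <= n.+1)%N.

(** Observer form: for xi = (1, z, ..., z^{n-1}) one has xi (zI - F) = a(z) [comp_H], so the
    resolvent is known explicitly along [comp_H], and the columns of [comp_G] may be arbitrary
    numerators of degree below n. *)
Definition comp_F : 'M[R]_n :=
  \matrix_(i, j) if (j.+1 < n)%N then (i == j.+1 :> nat)%:R else - a`_i.
Definition comp_H : 'rV[R]_n := \row_j (j.+1 == n)%:R.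
Definition comp_L : 'rV[R]_dy := \row_j (N 0 j)`_n.
(** The coefficients of N - N_n a, the remainder of N modulo the monic [a]. The quotient N_n is the
    direct term [comp_L]. *)
Definition comp_G : 'M[R]_(n, dy) := \matrix_(i, j) ((N 0 j)`_i - a`_i * (N 0 j)`_n).

Lemma horner_monicC (z : C) :
  (map_poly (real_complex R) a).[z] = \sum_(i < n) (a`_i)%:C%C * z ^+ i + z ^+ n.
Proof.
rewrite (@horner_coef_wide _ n.+1) ?size_map_poly ?size_a //.
rewrite big_ord_recr /= coef_map /=; congr (_ + _).
  by apply: eq_bigr => i _; rewrite coef_map.
have := monicP a_monic; rewrite lead_coefE size_a /= => ->.
exact: mul1r.
Qed.

Lemma comp_row_eval (v : 'rV[C]_n) (z : C) (w : nat -> C) :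
  (forall i : 'I_n, v 0 i = w i) ->
  forall j : 'I_n, (v *m mxC comp_F) 0 j =
    if (j.+1 < n)%N then w j.+1 else - \sum_(i < n) (a`_i)%:C%C * w i.
Proof.
move=> vw j; rewrite mxE; case: ltnP => jn.
  rewrite (bigD1 (Ordinal jn)) //= !mxE jn eqxx vw /= big1 => [|i ij].
    by rewrite addr0; exact: mulr1.
  have -> : mxC comp_F i j = 0.
    rewrite !mxE jn [_ == _](_ : _ = false) //; apply/negbTE.
    by apply: contra ij => /eqP e; apply/eqP/val_inj.
  exact: mulr0.
rewrite -sumrN; apply: eq_bigr => i _; rewrite !mxE ltnNge jn /= vw toCE rmorphN /=.
by rewrite mulrN mulrC.
Qed.

(** A left eigenvector satisfies v_{j+1} = z v_j, so v_j = z^j v_0 with v_0 nonzero, and the last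
    column then says a(z) = 0. *)
Lemma comp_F_root z : root (char_poly (mxC comp_F)) z ->
  root (map_poly (real_complex R) a) z.
Proof.
rewrite -eigenvalue_root_char => /eigenvalueP [v hv v0].
pose w i := if insub i is Some j then v 0 (j : 'I_n) else 0.
have vw (i : 'I_n) : v 0 i = w i by rewrite /w valK.
have hrow := comp_row_eval z vw.
have wS i : (i.+1 < n)%N -> w i.+1 = z * w i.
  move=> il; have := hrow (Ordinal (ltnW il)); rewrite hv mxE /= il => <-.
  by rewrite vw.
have wX i : (i < n)%N -> w i = z ^+ i * w 0%N.
  elim: i => [|i IH] il; first by rewrite expr0 mul1r.
  by rewrite wS // IH 1?ltnW // exprS mulrA.
have n0 : (0 < n)%N.
  by rewrite lt0n; apply: contraNneq v0 => n0; apply/eqP/rowP => -[i il]; exfalso; rewrite n0 in il.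
have w0 : w 0%N != 0.
  apply: contraNneq v0 => w0; apply/eqP/rowP => i.
  by rewrite vw wX // w0 mulr0 mxE.
have pn : (n.-1 < n)%N by rewrite prednK.
have := hrow (Ordinal pn); rewrite hv mxE /= prednK // ltnn vw /= wX // mulrA -exprS prednK //.
move=> e; rewrite rootE horner_monicC; apply/eqP/(mulIf w0); rewrite mul0r mulrDl e.
rewrite mulr_suml; apply/eqP; rewrite subr_eq0; apply/eqP; apply: eq_bigr => i _.
by rewrite (wX i (ltn_ord i)) mulrA.
Qed.

Lemma companion_realizes (F : tf R 1 dy) :
  (forall z, root (map_poly (real_complex R) a) z -> cabs z < 1) ->
  (forall t, (map_poly (real_complex R) a).[expi t] *: F t =
     map_mx (fun r : {poly R} => (map_poly (real_complex R) r).[expi t]) N) ->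
  realizes F comp_F comp_G comp_H comp_L.
Proof.
move=> ha hF; split=> [z /comp_F_root /ha|t]; first by rewrite cabs_lt1.
set z := expi t; pose az := (map_poly (real_complex R) a).[z].
have az0 : az != 0.
  by apply/negP => /ha; rewrite cabs_expi ltxx.
have uz : z%:M - mxC comp_F \in unitmx.
  rewrite unitmxE -char_poly_eval unitfE; apply/negP => /comp_F_root/ha.
  by rewrite cabs_expi ltxx.
pose xi : 'rV[C]_n := \row_i z ^+ i.
have xiE : xi *m (z%:M - mxC comp_F) = az *: mxC comp_H.
  apply/rowP => j; rewrite mulmxBr mul_mx_scalar !mxE.
  have := @comp_row_eval xi z (fun i => z ^+ i) (fun i => mxE _ _ _ _) j.
  rewrite mxE => ->; case: ltnP => jn.
    rewrite (ltn_eqF jn) -exprS subrr; symmetry; exact: mulr0.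
  have -> : j.+1 = n by apply/eqP; rewrite eqn_leq jn ltn_ord.
  rewrite eqxx -exprS.
  have -> : j.+1 = n by apply/eqP; rewrite eqn_leq jn ltn_ord.
  rewrite opprK addrC -horner_monicC; symmetry; exact: mulr1.
have xiG : mxC comp_H *m invmx (z%:M - mxC comp_F) = az^-1 *: xi.
  by rewrite -[xi](mulmxK uz) xiE -scalemxAl scalerA mulVf // scale1r.
apply: (scalerI az0); rewrite hF xiG -scalemxAl scalerDr scalerA divff // scale1r.
apply/rowP => j; rewrite !mxE.
rewrite (@horner_coef_wide _ n.+1) ?size_map_poly ?size_N //.
rewrite big_ord_recr /= coef_map /= /az horner_monicC mulrDl.
have -> : \sum_(i < n) xi 0 i * mxC comp_G i j =
   \sum_(i < n) ((N 0 j)`_i)%:C%C * z ^+ i - (\sum_(i < n) (a`_i)%:C%C * z ^+ i) * ((N 0 j)`_n)%:C%C.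
  rewrite mulr_suml -sumrB; apply: eq_bigr => i _.
  rewrite !mxE toCE rmorphB rmorphM /=.
  move: (_%:C)%C (_%:C)%C (_%:C)%C (z ^+ i) => x y u v; ring.
have -> : \sum_(i < n) (map_poly (real_complex R) (N 0 j))`_i * z ^+ i
   = \sum_(i < n) ((N 0 j)`_i)%:C%C * z ^+ i by apply: eq_bigr => i _; rewrite coef_map.
rewrite toCE.
move: (\sum_(i < n) _) (\sum_(i < n) _) (_%:C)%C (z ^+ n) => x y u v; ring.
Qed.

End Companion.
End StateSpace.

(** * Canonical factors *)

Section Canonical.
Variable R : realType.
Local Notation C := R[i].

Lemma ctrM m n p (M : 'M[C]_(m, n)) (N : 'M[C]_(n, p)) : ctr (M *m N) = ctr N *m ctr M.
Proof. by rewrite /ctr map_mxM trmx_mul. Qed.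

Lemma ctrK m n (M : 'M[C]_(m, n)) : ctr (ctr M) = M.
Proof. by apply/matrixP => i j; rewrite !mxE conjCK. Qed.

Lemma ctr1 n : ctr (1%:M : 'M[C]_n) = 1%:M.
Proof. by rewrite /ctr map_mx1 trmx1. Qed.

Lemma ctr_inv n (M : 'M[C]_n) : ctr (invmx M) = invmx (ctr M).
Proof. by rewrite /ctr map_invmx trmx_inv. Qed.

Lemma ctr_unit n (M : 'M[C]_n) : (ctr M \in unitmx) = (M \in unitmx).
Proof. by rewrite /ctr unitmx_tr map_unitmx. Qed.

Lemma ctr_scalar n (a : C) : ctr (a%:M : 'M[C]_n) = (Num.conj a)%:M.
Proof. by rewrite /ctr map_scalar_mx tr_scalar_mx. Qed.

Lemma wm_cst p q (M : 'M[C]_(p, q)) : wm (fun=> M) (fun k => (k == 0)%:R *: M).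
Proof.
move=> i j; have := wfZ (M i j) (@wf1 R); congr wf; apply/funext => k.
  by rewrite mulr1.
by rewrite mxE mulrC.
Qed.

Lemma wm_scalar n (u : R -> C) c : wf u c ->
  wm (fun t => (u t)%:M : 'M[C]_n) (fun k => (c k)%:M).
Proof.
move=> h i j; have := wfZ ((i == j)%:R) h; congr wf; apply/funext => k;
  by rewrite mxE mulr_natl.
Qed.

(* D^{-1} D' is causal with causal inverse and unitary on the circle; so its
   inverse, being its adjoint, is also anticausal. *)
Lemma lcanonical_factor_uniq n S (D D' : tf R n n) :
  lcanonical_factor (fun=> True) S D -> lcanonical_factor (fun=> True) S D' ->
  exists2 V, V *m ctr V = 1%:M & forall t, D' t = D t *m V.
Proof.
move=> [/causal_tfP [c hc c0] uD /causal_tfP [ci hci ci0] SD].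
move=> [/causal_tfP [c' hc' c0'] uD' /causal_tfP [ci' hci' ci0'] SD'].
have [e he e0] := wm_causal_mul hci hc' ci0 c0'.
have [f hf f0] := wm_causal_mul hci' hc ci0' c0.
pose E t := inv_tf D t *m D' t.
have EE t : E t *m ctr (E t) = 1%:M.
  rewrite /E /inv_tf ctrM mulmxA -[_ *m D' t *m _]mulmxA SD' // -SD // ctr_inv.
  by rewrite mulmxA mulVmx // mul1mx mulmxV // ctr_unit.
have EF t : inv_tf D' t *m D t = ctr (E t).
  have EF1 : E t *m (inv_tf D' t *m D t) = 1%:M.
    by rewrite /E /inv_tf -mulmxA [D' t *m _]mulmxA mulmxV // mul1mx mulVmx.
  by rewrite -[RHS]mulmx1 -EF1 mulmxA (mulmx1C (EE t)) mul1mx.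
have hf' := wm_ctr he.
have ef : f = fun k => ctr (e (- k)).
  apply: wm_uniq hf _; have := hf'; congr wm; apply/funext => t; by rewrite EF.
have e1 k : e (Posz k.+1) = 0.
  have := f0 k; rewrite ef NegzE opprK => h.
  by rewrite -[LHS]ctrK h /ctr map_mx0 trmx0.
have Ecst : E = fun=> e 0.
  apply: wm_uniq_fun he _; have := wm_cst (e 0); congr wm; apply/funext => -[[|k]|k].
  - exact: scale1r.
  - by rewrite e1; exact: scale0r.
  - by rewrite e0; exact: scale0r.
exists (e 0); first by have := EE 0; rewrite Ecst.
by move=> t; rewrite -[e 0]/((fun=> e 0) t) -Ecst /E /inv_tf mulmxA mulmxV // mul1mx.
Qed.

Let ratio_aux (z x y A B : C) : z - y != 0 ->
  A / B + (y - x) * (A / B / (z - y)) = (z - x) * A / ((z - y) * B).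
Proof.
move=> zy; rewrite invfM mulrACA.
have -> : (z - x) / (z - y) = 1 + (y - x) / (z - y) by field.
move: (A / B) ((z - y)^-1) => F w; ring.
Qed.

(** Pair the factors: (z - x) / (z - y) = 1 + (y - x) / (z - y), and division by z - y with |y| < 1
    preserves causality. Equal sizes leave no factor over that would produce a positive power of
    z. *)
Lemma causal_ratio (s r : seq C) : size s = size r -> all (fun x => cabs x < 1) r ->
  exists2 c, wf (fun t => (\prod_(x <- s) ('X - x%:P)).[expi t] /
                          (\prod_(x <- r) ('X - x%:P)).[expi t]) c & causal_coef c.
Proof.
elim: s r => [|x s IH] [|y r] //= => [_ _|[sr] /andP[y1 ha]].
  exists (fun k => (k == 0)%:R) => //.
  have := @wf1 R; congr wf; apply/funext => t.
  by rewrite !big_nil hornerC divr1.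
have [c hc c0] := IH r sr ha.
have [d [hd d0]] := wf_div_in hc y1.
have {d0} [d0 _] := d0 c0.
exists (fun k => c k + (y - x) * d k); last by move=> k; rewrite c0 d0 mulr0 addr0.
have := wfD hc (wfZ (y - x) hd); congr wf; apply/funext => t.
rewrite !big_cons !hornerM !hornerXsubC.
have zy : expi t - y != 0.
  by apply/eqP => /subr0_eq e; move: y1; rewrite -e cabs_expi ltxx.
exact: ratio_aux.
Qed.

Lemma expi_lpoly_shift (t : R) (m i : nat) : (i <= m + m)%N ->
  expi t ^+ m * zinv t (i%:Z - m%:Z) = expi t ^+ (m + m - i).
Proof.
move=> im; rewrite -!expiMn /zinv -expiD; congr expi.
rewrite natrB // natrD rmorphB /= -!pmulrn; ring.
Qed.

Lemma lpoly_factor (p : int -> R) m : (forall k, p (- k) = p k) -> p m%:Z != 0 ->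
  (forall t, 0 < lpoly p m t) ->
  exists s (k : C), [/\ size s = m, all (fun r => cabs r < 1) s, 0 < k
    & forall t, lpoly p m t = k * ((\prod_(r <- s) ('X - r%:P)).[expi t]
        * Num.conj (\prod_(r <- s) ('X - r%:P)).[expi t])].
Proof.
move=> psym pm ppos.
(* This is z^m P(z): the coefficient of z^i is p (m - i), equal to p (i - m) by symmetry. Its degree
   is exactly 2m because p m is nonzero. *)
pose f : {poly C} := \poly_(i < (m + m).+1) toC (p (i%:Z - m%:Z)).
apply: (@fejer_riesz _ m f) => //.
  rewrite size_poly_eq //= PoszD addrK -cabs_eq0 cabs_toC normr_eq0 //.
move=> t; rewrite horner_poly /lpoly mulr_sumr (reindex_inj rev_ord_inj) /=.
apply: eq_bigr => i _; have il : (i <= m + m)%N by rewrite -ltnS.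
rewrite subSS [RHS]mulrCA expi_lpoly_shift //; congr (toC _ * _).
by rewrite -psym; congr p; lia.
Qed.

Definition ratio_tf (s r : seq C) (a : C) : tf R 1 1 := fun t =>
  (a * ((\prod_(x <- s) ('X - x%:P)).[expi t] /
        (\prod_(x <- r) ('X - x%:P)).[expi t]))%:M.

Lemma prod_XsubC_circle (s : seq C) t : all (fun x => cabs x < 1) s ->
  (\prod_(x <- s) ('X - x%:P)).[expi t] != 0.
Proof.
move=> hs; rewrite -rootE root_prod_XsubC; apply/negP => /(allP hs).
by rewrite cabs_expi ltxx.
Qed.

Let factor_aux (a l x x' y y' : C) : y != 0 -> y' != 0 -> l != 0 ->
  a * (x' / y') * (a * (x / y)) = a ^+ 2 * l * (x * x') / (l * (y * y')).
Proof. by move=> h1 h2 h3; field; rewrite h1 h2 h3. Qed.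

(** Equal degrees, with all roots of numerator and denominator in the disc, make both the ratio and
    its inverse causal. The constant is a positive real square root, hence its own conjugate. *)
Lemma ratio_tf_factor (p q : R -> C) (s r : seq C) (k l : C) :
  size s = size r -> all (fun x => cabs x < 1) s -> all (fun x => cabs x < 1) r ->
  0 < k -> 0 < l ->
  (forall t, p t = k * ((\prod_(x <- s) ('X - x%:P)).[expi t]
      * Num.conj (\prod_(x <- s) ('X - x%:P)).[expi t])) ->
  (forall t, q t = l * ((\prod_(x <- r) ('X - x%:P)).[expi t]
      * Num.conj (\prod_(x <- r) ('X - x%:P)).[expi t])) ->
  rcanonical_factor (fun=> True) (fun t => (p t / q t)%:M) (ratio_tf s r (sqrtC (k / l))).
Proof.
move=> sr hs hr k0 l0 pE qE; set a := sqrtC (k / l).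
have a2 : a ^+ 2 = k / l by rewrite sqrtCK.
have a0 : a != 0 by rewrite sqrtC_eq0 mulf_neq0 ?invr_eq0 ?gt_eqF.
have ac : Num.conj a = a by apply/CrealP/ger0_real; rewrite sqrtC_ge0 divr_ge0 // ltW.
have ps t := prod_XsubC_circle t hs; have pr t := prod_XsubC_circle t hr.
have un t : ratio_tf s r a t \in unitmx.
  by rewrite unitmxE det_scalar1 unitfE !mulf_neq0 ?invr_eq0.
split => //.
- apply/causal_tfP; have [c hc c0] := causal_ratio sr hr.
  exists (fun k => (a * c k)%:M); first by apply: wm_scalar; apply: wfZ.
  by move=> j; rewrite c0 mulr0 raddf0.
- apply/causal_tfP; have [c hc c0] := causal_ratio (esym sr) hs.
  exists (fun k => (a^-1 * c k)%:M); last by move=> j; rewrite c0 mulr0 raddf0.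
  have := @wm_scalar 1 _ _ (wfZ a^-1 hc); congr wm; apply/funext => t.
  by rewrite /inv_tf /ratio_tf invmx_scalar invfM invf_div.
move=> t _; rewrite /ratio_tf ctr_scalar -scalar_mxM; congr (_%:M).
rewrite rmorphM fmorph_div /= ac pE qE.
have -> : k = a ^+ 2 * l by rewrite a2 divfK // gt_eqF.
have ps' : Num.conj (\prod_(x <- s) ('X - x%:P)).[expi t] != 0 by rewrite fmorph_eq0.
have pr' : Num.conj (\prod_(x <- r) ('X - x%:P)).[expi t] != 0 by rewrite fmorph_eq0.
have l0' : l != 0 by rewrite gt_eqF.
exact: factor_aux.
Qed.

End Canonical.

(** * Rationality of the filter *)

Section Annihilator.
Variable R : realType.
Local Notation C := R[i].

Lemma wm_opp p q (F : tf R p q) c : wm F c -> wm (fun t => F (- t)) (fun k => c (- k)).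
Proof. by move=> h i j; have := wf_opp (h i j). Qed.

Lemma wm_sum p q n (F : 'I_n -> tf R p q) (c : 'I_n -> int -> 'M[C]_(p, q)) :
  (forall i, wm (F i) (c i)) -> wm (fun t => \sum_i F i t) (fun k => \sum_i c i k).
Proof.
move=> h i j; have := wf_sum (index_enum _) (fun l => h l i j); congr wf;
  by apply/funext => x; rewrite summxE.
Qed.

Lemma wm_shiftn p q n (F : tf R p q) c : wm F c ->
  wm (fun t => expi t ^+ n *: F t) (fun k => c (k + n%:Z)).
Proof.
move=> h i j; have := wf_shiftn n (h i j); congr wf; apply/funext => x; by rewrite mxE.
Qed.

Lemma causal_anticausal p q (F : tf R p q) c : wm F c ->
  forall t, F t = causal_part F t + anticausal_part F t.
Proof.
move=> h t; suff e : F = fun t => causal_part F t + anticausal_part F t.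
  exact: (congr1 (fun f => f t) e).
apply: (wm_uniq_fun h).
have := wmD (wm_causal_part h) (wm_anticausal_part h).
by congr wm; apply/funext => -[k|k]; [exact: addr0|exact: add0r].
Qed.

Definition rowpoly q n (N : nat -> 'rV[C]_q) : tf R 1 q :=
  fun t => \sum_(i < n) expi t ^+ i *: N i.

Lemma wm_rowpoly_mul q r n (N : nat -> 'rV[C]_q) (F : tf R q r) c : wm F c ->
  wm (fun t => rowpoly n N t *m F t) (fun k => \sum_(i < n) N i *m c (k + i%:Z)).
Proof.
move=> h; have := wm_sum (fun i : 'I_n => wm_shiftn i (wm_mulmxl (N i) h)).
congr wm; apply/funext => t; rewrite /rowpoly mulmx_suml; apply: eq_bigr => i _.
by rewrite scalemxAl.
Qed.

Lemma rowpoly_eq0 q n (N : nat -> 'rV[C]_q) :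
  (forall t, rowpoly n N t = 0) -> forall i, (i < n)%N -> N i = 0.
Proof.
move=> h i il; apply/rowP => j; rewrite mxE.
have : \poly_(l < n) N l 0 j = 0.
  apply: poly_circle_eq0 => t; have := congr1 (fun M : 'rV_q => M 0 j) (h t).
  rewrite mxE summxE horner_poly => e; rewrite -[RHS]e.
  by apply: eq_bigr => l _; rewrite mxE mulrC.
by move/(congr1 (fun p : {poly C} => p`_i)); rewrite coef_poly il coef0.
Qed.

Variables (n dy dw m : nat).
Variables (A : 'M[C]_n) (B : 'M[C]_(n, dw)) (Cy : 'M[C]_(dy, n)) (Cs : 'M[C]_(1, n)).
Hypothesis A_real : ctr A = A^T.
Hypothesis A_reg : forall t, (expi t)%:M - A \in unitmx.

Let G t := invmx ((expi t)%:M - A).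
Let H : tf R dy dw := fun t => Cy *m G t *m B.
Let L : tf R 1 dw := fun t => Cs *m G t *m B.
Let S : tf R dy dy := fun t => 1%:M + H t *m ctr (H t).
Let Ko := wiener_nc H L.

Variable D : tf R dy dy.
Hypothesis D_factor : lcanonical_factor (fun=> True) S D.

Let Y t := ctr (invmx (D t)).
Let lam t := ctr (G t) *m (ctr Cy *m Y t).
Let Z t := G t *m (B *m ctr B *m lam t).

(** D = S Y because S = D D^*, and H H^* Y = Cy Z. *)
Lemma factor_split t : D t = Y t + Cy *m Z t.
Proof.
have [_ uD _ SD] := D_factor; have uDt := uD t.
have : S t *m Y t = D t.
  rewrite -SD // -mulmxA /Y -ctrM mulVmx // ctr1; exact: mulmx1.
rewrite /S mulmxDl mul1mx => <-; congr (_ + _).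
by rewrite /Z /lam /H !ctrM !mulmxA.
Qed.

(** S^{-1} D = Y, so K_o D = L H^* Y. This removes the inverse of S from the formula. *)
Lemma wiener_mul_factor t : Ko t *m D t = Cs *m Z t.
Proof.
have [_ uD _ SD] := D_factor; have uDt := uD t.
have uSD : ctr (D t) \in unitmx by rewrite ctr_unit.
have e : invmx (S t) *m D t = Y t.
  have uS : S t \in unitmx by rewrite -SD // unitmx_mul uDt.
  apply: (can_inj (mulKmx uS)); rewrite mulKVmx // -SD // -mulmxA /Y -ctrM mulVmx //.
  by rewrite ctr1 mulmx1.
rewrite /Ko /wiener_nc -/(S t) -!mulmxA e.
by rewrite /Z /lam /L /H !ctrM !mulmxA.
Qed.

Lemma adjoint_state_rec t : expi (- t) *: lam t = A^T *m lam t + ctr Cy *m Y t.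
Proof.
have uG : ctr ((expi t)%:M - A) \in unitmx by rewrite ctr_unit.
have : ctr ((expi t)%:M - A) *m lam t = ctr Cy *m Y t.
  by rewrite /lam /G ctr_inv mulKVmx.
have -> : ctr ((expi t)%:M - A) = (expi (- t))%:M - A^T.
  rewrite -A_real -expi_conj -ctr_scalar.
  by apply/matrixP => i j; rewrite !mxE rmorphB.
by rewrite mulmxBl mul_scalar_mx => <-; rewrite addrC subrK.
Qed.

Lemma state_rec t : expi t *: Z t = A *m Z t + B *m ctr B *m lam t.
Proof.
have : ((expi t)%:M - A) *m Z t = B *m ctr B *m lam t by rewrite /Z /G mulKVmx.
by rewrite mulmxBl mul_scalar_mx => <-; rewrite addrC subrK.
Qed.

Lemma wm_states : exists y l z,
  [/\ wm Y y, wm lam l, wm Z z, (forall k, y (Posz k.+1) = 0)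
    & (forall k, l (Posz k) = A^T *m l (Posz k.+1)) /\
      (forall k, z (k + 1) = A *m z k + B *m ctr B *m l k)].
Proof.
have [_ uD /causal_tfP [c hc c0] _] := D_factor.
have hy : wm Y (fun k => ctr (c (- k))) by apply: wm_ctr.
set y := fun k => ctr (c (- k)) in hy.
have y0 k : y (Posz k.+1) = 0.
  by rewrite /y -NegzE c0 /ctr map_mx0 trmx0.
(* G^* is a resolvent of [A^T] at z^{-1}. The reflection t -> -t makes it a resolvent at z, and a
   second reflection undoes this. *)
have hY' := wm_opp (wm_mulmxl (ctr Cy) hy).
have uA t : (expi t)%:M - A^T \in unitmx.
  have := A_reg t; rewrite -unitmx_tr; congr (_ \in unitmx).
  by rewrite linearB /= tr_scalar_mx.
have [l' hl'] := wm_resolvent uA hY'.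
have hl : wm lam (fun k => l' (- k)).
  have := wm_opp hl'; congr wm; apply/funext => t; rewrite opprK /lam /G ctr_inv.
  congr (invmx _ *m _); rewrite -A_real -expi_conj -ctr_scalar.
  by apply/matrixP => i j; rewrite !mxE rmorphB.
set l := (X in wm _ X) in hl.
have [z hz] := wm_resolvent A_reg (wm_mulmxl (B *m ctr B) hl).
exists y, l, z; split => //; split => [k|k].
  (* At strictly positive indices the input Y has no coefficient, so the adjoint recursion becomes
     homogeneous there. *)
  have h1 := wm_unshift hl.
  have h2 := wmD (wm_mulmxl A^T hl) (wm_mulmxl (ctr Cy) hy).
  have e : (fun t => expi (- t) *: lam t) = (fun t => A^T *m lam t + ctr Cy *m Y t).
    by apply/funext => t; apply: adjoint_state_rec.
  rewrite e in h1; have := congr1 (fun f => f (Posz k.+1)) (wm_uniq h1 h2).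
  rewrite /= y0 mulmx0 addr0 => <-; congr l; lia.
have h1 := wm_shift hz.
have h2 := wmD (wm_mulmxl A hz) (wm_mulmxl (B *m ctr B) hl).
have e : (fun t => expi t *: Z t) = (fun t => A *m Z t + B *m ctr B *m lam t).
  by apply/funext => t; apply: state_rec.
rewrite -/Z in h1; rewrite e in h1.
exact: (congr1 (fun f : int -> 'M[C]_(n, dy) => f k) (wm_uniq h1 h2)).
Qed.

Variables (s r : seq C) (e : C).
Hypothesis size_s : size s = m.
Hypothesis s_in : all (fun x => cabs x < 1) s.
Hypothesis r_in : all (fun x => cabs x < 1) r.
Hypothesis e_neq0 : e != 0.
Variable U : tf R 1 1.
Hypothesis U_causal_inv : causal_tf (inv_tf U).
Let P1 := \prod_(x <- s) ('X - x%:P).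
Let Q1 := \prod_(x <- r) ('X - x%:P).
Hypothesis UE : forall t, U t = (e * (P1.[expi t] / Q1.[expi t]))%:M.

Let T t := Ko t *m D t.
Let Tm := anticausal_part T.
Let UT t := U t *m Tm t.

Lemma wm_wiener_factor : exists c, wm T c.
Proof.
have [y [l [z [_ _ hz _ _]]]] := wm_states.
exists (fun k => Cs *m z k); have := wm_mulmxl Cs hz; congr wm.
by apply/funext => t; rewrite /T wiener_mul_factor.
Qed.

Lemma wm_anticausal_mul : exists c, wm UT c.
Proof.
have [c hc] := wm_wiener_factor.
have h1 := wmZ e (wm_mulpoly P1 (wm_anticausal_part hc)).
have [||d hd] := wm_divpoly h1 (P := Q1).
- move=> z; rewrite root_prod_XsubC => /(allP r_in) z1; by rewrite lt_eqF.
- by rewrite monic_neq0 // monic_prod_XsubC.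
exists d; have := hd; congr wm; apply/funext => t.
by rewrite /UT UE mul_scalar_mx !scalerA; congr (_ *: _); rewrite -mulrA [LHS]mulrC -mulrA.
Qed.

Let V t := causal_part T t + invmx (U t) *m causal_part UT t.

Lemma filter_eq t : filter_tf Ko D U t = V t *m invmx (D t).
Proof. by rewrite /filter_tf /kalman_tf /V mulmxDl. Qed.

Lemma wm_filter_numerator : exists2 v, wm V v & mcausal_coef v.
Proof.
have [c hc] := wm_wiener_factor; have [d hd] := wm_anticausal_mul.
have /causal_tfP [u hu u0] := U_causal_inv.
have cT := wm_causal_part hc; have cU := wm_causal_part hd.
have [f hf f0] := wm_causal_mul hu cU u0 (fun k => erefl).
exists (fun k => (if k is Posz j then c j else 0) + f k); first exact: wmD.
by move=> k; rewrite f0; exact: addr0.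
Qed.

Lemma wm_filter : exists2 k, wm (filter_tf Ko D U) k & mcausal_coef k.
Proof.
have [v hv v0] := wm_filter_numerator; have [_ _ /causal_tfP [d hd d0] _] := D_factor.
have [k hk k0] := wm_causal_mul hv hd v0 d0; exists k => //.
by have := hk; congr wm; apply/funext => t; rewrite filter_eq.
Qed.

(* The subtracted term has no causal part. *)
Lemma filter_numerator_eq t :
  P1.[expi t] *: V t = P1.[expi t] *: T t - (e^-1 * Q1.[expi t]) *: anticausal_part UT t.
Proof.
have [c hc] := wm_wiener_factor; have [d hd] := wm_anticausal_mul.
have p0 : P1.[expi t] != 0 by apply: prod_XsubC_circle.
have q0 : Q1.[expi t] != 0 by apply: prod_XsubC_circle.
have UV : P1.[expi t] *: invmx (U t) = (e^-1 * Q1.[expi t])%:M.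
  rewrite UE invmx_scalar scale_scalar_mx; congr (_%:M).
  by rewrite invfM invf_div mulrCA [_ / P1.[_]]mulrC mulVKf.
have UTm : (e^-1 * Q1.[expi t]) *: UT t = P1.[expi t] *: Tm t.
  rewrite /UT UE mul_scalar_mx scalerA; congr (_ *: _).
  by rewrite mulrACA mulVf // mul1r mulrCA divff // mulr1.
(* Since P1 U^{-1} = e^{-1} Q1, the term P1 U^{-1} {U T_-}_+ is e^{-1} Q1 times U T_- minus its
   anticausal part, and e^{-1} Q1 U T_- = P1 T_- completes P1 T_+ to P1 T. *)
rewrite [X in _ = _ *: X - _](causal_anticausal hc) scalerDr /V scalerDr -addrA.
congr (_ + _); rewrite scalemxAl UV mul_scalar_mx -[anticausal_part T t]/(Tm t) -UTm.
rewrite [in X in X - _](causal_anticausal hd) scalerDr.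
by rewrite -addrA subrr addr0.
Qed.

(** The unknown vector holds the coefficients of c, then those of N. [u_poly] is c P1 and not c
    itself, so the factor P1 is imposed and costs no unknowns. *)
Let u_poly k (x : 'rV[C]_(n.+1 + k)) : {poly C} := rVpoly (lsubmx x) * P1.
Let u_row (x : 'rV[C]_(n.+1 + (m + n).+1 * dy)) (i : nat) : 'rV[C]_dy :=
  row (inord i) (vec_mx (rsubmx x)).

Let u_poly_lin k a (x x' : 'rV[C]_(n.+1 + k)) i :
  (u_poly (a *: x + x'))`_i = a * (u_poly x)`_i + (u_poly x')`_i.
Proof. by rewrite /u_poly !linearP /= mulrDl -scalerAl coefD coefZ. Qed.

Let u_row_lin a x x' i : u_row (a *: x + x') i = a *: u_row x i + u_row x' i.
Proof. by rewrite /u_row !linearP. Qed.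

(* Counting dimensions: (n+1) + (m+n+1) dy unknown coefficients of (c, N) against
   (m+n+1) dy + n linear equations equivalent to c P1 V = N D. *)
Lemma filter_annihilator : exists2 a : {poly C}, a != 0 /\ (size a <= (m + n).+1)%N &
  exists N, forall t, a.[expi t] *: filter_tf Ko D U t = rowpoly (m + n).+1 N t.
Proof.
have [y [l [z [hy hl hz y0 [lrec zrec]]]]] := wm_states.
have [v hv v0] := wm_filter_numerator.
have [ut hut] := wm_anticausal_mul.
have [_ uD /causal_tfP [dc hdc dc0] SD] := D_factor.
have hD : wm D (fun k => y k + Cy *m z k).
  have := wmD hy (wm_mulmxl Cy hz); congr wm; apply/funext => t.
  by rewrite factor_split.
have hT : wm T (fun k => Cs *m z k).
  have := wm_mulmxl Cs hz; congr wm; apply/funext => t.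
  by rewrite /T wiener_mul_factor.
have hA x : root (char_poly A) x -> cabs x != 1.
  move=> rx; apply/eqP => /expi_surj [t xt].
  by have := A_reg t; rewrite unitmxE -char_poly_eval -xt (rootP rx) unitr0.
have bz : bnd (fun k => z (Posz k.+1)).
  by have [b hb] := wm_coef_bounded hz; exists b.
have bl : bnd (fun k => l (Posz k.+1)).
  by have [b hb] := wm_coef_bounded hl; exists b.
have zrec' k : z (Posz k.+2) = A *m z (Posz k.+1) + B *m ctr B *m l (Posz k.+1).
  by rewrite -(zrec (Posz k.+1)); congr z; lia.
have [d [W [dn hW]]] := bounded_solution_dim hA bz bl zrec' (fun k => lrec k.+1).
set M := (m + n)%N.
have dD : exists2 dd, wm D dd & mcausal_coef dd.
  by have [/causal_tfP] := D_factor.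
have [dd hdd dd0] := dD.
have ddE := wm_uniq hdd hD.
(* The k-th Laurent coefficient of c P1 V - N D. *)
pose eps x k := \sum_(i < M.+1) (u_poly x)`_i *: v (k + i%:Z)
  - \sum_(i < M.+1) u_row x i *m dd (k + i%:Z).
(* The equations imposed: [eps] vanishes at the indices 0, -1, ..., -M, and one relation in terms of
   [W] covers all positive indices at once. *)
pose f (x : 'rV[C]_(n.+1 + M.+1 * dy)) : 'rV[C]_(M.+1 * dy + d) :=
  row_mx (mxvec (\matrix_(i < M.+1) eps x (- (i : nat)%:Z)))
    (\sum_(i < M.+1) ((u_poly x)`_i *: Cs - u_row x i *m Cy) *m W i).
have eps_lin a x x' k : eps (a *: x + x') k = a *: eps x k + eps x' k.
  rewrite /eps scalerBr !scaler_sumr.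
  under eq_bigr do rewrite u_poly_lin scalerDl -scalerA.
  under [X in _ - X]eq_bigr do rewrite u_row_lin mulmxDl -scalemxAl.
  by rewrite !big_split /= opprD addrACA.
have f_lin a x x' : f (a *: x + x') = a *: f x + f x'.
  rewrite /f scale_row_mx add_row_mx; congr row_mx.
    rewrite -linearP /=; congr mxvec; apply/row_matrixP => i.
    by rewrite linearP /= !rowK eps_lin.
  rewrite scaler_sumr -big_split /=; apply: eq_bigr => i _.
  rewrite u_poly_lin u_row_lin scalemxAl -mulmxDl; congr (_ *m _).
  by rewrite mulmxDl scalerDl -scalerA -scalemxAl scalerBr opprD addrACA.
have [|x x0 fx] := linear_kernel_neq0 f_lin.
  by rewrite addnC -addSn leq_add2r.
have sP1 : size P1 = m.+1 by rewrite size_prod_XsubC size_s.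
have su : (size (u_poly x) <= M.+1)%N.
  apply: leq_trans (size_polyMleq _ _) _; rewrite sP1 addnS /=.
  have : (size (rVpoly (lsubmx x)) <= n.+1)%N by apply: size_poly.
  by rewrite /M; move: (size _) => k; lia.
have [fx1 fx2] : mxvec (\matrix_(i < M.+1) eps x (- (i : nat)%:Z)) = 0 /\
    \sum_(i < M.+1) ((u_poly x)`_i *: Cs - u_row x i *m Cy) *m W i = 0.
  by apply: eq_row_mx; rewrite row_mx0.
have eps_low i : (i <= M)%N -> eps x (- i%:Z) = 0.
  move=> iM; have := congr1 vec_mx fx1; rewrite mxvecK linear0.
  move=> e0; have := congr1 (row (Ordinal (iM : (i < M.+1)%N))) e0.
  by rewrite rowK row0.
(* Below -M nothing remains, since V and D are causal and both polynomials have degree at most M. *)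
have eps_vlow k : (M <= k)%N -> eps x (Negz k) = 0.
  move=> Mk; rewrite /eps !big1 ?subr0 // => i _.
    have -> : Negz k + (i : nat)%:Z = Negz (k - i).
      by have := ltn_ord i; rewrite !NegzE; lia.
    by rewrite dd0 mulmx0.
  have -> : Negz k + (i : nat)%:Z = Negz (k - i).
    by have := ltn_ord i; rewrite !NegzE; lia.
  by rewrite v0 scaler0.
(* At positive indices c P1 V agrees with c P1 Cs Z, the difference being strictly anticausal, and D
   agrees with Cy Z. Hence [eps] is a fixed combination of shifts of the coefficients of Z, which
   the relation among the [W i] annihilates. *)
have eps_high k : eps x (Posz k.+1) = 0.
  have h1 := wm_mulpoly (u_poly x) hv.
  pose q := e^-1 *: (rVpoly (lsubmx x) * Q1).
  have h2 := wmB (wm_mulpoly (u_poly x) hT) (wm_mulpoly q (wm_anticausal_part hut)).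
  have e12 : (fun t => (u_poly x).[expi t] *: V t) =
      (fun t => (u_poly x).[expi t] *: T t - q.[expi t] *: anticausal_part UT t).
    apply/funext => t; rewrite /q /u_poly hornerZ !hornerM -[LHS]scalerA filter_numerator_eq.
    by rewrite scalerBr !scalerA; congr (_ - _ *: _); exact: mulrCA.
  rewrite e12 in h1; have /= E12 := congr1 (fun g : int -> 'M[C]_(1, dy) => g (Posz k.+1)) (wm_uniq h1 h2).
  have qz : mpact q (fun k => if k is Posz _ then 0 else ut k) (Posz k.+1) = 0.
    by apply: big1 => i _; exact: scaler0.
  rewrite qz subr0 in E12.
  rewrite /eps -(mpactE _ _ su) E12 (mpactE _ _ su) -sumrB.
  apply: etrans (hW M.+1 (fun i => (u_poly x)`_i *: Cs - u_row x i *m Cy) fx2 k).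
  apply: eq_bigr => i _.
  have -> : Posz k.+1 + (i : nat)%:Z = Posz (k + i).+1 by lia.
  by rewrite ddE y0 add0r mulmxBl scalemxAl mulmxA.
have eps0 k : eps x k = 0.
  case: k => [[|k]|k]; [exact: (eps_low 0%N)|exact: eps_high|].
  have [Mk|kM] := leqP M k; first exact: eps_vlow.
  by rewrite NegzE; apply: eps_low.
have VE t : (u_poly x).[expi t] *: V t = rowpoly M.+1 (u_row x) t *m D t.
  apply/eqP; rewrite -subr_eq0; apply/eqP.
  have h1 := wmB (wm_mulpoly (u_poly x) hv) (wm_rowpoly_mul M.+1 (u_row x) hdd).
  have h0 : wm (fun=> 0 : 'M[C]_(1, dy)) (fun=> 0).
    have := wm_cst (0 : 'M[C]_(1, dy)); congr wm; apply/funext => k; exact: scaler0.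
  have e0 : (fun k => mpact (u_poly x) v k - \sum_(i < M.+1) u_row x i *m dd (k + (i : nat)%:Z))
      = fun=> 0 by apply/funext => k; rewrite (mpactE _ _ su); apply: eps0.
  rewrite e0 in h1; exact: (congr1 (fun g => g t) (wm_uniq_fun h1 h0)).
have KE t : (u_poly x).[expi t] *: filter_tf Ko D U t = rowpoly M.+1 (u_row x) t.
  by rewrite filter_eq scalemxAl VE mulmxK.
exists (u_poly x); last by exists (u_row x).
(* If c P1 = 0 then N = c P1 K vanishes on the circle, so c and N are both zero, contrary to the
   choice of x. *)
split => //; apply: contra x0 => /eqP ux0.
have P10 : P1 != 0 by rewrite monic_neq0 // monic_prod_XsubC.
have c0 : lsubmx x = 0.
  have : rVpoly (lsubmx x) = 0.
    by apply/eqP; move/eqP: ux0; rewrite /u_poly mulf_eq0 (negPf P10) orbF.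
  by move/(congr1 (@poly_rV _ n.+1)); rewrite rVpolyK linear0.
have r0 : vec_mx (rsubmx x) = 0.
  apply/row_matrixP => i; rewrite row0.
  have ri : u_row x i = 0.
    apply: (@rowpoly_eq0 _ M.+1 (u_row x)) (ltn_ord i) => t.
    by rewrite -KE ux0 horner0 scale0r.
  by move: ri; rewrite /u_row inord_val.
by rewrite -[x]hsubmxK c0 -[rsubmx x]vec_mxK r0 linear0 row_mx0.
Qed.

End Annihilator.

(** * Real coefficients and stability *)

Section RealRealization.
Variable R : realType.
Local Notation C := R[i].

(** If x_k were nonzero, n |x_k| would stay below the l1 bound for every n. *)
Lemma l1_nondecreasing_eq0 (x : nat -> C) : l1 x ->
  (forall k, cabs (x k) <= cabs (x k.+1)) -> forall k, x k = 0.
Proof.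
move=> lx xle k; have lk := l1_addn k lx; have [M hM] := lk.
apply/eqP; rewrite -cabs_eq0; apply: contraT => c0.
have cp : 0 < cabs (x k) by rewrite lt_neqAle cabs_ge0 andbT eq_sym.
have hle n : cabs (x k) <= cabs (x (k + n)%N).
  by elim: n => [|n IH]; rewrite ?addn0 // addnS; apply: le_trans IH (xle _).
have h n : n%:R * cabs (x k) <= M.
  apply: le_trans (hM n); rewrite mulr_natl -[X in _ *+ X](card_ord n) -sumr_const.
  by apply: ler_sum => i _.
have M0 : 0 <= M by have := h 0%N; rewrite mul0r.
have := h (Num.bound (M / cabs (x k))); rewrite -ler_pdivlMr //.
by rewrite leNgt archi_boundP // divr_ge0 // ltW.
Qed.

Variables (q n : nat) (K : tf R 1 q) (k : int -> 'rV[C]_q).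
Hypothesis hK : wm K k.
Hypothesis k_causal : mcausal_coef k.
Hypothesis k_real : forall j, map_mx Num.conj (k j) = k j.

(** K is causal, so a K contains only powers of z up to the degree of [a]. It is a polynomial
    exactly when its negative powers of z vanish too. *)
Let good (a : {poly C}) := forall j, mpact a k (Posz j.+1) = 0.

Let mpact_lin a b c j : mpact (a *: b + c) k j = a *: mpact b k j + mpact c k j.
Proof.
have h1 := wm_mulpoly (a *: b + c) hK.
have h2 := wmD (wmZ a (wm_mulpoly b hK)) (wm_mulpoly c hK).
have e : (fun t => (a *: b + c).[expi t] *: K t) =
    (fun t => a *: (b.[expi t] *: K t) + c.[expi t] *: K t).
  by apply/funext => t; rewrite hornerD hornerZ scalerDl scalerA.
rewrite e in h1; exact: (congr1 (fun f : int -> 'rV[C]_q => f j) (wm_uniq h1 h2)).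
Qed.

Let mpact_mulXsubC a r j :
  mpact (a * ('X - r%:P)) k j = mpact a k (j + 1) - r *: mpact a k j.
Proof.
have h1 := wm_mulpoly (a * ('X - r%:P)) hK.
have h2 := wmB (wm_shift (wm_mulpoly a hK)) (wmZ r (wm_mulpoly a hK)).
have e : (fun t => (a * ('X - r%:P)).[expi t] *: K t) =
    (fun t => expi t *: (a.[expi t] *: K t) - r *: (a.[expi t] *: K t)).
  by apply/funext => t; rewrite hornerM hornerXsubC mulrC -scalerA scalerBl.
rewrite e in h1; exact: (congr1 (fun f : int -> 'rV[C]_q => f j) (wm_uniq h1 h2)).
Qed.

(** If a (z - r) K is a polynomial, the coefficients of a K at positive indices satisfy x_{j+1} = r
    x_j. For |r| >= 1 their moduli do not decrease, and summability makes them vanish. So an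
    annihilator of least degree has no root of modulus at least 1. *)
Let good_div a r : good (a * ('X - r%:P)) -> 1 <= cabs r -> good a.
Proof.
move=> ga r1 j; apply/rowP => i; rewrite [RHS]mxE.
have [l _ _] := wm_mulpoly a hK 0 i.
have l' : l1 (fun j => mpact a k (Posz j.+1) 0 i).
  exact/(@l1_shift _ (fun j => mpact a k (Posz j) 0 i)).
apply: (l1_nondecreasing_eq0 l') => {}j.
have := ga j; rewrite mpact_mulXsubC => /eqP; rewrite subr_eq0 => /eqP e.
have -> : Posz j.+2 = Posz j.+1 + 1 by lia.
by rewrite e mxE cabsM ler_peMl // cabs_ge0.
Qed.

Let good_conj a : good a -> good (map_poly Num.conj a).
Proof.
move=> ga j; rewrite /mpact size_map_poly.
transitivity (map_mx Num.conj (mpact a k (Posz j.+1))); last by rewrite ga map_mx0.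
rewrite /mpact map_mx_sum; apply: eq_bigr => i _.
by rewrite map_mxZ /= coef_map k_real.
Qed.

Lemma minimal_annihilator (a : {poly C}) : a != 0 -> (size a <= n.+1)%N -> good a ->
  exists b : {poly C}, [/\ b \is monic, (size b <= n.+1)%N, good b,
    (forall z, root b z -> cabs z < 1) & map_poly Num.conj b = b].
Proof.
move=> a0 sa ga.
pose D m := `[< exists b : {poly C}, [/\ b != 0, size b = m & good b] >].
have D0 : exists m, D m by exists (size a); apply/asboolP; exists a.
case: (ex_minnP D0) => m /asboolP [b0 [b00 sb0 gb0]] mmin.
have l0 : lead_coef b0 != 0 by rewrite lead_coef_eq0.
pose b := (lead_coef b0)^-1 *: b0.
have sb : size b = m by rewrite size_scale // invr_eq0.
have bm : b \is monic by rewrite monicE lead_coefZ mulVf.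
have gb : good b.
  move=> j; rewrite /b -[_ *: _]addr0 mpact_lin gb0 scaler0 add0r.
  by rewrite /mpact size_poly0 big_ord0.
have bmin c : c != 0 -> good c -> (size b <= size c)%N.
  by move=> c0 gc; rewrite sb; apply: mmin; apply/asboolP; exists c.
exists b; split => //.
- by rewrite sb; apply: leq_trans sa; apply: mmin; apply/asboolP; exists a.
- move=> z rz; rewrite ltNge; apply/negP => z1.
  have [c bc] := factor_theorem _ _ rz.
  have c0 : c != 0 by apply: contraTneq bm => c0; rewrite bc c0 mul0r monicE lead_coef0 eq_sym oner_eq0.
  have := bmin c c0; rewrite bc in gb; move/(_ (good_div gb z1)).
  by rewrite bc size_mul ?polyXsubC_eq0 // size_XsubC addn2 /= ltnn.
apply/eqP; rewrite -subr_eq0; apply: contraT => d0.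
(* Both polynomials are monic of the same degree, so their difference has smaller degree and, by
   minimality, must be zero. *)
have gd : good (map_poly Num.conj b - b).
  move=> j; rewrite addrC -scaleN1r mpact_lin (good_conj gb) gb scaler0; exact: addr0.
have := bmin _ d0 gd; rewrite leqNgt => /negP []; rewrite -[size b]prednK; last first.
  by rewrite lt0n size_poly_eq0 monic_neq0.
rewrite ltnS; apply/leq_sizeP => j; rewrite leq_eqVlt => /orP[/eqP <-|bj].
  by rewrite coefB coef_map -lead_coefE (monicP bm) /= rmorph1 subrr.
have bj' : (size b <= j)%N by move: bj; case: (size b).
by rewrite coefB coef_map (nth_default _ bj') /= conjC0 subrr.
Qed.

Lemma rational_realizes (a : {poly C}) : a != 0 -> (size a <= n.+1)%N -> good a ->
  rational_tf K /\
  exists (F : 'M[R]_n) (G : 'M[R]_(n, q)) (H : 'rV[R]_n) (L : 'rV[R]_q),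
    realizes K F G H L.
Proof.
move=> a0 sa ga.
have [b [bm sb gb rb cb]] := minimal_annihilator a0 sa ga.
(* Padding to degree exactly n fixes the dimension of the companion matrix. The added roots are at
   0, hence stable. *)
pose d := b * 'X^(n.+1 - size b).
have dm : d \is monic by rewrite monicMl ?monicXn.
have sd : size d = n.+1 by rewrite size_mul ?monic_neq0 ?monicXn // size_polyXn addnS /= subnKC.
have rd z : root d z -> cabs z < 1.
  rewrite rootM => /orP[/rb //|]; rewrite rootE hornerXn expf_eq0 => /andP[_ /eqP ->].
  by rewrite cabs0.
have cd : map_poly Num.conj d = d by rewrite rmorphM /= cb map_polyXn.
have hdK := wm_mulpoly d hK.
have gd : good d.
  have h2 := wm_shiftn (n.+1 - size b) (wm_mulpoly b hK).
  move=> j; have e : mpact d k = fun j => mpact b k (j + (n.+1 - size b)%N%:Z).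
    apply: (wm_uniq hdK); have := h2; congr wm; apply/funext => t.
    by rewrite hornerM hornerXn mulrC scalerA.
  rewrite e; have -> : Posz j.+1 + (n.+1 - size b)%N%:Z = Posz (j + (n.+1 - size b)).+1 by lia.
  exact: gb.
pose dr : {poly R} := \poly_(i < n.+1) complex.Re d`_i.
have reC (x : C) : Num.conj x = x -> (complex.Re x)%:C%C = x.
  by move=> h; apply: RRe_real; apply/CrealP.
have drE : map_poly (real_complex R) dr = d.
  apply/polyP => i; rewrite coef_map coef_poly; case: ltnP => il; last first.
    by rewrite nth_default ?sd // rmorph0.
  by apply: reC; have := congr1 (fun p : {poly C} => p`_i) cd; rewrite coef_map.
pose nu := mpact d k.
have nu_real j : map_mx Num.conj (nu j) = nu j.
  rewrite /nu /mpact map_mx_sum; apply: eq_bigr => i _.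
  by rewrite map_mxZ k_real; congr (_ *: _); have := congr1 (fun p : {poly C} => p`_i) cd; rewrite coef_map.
pose N : 'rV[{poly R}]_q := \row_j \poly_(i < n.+1) complex.Re (nu (- i%:Z) 0 j).
(* Index -i carries z^i. The positive indices vanish because [d] is an annihilator, and those below
   -n because K is causal and [d] has degree n. *)
have nuE t : d.[expi t] *: K t = rowpoly n.+1 (fun i => nu (- i%:Z)) t.
  have h := wm_sum (fun i : 'I_n.+1 => wm_shiftn i (wm_cst (nu (- (i : nat)%:Z)))).
  suff e : (fun t => d.[expi t] *: K t) = rowpoly n.+1 (fun i => nu (- i%:Z)).
    exact: (congr1 (fun g => g t) e).
  apply: (wm_uniq_fun hdK); have := h; congr wm; apply/funext => j.
  have nolow i' : (n < i')%N -> nu (- i'%:Z) = 0.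
    move=> ni; apply: big1 => i _.
    have -> : - i'%:Z + (i : nat)%:Z = Negz (i' - i).-1.
      have il : (i < n.+1)%N by rewrite -[X in (_ < X)%N]sd.
      rewrite NegzE; lia.
    by rewrite k_causal scaler0.
  have term (i : 'I_n.+1) : j != - (i : nat)%:Z ->
      ((j + (i : nat)%:Z == 0)%:R : C) *: nu (- (i : nat)%:Z) = 0.
    by rewrite -subr_eq0 opprK => /negPf ->; exact: scale0r.
  have [jp|jp] := ltP 0 j.
    rewrite big1 => [|i _]; last by apply: term; apply/eqP; lia.
    by case: j jp {term} => // -[//|j] _; rewrite [RHS]gd.
  have [i' ji] : exists i' : nat, j = - i'%:Z by exists `|j|%N; lia.
  rewrite {}ji in term *.
  have [il|il] := ltnP i' n.+1; last first.
    rewrite big1 => [|i _]; first by rewrite [RHS]nolow.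
    by apply: term; have il' := ltn_ord i; apply/eqP; lia.
  rewrite (bigD1 (Ordinal il)) //= addNr eqxx scale1r big1 ?addr0 // => i /eqP hi.
  apply: term; apply/eqP => e; apply: hi; apply: val_inj => /=; lia.
have NE t : map_mx (fun r : {poly R} => (map_poly (real_complex R) r).[expi t]) N
    = rowpoly n.+1 (fun i => nu (- i%:Z)) t.
  apply/rowP => j; rewrite !mxE summxE.
  have -> : map_poly (real_complex R) (\poly_(i < n.+1) complex.Re (nu (- i%:Z) 0 j))
      = \poly_(i < n.+1) nu (- i%:Z) 0 j.
    apply/polyP => i; rewrite coef_map !coef_poly; case: ltnP => _; last exact: rmorph0.
    apply: reC; have := congr1 (fun M : 'rV[C]_q => M 0 j) (nu_real (- i%:Z)).
    by rewrite mxE.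
  by rewrite horner_poly; apply: eq_bigr => i _; rewrite mxE mulrC.
have drm : dr \is monic.
  by rewrite -(map_monic (real_complex R)) drE.
have sdr : size dr = n.+1 by rewrite -(size_map_poly (real_complex R)) drE.
split.
  exists (map_mx (map_poly (real_complex R)) N), d => t.
  have d0 : d.[expi t] != 0 by apply/negP => /rd; rewrite cabs_expi ltxx.
  split => //; apply: (scalerI d0); rewrite scalerA divff // scale1r nuE -NE.
  by apply/rowP => j; rewrite !mxE.
exists (comp_F n dr), (comp_G n dr N), (comp_H R n), (comp_L n N).
apply: companion_realizes => //.
- by move=> j; rewrite mxE size_poly.
- by rewrite drE.
- by move=> t; rewrite drE nuE NE.
Qed.

End RealRealization.

(** * Conjugation symmetry, and independence of the filter from the choice of factors *)

Section Symmetry.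
Variable R : realType.
Local Notation C := R[i].
Local Notation cj M := (map_mx Num.conj M).

Lemma causal_part_conj p q (F : tf R p q) c : wm F c ->
  causal_part (fun t => cj (F (- t))) = fun t => cj (causal_part F (- t)).
Proof.
move=> h; apply: wm_uniq_fun (wm_causal_part (wm_conj_opp h)) _.
have := wm_conj_opp (wm_causal_part h); congr wm; apply/funext => -[k|k] //.
exact: map_mx0.
Qed.

Lemma anticausal_part_conj p q (F : tf R p q) c : wm F c ->
  anticausal_part (fun t => cj (F (- t))) = fun t => cj (anticausal_part F (- t)).
Proof.
move=> h; apply: wm_uniq_fun (wm_anticausal_part (wm_conj_opp h)) _.
have := wm_conj_opp (wm_anticausal_part h); congr wm; apply/funext => -[k|k] //.
exact: map_mx0.
Qed.

Lemma causal_part_lin p q r (F : tf R p q) c a (M : 'M[C]_(q, r)) : wm F c ->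
  causal_part (fun t => a *: (F t *m M)) = fun t => a *: (causal_part F t *m M).
Proof.
move=> h; apply: wm_uniq_fun (wm_causal_part (wmZ a (wm_mulmxr M h))) _.
have := wmZ a (wm_mulmxr M (wm_causal_part h)); congr wm; apply/funext => -[k|k] //.
by rewrite mul0mx scaler0.
Qed.

Lemma anticausal_part_lin p q r (F : tf R p q) c a (M : 'M[C]_(q, r)) : wm F c ->
  anticausal_part (fun t => a *: (F t *m M)) = fun t => a *: (anticausal_part F t *m M).
Proof.
move=> h; apply: wm_uniq_fun (wm_anticausal_part (wmZ a (wm_mulmxr M h))) _.
have := wmZ a (wm_mulmxr M (wm_anticausal_part h)); congr wm; apply/funext => -[k|k] //.
by rewrite mul0mx scaler0.
Qed.

Lemma filter_tf_conj n (Ko : tf R 1 n) D (U : tf R 1 1) c d :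
  (forall t, Ko t = cj (Ko (- t))) ->
  wm (fun t => Ko t *m D t) c ->
  wm (fun t => U t *m anticausal_part (fun t => Ko t *m D t) t) d ->
  forall t, filter_tf Ko (fun t => cj (D (- t))) (fun t => cj (U (- t))) t
    = cj (filter_tf Ko D U (- t)).
Proof.
move=> hKo hT hUT t; rewrite /filter_tf /kalman_tf.
have -> : (fun t => Ko t *m cj (D (- t))) = (fun t => cj ((fun t => Ko t *m D t) (- t))).
  by apply/funext => u; rewrite /= map_mxM -hKo.
rewrite (causal_part_conj hT) (anticausal_part_conj hT).
have -> : (fun u => cj (U (- u)) *m cj (anticausal_part (fun t => Ko t *m D t) (- u)))
   = (fun u => cj ((fun t => U t *m anticausal_part (fun t => Ko t *m D t) t) (- u))).
  by apply/funext => u; rewrite /= map_mxM.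
rewrite (causal_part_conj hUT) map_mxD !map_mxM !map_invmx //.
Qed.

(** A constant matrix on the right of D passes through both parts and cancels against its inverse
    coming from D^{-1}. The scalar on U cancels against the one in U^{-1}. *)
Lemma filter_tf_unit_factor n (Ko : tf R 1 n) D (U : tf R 1 1) c d V w :
  (forall t, D t \in unitmx) -> (forall t, U t \in unitmx) -> V \in unitmx -> w != 0 ->
  wm (fun t => Ko t *m D t) c ->
  wm (fun t => U t *m anticausal_part (fun t => Ko t *m D t) t) d ->
  filter_tf Ko (fun t => D t *m V) (fun t => w *: U t) = filter_tf Ko D U.
Proof.
move=> uD uU uV w0 hT hUT; apply/funext => t; rewrite /filter_tf /kalman_tf.
set T := fun t => Ko t *m D t in hT hUT *.
have -> : (fun t => Ko t *m (D t *m V)) = (fun t => 1 *: (T t *m V)).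
  by apply/funext => u; rewrite scale1r mulmxA.
rewrite (causal_part_lin 1 V hT) (anticausal_part_lin 1 V hT).
have -> : (fun t => w *: U t *m (1 *: (anticausal_part T t *m V)))
   = (fun t => w *: (U t *m anticausal_part T t *m V)).
  by apply/funext => u; rewrite scale1r -scalemxAl mulmxA.
rewrite (causal_part_lin w V hUT) scale1r.
have VD : V *m invmx (D t *m V) = invmx (D t).
  have uDV : D t *m V \in unitmx by rewrite unitmx_mul uD.
  apply: (can_inj (mulKmx (uD t))); rewrite mulmxA mulmxV // mulmxV //.
rewrite -[_ *m V *m invmx _]mulmxA VD; congr (_ + _).
have -> : invmx (w *: U t) = w^-1 *: invmx (U t) by rewrite invmxZ // unitmxZ ?unitfE.
by rewrite -!scalemxAl -!scalemxAr -!scalemxAl scalerA mulVf // scale1r !mulmxA -[_ *m V *m _]mulmxA VD.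
Qed.

Lemma mxC_conj m n (M : 'M[R]_(m, n)) : cj (mxC M) = mxC M.
Proof. by apply/matrixP => i j; rewrite !mxE /=; exact: conjc_real. Qed.

Lemma ss_tf_conj n dw k (A : 'M[R]_n) (B : 'M[R]_(n, dw)) (Cm : 'M[R]_(k, n)) t :
  ss_tf A B Cm t = cj (ss_tf A B Cm (- t)).
Proof.
rewrite /ss_tf !map_mxM !mxC_conj map_invmx map_mxB mxC_conj map_scalar_mx.
by rewrite /= expi_conj opprK.
Qed.

Lemma ctr_conj m n (M : 'M[C]_(m, n)) : ctr (cj M) = cj (ctr M).
Proof. by rewrite /ctr -!map_trmx. Qed.

Lemma lpoly_conj (p : int -> R) m t : lpoly p m t = Num.conj (lpoly p m (- t)).
Proof.
rewrite /lpoly rmorph_sum; apply: eq_bigr => i _; rewrite rmorphM /=.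
congr (_ * _); first by rewrite toCE; apply/esym/conjc_real.
by rewrite /zinv expi_conj mulrN !opprK.
Qed.

Lemma lcanonical_factor_conj n S (D : tf R n n) : (forall t, S t = cj (S (- t))) ->
  lcanonical_factor (fun=> True) S D ->
  lcanonical_factor (fun=> True) S (fun t => cj (D (- t))).
Proof.
move=> hS [/causal_tfP [c hc c0] uD /causal_tfP [d hd d0] SD]; split.
- apply/causal_tfP; exists (fun k => cj (c k)); first exact: wm_conj_opp.
  by move=> k; rewrite c0 map_mx0.
- by move=> t; rewrite map_unitmx.
- apply/causal_tfP; exists (fun k => cj (d k)); last by move=> k; rewrite d0 map_mx0.
  have := wm_conj_opp hd; congr wm; apply/funext => t; by rewrite /inv_tf map_invmx.
- by move=> t _; rewrite ctr_conj -map_mxM SD // -hS.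
Qed.

Lemma mulmx11C (M N : 'M[C]_1) : M *m N = N *m M.
Proof. by rewrite [M]mx11_scalar [N]mx11_scalar -!scalar_mxM mulrC. Qed.

Lemma rcanonical_lcanonical S (U : tf R 1 1) :
  rcanonical_factor (fun=> True) S U -> lcanonical_factor (fun=> True) S U.
Proof. by case=> h1 h2 h3 h4; split => // t _; rewrite mulmx11C h4. Qed.

Lemma scalar_unitary (V : 'M[C]_1) : V *m ctr V = 1%:M -> V 0 0 != 0.
Proof.
move=> h; apply/eqP => v0; have := congr1 (fun M : 'M[C]_1 => M 0 0) h.
by rewrite mxE big_ord1 v0 mul0r mxE eqxx => /esym/eqP; rewrite oner_eq0.
Qed.

(** The i-th diagonal entries give sum |D_il|^2 = 1 + sum |H_il|^2, so |H_ij|^2 <= n b^2. The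
    inequality x <= 1 + x^2 then avoids a square root in the bound. *)
Lemma gram_bound n k (D : 'M[C]_n) (H : 'M[C]_(n, k)) (b : R) : 0 <= b ->
  (forall i j, cabs (D i j) <= b) -> D *m ctr D = 1%:M + H *m ctr H ->
  forall i j, cabs (H i j) <= 1 + n%:R * b ^+ 2.
Proof.
move=> b0 hb hDH i j.
have gram m (M : 'M[C]_(n, m)) : (M *m ctr M) i i = (\sum_l cabs (M i l) ^+ 2)%:C%C.
  rewrite mxE rmorph_sum; apply: eq_bigr => l _; rewrite !mxE -normCK -cabsE.
  by rewrite rmorphXn.
have e : \sum_l cabs (D i l) ^+ 2 = 1 + \sum_l cabs (H i l) ^+ 2.
  apply: complexI; rewrite -gram hDH rmorphD /= -gram mxE; congr (_ + _).
  by rewrite mxE eqxx.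
have h1 : \sum_l cabs (D i l) ^+ 2 <= n%:R * b ^+ 2.
  rewrite mulr_natl -[X in _ *+ X](card_ord n) -sumr_const; apply: ler_sum => l _.
  by rewrite ler_pXn2r ?nnegrE ?cabs_ge0.
have h2 : cabs (H i j) ^+ 2 <= \sum_l cabs (H i l) ^+ 2.
  by rewrite (bigD1 j) //= lerDl sumr_ge0 // => l _; rewrite sqr_ge0.
have h3 := cabs_ge0 (H i j); nra.
Qed.

End Symmetry.

Theorem theorem4p6 (R : realType) (dx dy dw m : nat)
  (A : 'M[R]_dx) (B : 'M[R]_(dx, dw)) (Cy : 'M[R]_(dy, dx)) (Cs : 'M[R]_(1, dx))
  (p q : int -> R) :
  detectable A Cy -> detectable A Cs -> controllable A B ->
  (forall k, p (- k) = p k) -> (forall k, q (- k) = q k) ->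
  p m%:Z != 0 -> q m%:Z != 0 ->
  (forall t, 0 < lpoly p m t) -> (forall t, 0 < lpoly q m t) ->
  let H := ss_tf A B Cy in
  let L := ss_tf A B Cs in
  let Ko := wiener_nc H L in
  let PQ : tf R 1 1 := fun t => (lpoly p m t / lpoly q m t)%:M in
  (exists U : tf R 1 1,
      rcanonical_factor (fun _ => True) PQ U /\ rational_tf U) /\
  (forall (U : tf R 1 1) (D : tf R dy dy),
      rcanonical_factor (fun _ => True) PQ U ->
      lcanonical_factor (regular_pt A) (fun t => 1%:M + H t *m ctr (H t)) D ->
      rational_tf (filter_tf Ko D U) /\
      exists (Ft : 'M[R]_(m + dx)) (Gt : 'M[R]_(m + dx, dy))
             (Ht : 'M[R]_(1, m + dx)) (Lt : 'M[R]_(1, dy)),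
        realizes (filter_tf Ko D U) Ft Gt Ht Lt).
Proof.
move=> detY _ ctrl psym qsym pm qm ppos qpos H L Ko PQ.
have [s [k [ss s_in k0 pE]]] := lpoly_factor psym pm ppos.
have [r [l [sr r_in l0 qE]]] := lpoly_factor qsym qm qpos.
set a := sqrtC (k / l).
have a0 : a != 0 by rewrite sqrtC_eq0 mulf_neq0 ?invr_eq0 ?gt_eqF.
have srs : size s = size r by rewrite ss sr.
have U0_factor : rcanonical_factor (fun=> True) PQ (ratio_tf s r a).
  exact: ratio_tf_factor.
split.
  exists (ratio_tf s r a); split => //.
  exists (a *: \prod_(x <- s) ('X - x%:P))%:M, (\prod_(x <- r) ('X - x%:P)) => t.
  split; first exact: prod_XsubC_circle.
  by apply/matrixP => i j; rewrite !ord1 !mxE !eqxx !mulr1n hornerZ mulrA mulrC.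
move=> U D U_factor [D_causal uD Di_causal DS].
have [dc hdc _] := (causal_tfP D).1 D_causal.
have [b hb] := wm_bounded hdc.
have b0 : 0 <= `|b| by [].
(* D is bounded on the whole circle and S = D D^* at regular points, so H is bounded there
   uniformly. An eigenvalue of [A] on the circle would contradict this, being both observable and
   controllable. *)
have A_reg t0 : (expi t0)%:M - mxC A \in unitmx.
  apply: (@circle_regular _ _ dy dw _ (mxC B) (mxC Cy) _
            ((dy * dw)%:R * (1 + dy%:R * `|b| ^+ 2))).
  - by apply: detY; rewrite -cabs_le1 cabs_expi.
  - exact: controllable_pbh.
  - move=> t ut; apply: mnorm_le => i j; apply: (gram_bound b0 _ (DS t ut)).
    by move=> i' j'; apply: le_trans (hb t i' j') (ler_norm _).
(* At an eigenvalue on the circle the inverse in H would be a default value, hence the restriction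
   to regular points in the hypothesis. All points are now known to be regular. *)
have D_factor : lcanonical_factor (fun=> True) (fun t => 1%:M + H t *m ctr (H t)) D.
  by split => // t _; apply: DS; apply: A_reg.
have A_real : ctr (mxC A) = (mxC A)^T by rewrite /ctr mxC_conj.
(* Uniqueness carries the explicit form of the constructed factor over to the given U, with constant
   [e]. *)
have [v vv UE0] := lcanonical_factor_uniq (rcanonical_lcanonical U0_factor)
  (rcanonical_lcanonical U_factor).
pose e := a * v 0 0.
have e0 : e != 0 by rewrite mulf_neq0 // scalar_unitary.
have UE t : U t = (e * ((\prod_(x <- s) ('X - x%:P)).[expi t] /
    (\prod_(x <- r) ('X - x%:P)).[expi t]))%:M.
  by rewrite UE0 [v]mx11_scalar -scalar_mxM mulrAC.
have [_ uU Ui_causal _] := U_factor.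
have [c hT] : exists c, wm (fun t => Ko t *m D t) c :=
  wm_wiener_factor (mxC Cs) A_real A_reg D_factor.
have [d hUT] : exists d,
    wm (fun t => U t *m anticausal_part (fun t => Ko t *m D t) t) d :=
  wm_anticausal_mul (mxC Cs) A_real A_reg D_factor r_in UE.
have [f hK f_causal] : exists2 f, wm (filter_tf Ko D U) f & mcausal_coef f :=
  wm_filter (mxC Cs) A_real A_reg D_factor r_in Ui_causal UE.
have H_conj t : H t = map_mx Num.conj (H (- t)) by apply: ss_tf_conj.
have L_conj t : L t = map_mx Num.conj (L (- t)) by apply: ss_tf_conj.
have S_conj t : 1%:M + H t *m ctr (H t) =
    map_mx Num.conj (1%:M + H (- t) *m ctr (H (- t))).
  by rewrite map_mxD map_mxM map_mx1 -ctr_conj -H_conj.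
have Ko_conj t : Ko t = map_mx Num.conj (Ko (- t)).
  by rewrite /Ko /wiener_nc map_mxM map_mxM map_invmx -S_conj -ctr_conj -L_conj -H_conj.
have PQ_conj t : PQ t = map_mx Num.conj (PQ (- t)).
  rewrite /PQ map_scalar_mx (lpoly_conj p m t) (lpoly_conj q m t).
  by congr (_%:M); apply/esym/fmorph_div.
have [V VV DV] := lcanonical_factor_uniq D_factor (lcanonical_factor_conj S_conj D_factor).
have [w ww Uw] := lcanonical_factor_uniq (rcanonical_lcanonical U_factor)
  (lcanonical_factor_conj PQ_conj (rcanonical_lcanonical U_factor)).
(* The conjugated factors are canonical for the same data, so they differ from D and U by constants,
   which the filter does not see. *)
have K_conj : (fun t => map_mx Num.conj (filter_tf Ko D U (- t))) = filter_tf Ko D U.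
  have uV : V \in unitmx by case: (mulmx1_unit VV).
  apply: etrans _ (filter_tf_unit_factor uD uU uV (scalar_unitary ww) hT hUT).
  have eD : (fun t => map_mx Num.conj (D (- t))) = (fun t => D t *m V) by apply/funext.
  have eU : (fun t => map_mx Num.conj (U (- t))) = (fun t => w 0 0 *: U t).
    by apply/funext => t; rewrite Uw [w]mx11_scalar mul_mx_scalar mxE eqxx mulr1n.
  rewrite -eD -eU; apply/funext => t.
  exact: esym (filter_tf_conj Ko_conj hT hUT t).
have f_real j : map_mx Num.conj (f j) = f j.
  have := wm_conj_opp hK; rewrite K_conj => h.
  exact: (congr1 (fun g : int -> 'M[R[i]]_(1, dy) => g j) (wm_uniq h hK)).
have [g [g0 sg] [N gN]] : exists2 g : {poly R[i]}, g != 0 /\ (size g <= (m + dx).+1)%N &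
    exists N, forall t, g.[expi t] *: filter_tf Ko D U t = rowpoly (m + dx).+1 N t :=
  filter_annihilator (mxC Cs) A_real A_reg D_factor ss s_in r_in e0
  Ui_causal UE.
(* g K equals a polynomial on the circle, so by uniqueness of coefficients it has none at positive
   indices. *)
apply: (rational_realizes hK f_causal f_real g0 sg) => j.
have h1 := wm_mulpoly g hK.
have h2 := wm_sum (fun i : 'I_(m + dx).+1 => wm_shiftn i (wm_cst (N i))).
have eN : (fun t => g.[expi t] *: filter_tf Ko D U t)
    = (fun t => \sum_(i < (m + dx).+1) expi t ^+ i *: N i) by apply/funext => t; rewrite gN.
rewrite eN in h1.
have -> := congr1 (fun g : int -> 'M[R[i]]_(1, dy) => g (Posz j.+1)) (wm_uniq h1 h2).
by apply: big1 => i _; exact: scale0r.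
Qed.
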